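(* Let $k$ be an algebraically closed field of characteristic zero, and let $X\subset\mathbb{P}^4_{x_1,\dots,x_5}$ be a cubic threefold over $k$ given either by $$x_3x_4^2+(x_1x_2+x_3^2)x_5+e_1x_4^2x_5+e_2x_4x_5^2+e_3x_5^3=0,\qquad e_1,e_2,e_3\in k,$$ or by $$x_5(x_1x_2+x_3^2)+x_4^3+e_1x_4x_5^2+e_2x_5^3=0,\qquad e_1,e_2\in k.$$ Then $X$ is $G$-unirational for all finite subgroups $G\subseteq\mathrm{Aut}(X)$.
   Context: A variety $X$ with an action of a finite group $G$ is called $G$-unirational if it is $G$-equivariantly dominated by the projectivization of a linear representation of $G$, i.e. there exist a $G$-representation $V$ and a dominant $G$-equivariant rational map $\mathbb{P}(V)\dashrightarrow X$. *)

(* Defs.v *)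
From HB Require Import structures.
From mathcomp Require Import all_boot all_order all_algebra all_fingroup.
From mathcomp Require Import mxrepresentation.
From mathcomp Require Export mpoly.

Set Implicit Arguments.
Unset Strict Implicit.
Unset Printing Implicit Defensive.

Import GRing.Theory.
Local Open Scope ring_scope.

(* Varieties are treated classically: over an algebraically closed field a     *)
(* variety is identified with its set of closed points.                       *)

(* [proj k n] is P(k^n), i.e. projective space of dimension n - 1: its points  *)
(* are the lines through the origin in the space of column vectors k^n.        *)
Record proj (k : fieldType) (n : nat) := Proj {
  line :> {vspace 'cV[k]_n};
  line_dim : \dim line == 1%N
}.

HB.instance Definition _ (k : fieldType) (n : nat) :=
  [isSub for @line k n].
HB.instance Definition _ (k : fieldType) (n : nat) :=
  [Choice of proj k n by <:].

Section Projective.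
Variable k : closedFieldType.

(* Some choice of homogeneous coordinates of p. It is only used below in ways  *)
(* that do not depend on the choice, namely to evaluate one homogeneous form up *)
(* to zero / nonzero, or several forms of one degree up to a common scalar.     *)
Definition hcoord n (p : proj k n) : 'cV[k]_n := vpick p.

Definition eval_at n (F : {mpoly k[n]}) (p : proj k n) : k :=
  F.@[fun i => hcoord p i 0].

Definition zeros n (s : seq {mpoly k[n]}) : pred (proj k n) :=
  fun p => all (fun F => eval_at F p == 0) s.

Definition zariski_closed n (C : pred (proj k n)) : Prop :=
  exists s : seq {mpoly k[n]},
    (forall F, F \in s -> exists d, F \is d.-homog) /\ C =1 zeros s.

Definition zariski_open n (U : pred (proj k n)) : Prop :=
  zariski_closed (predC U).

(* A map f from a locally closed A in P(k^n) to P(k^m) is regular if, near each *)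
(* point of A, it is p |-> [F_1(p) : ... : F_m(p)] for forms F_i of one degree. *)
(* The F_i cannot all vanish at a point of W, because a [proj] is a line and    *)
(* <[0]>%VS is not.                                                            *)
Definition regular n m (A : pred (proj k n))
    (f : {p : proj k n | A p} -> proj k m) : Prop :=
  forall p : {p : proj k n | A p},
  exists (W : pred (proj k n)) (d : nat) (F : 'I_m -> {mpoly k[n]}),
    [/\ zariski_open W,
        W (val p),
        forall i, F i \is d.-homog
      & forall q : {p : proj k n | A p}, W (val q) ->
          line (f q) = <[\col_i eval_at (F i) (val q)]>%VS].

Definition is_automorphism n (A : pred (proj k n))
    (f : {p : proj k n | A p} -> {p : proj k n | A p}) : Prop :=
  regular (fun p => val (f p)) /\
  exists g : {p : proj k n | A p} -> {p : proj k n | A p},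
    [/\ cancel f g, cancel g f & regular (fun p => val (g p))].

(* A finite subgroup of Aut(A), presented as the image of an injective group   *)
(* homomorphism a from a finite group gT to Aut(A) (under composition).        *)
Definition finite_subgroup_of_Aut n (A : pred (proj k n)) (gT : finGroupType)
    (a : gT -> {p : proj k n | A p} -> {p : proj k n | A p}) : Prop :=
  [/\ forall g, is_automorphism (a g),
      forall g h, a (g * h)%g =1 a g \o a h
    & forall g h, a g =1 a h -> g = h].

Lemma proj_mx_subproof n (M : 'M[k]_n) (uM : M \in unitmx) (p : proj k n) :
  \dim (linfun (mulmx M : 'cV[k]_n -> 'cV[k]_n) @: line p)%VS == 1%N.
Proof.
rewrite limg_dim_eq ?line_dim //.
suff /eqP -> : lker (linfun (mulmx M : 'cV[k]_n -> 'cV[k]_n)) == 0%VS.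
  exact: capv0.
by apply/lker0P => u v; rewrite !lfunE /= => /(can_inj (mulKmx uM)).
Qed.

(* The projective transformation [v] |-> [M v].                                *)
Definition proj_mx n (M : 'M[k]_n) (uM : M \in unitmx) (p : proj k n) :
  proj k n := Proj (proj_mx_subproof uM p).

Definition proj_repr (gT : finGroupType) n
    (rG : mx_representation k [set: gT] n) (g : gT) : proj k n -> proj k n :=
  proj_mx (repr_mx_unit rG (in_setT g)).

(* The rational map P(V) --> A is represented by a regular map phi on a        *)
(* nonempty open U (dense, as P(V) is irreducible); equivariance is an         *)
(* identity of rational maps, so it is imposed where both sides are defined    *)
(* by phi, and U need not be stable under the group.                           *)
Definition G_unirational n (A : pred (proj k n)) (gT : finGroupType)
    (a : gT -> {p : proj k n | A p} -> {p : proj k n | A p}) : Prop :=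
  exists (N : nat) (rG : mx_representation k [set: gT] N)
         (U : pred (proj k N))
         (phi : {p : proj k N | U p} -> {p : proj k n | A p}),
    [/\ zariski_open U /\ (exists p, U p),
        regular (fun p => val (phi p)),
        forall g (p q : {p : proj k N | U p}),
          val q = proj_repr rG g (val p) -> phi q = a g (phi p)
      & forall C : pred (proj k n), zariski_closed C ->
          (forall p, C (val (phi p))) -> forall x, A x -> C x].

(* The coordinates x_1, ..., x_5 on P^4 = proj k 5.                            *)
Definition x_ (i : nat) : {mpoly k[5]} := 'X_(inord i.-1 : 'I_5).

Definition cubic1 (e1 e2 e3 : k) : {mpoly k[5]} :=
  x_ 3 * x_ 4 ^+ 2 + (x_ 1 * x_ 2 + x_ 3 ^+ 2) * x_ 5
  + e1 *: (x_ 4 ^+ 2 * x_ 5) + e2 *: (x_ 4 * x_ 5 ^+ 2) + e3 *: x_ 5 ^+ 3.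

Definition cubic2 (e1 e2 : k) : {mpoly k[5]} :=
  x_ 5 * (x_ 1 * x_ 2 + x_ 3 ^+ 2) + x_ 4 ^+ 3
  + e1 *: (x_ 4 * x_ 5 ^+ 2) + e2 *: x_ 5 ^+ 3.

(* Both cubics are irreducible polynomials, so the zero set carries the same   *)
(* information as the (integral) hypersurface.                                 *)
Definition hypersurface (F : {mpoly k[5]}) : pred (proj k 5) := zeros [:: F].

End Projective.

(* Main.v *)
Require Import Defs.
From HB Require Import structures.
From mathcomp Require Import all_boot all_algebra all_fingroup.
From mathcomp Require Import mxrepresentation.
From mathcomp Require Import mpoly ring zify.
From Stdlib Require Import Classical FunctionalExtensionality.

Set Implicit Arguments.
Unset Strict Implicit.
Unset Printing Implicit Defensive.

Import GRing.Theory.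
Local Open Scope ring_scope.

(** Number the coordinates from 0. Both families consist of cubics [x_0 x_1
    x_4 + g(x_2, x_3, x_4) = 0] that are singular along the conic [x_0 x_1 +
    x_2^2 = 0] of the plane [x_3 = x_4 = 0]. The proof has three steps.

    Every automorphism of [X] is induced by a matrix. The affine slice [x_1 =
    1] of the cone over [X] is a quotient of an affine space: by the cube
    roots of unity in the second family ([cuspidal_chart]), by a
    one-dimensional torus in the first ([toric_chart]). Polynomial rings are
    factorial ([ufd_mpoly]), so over this slice a regular map is given by a
    single vector of polynomials without common factor, and this vector
    descends to forms ([chart_forms]). The same holds for [x_0 = 1]. The two
    vectors of forms differ by a function without zeros or poles outside of
    [x_0 x_1 = 0]. On the slice [x_1 = 1], all functions with zeros and poles
    in [x_0 = 0] are powers of [x_0] up to constants ([chart_units]), hence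
    that function is a monomial in [x_0] and [x_1], and the vectors can be
    corrected so as to agree. They then extend over [x_0 = x_1 = 0], which has
    codimension two, and the map is given on all of [X] by forms of one degree
    without common zeros ([global_forms]). Degrees multiply under composition,
    so for an automorphism the degree is one ([linear_automorphism]).

    These matrices have a simple shape. A linear symmetry preserves the
    singular conic and the plane that it spans, and comparing the coefficients
    of [F] shows that it multiplies [x_0 x_1 + x_2^2], [x_3] and [x_4] by
    scalars; in the first family it moreover preserves [x_2] up to a scalar.
    Normalized to fix [x_4], the matrices of a finite group of automorphisms
    multiply, so they form a linear representation on [V = k^5]
    ([group_matrices]).

    There is an equivariant dominant rational map from [P(V + V)] to [X],
    given by explicit forms. In the first family the plane [x_2 = x_4 = 0]
    lies in [X] and is stable. Project [v] to a point [p] of this plane,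
    correct the second vector [z] along the last basis vector to a tangent
    direction at [p], and take the residual point of [X] on that tangent line
    ([toric_map]). In the second family, [v] yields a pair of points of [X]
    that are conjugate over a quadratic extension of the field of functions;
    with the help of [w] one moves each along a tangent line, and the line
    joining the two new points meets [X] in a third, rational, point
    ([cusp_map]). All ingredients are covariants of the structure that
    symmetries preserve, and dominance is checked by solving the equations:
    directly in the first family ([toric_map_dominant]), and in the second
    after using reflections of the quadratic form [x_0 x_1 + x_2^2] to reduce
    to the last two coordinates ([cusp_map_dominant]). *)

(** * Factorial domains *)

Section Divisibility.
Variable R : idomainType.
Implicit Types a b c p q u x : R.

Definition divides a b := exists c, b = c * a.

Definition prime_elt p :=
  [/\ p != 0, p \isn't a GRing.unit
    & forall a b, divides p (a * b) -> divides p a \/ divides p b].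

Definition ufd := forall x, x != 0 ->
  exists u (s : seq R),
    [/\ u \is a GRing.unit, {in s, forall p, prime_elt p}
      & x = u * \prod_(p <- s) p].

Lemma divides_refl a : divides a a.
Proof. by exists 1; rewrite mul1r. Qed.

Lemma divides_trans b a c : divides a b -> divides b c -> divides a c.
Proof. by move=> [x ->] [y ->]; exists (y * x); rewrite mulrA. Qed.

Lemma divides_mull a b c : divides a b -> divides a (c * b).
Proof. by move=> [x ->]; exists (c * x); rewrite mulrA. Qed.

Lemma divides_add a b c : divides a b -> divides a c -> divides a (b + c).
Proof. by move=> [x ->] [y ->]; exists (x + y); rewrite mulrDl. Qed.

Lemma divides_prod p u (s : seq R) : prime_elt p -> u \is a GRing.unit ->
  divides p (u * \prod_(q <- s) q) -> exists2 q, q \in s & divides p q.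
Proof.
move=> pp uu; elim: s => [|q s IH] in u uu *.
  rewrite big_nil mulr1 => -[c cE]; case: pp => _ /negP[].
  by move: uu; rewrite cE unitrM => /andP[].
rewrite big_cons mulrCA => d; have [_ _ /(_ _ _ d)[dq|ds]] := pp.
  by exists q => //; rewrite inE eqxx.
by have [x xs xd] := IH u uu ds; exists x => //; rewrite inE xs orbT.
Qed.

Lemma divides_prime p q : prime_elt p -> prime_elt q -> divides p q -> divides q p.
Proof.
move=> [_ pu _] [q0 qu qp] [c cE].
have [|[d dE]|//] := qp c p; first by exists 1; rewrite mul1r cE.
have dp : d * p = 1 by apply: (mulIf q0); rewrite mul1r [RHS]cE dE mulrAC.
by case/negP: pu; apply/unitrP; exists d; rewrite [p * d]mulrC dp.
Qed.

End Divisibility.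

Section UFDPoly.
Variable R : idomainType.
Hypothesis ufdR : ufd R.
Implicit Types f g q t : {poly R}.

(** A product with all coefficients divisible by [p] has [p] dividing one of the
    leading coefficients; removing that leading term lowers the total size. *)
Lemma prime_polyC (p : R) : prime_elt p -> prime_elt p%:P.
Proof.
move=> [p0 pu pp]; split; first by rewrite polyC_eq0.
  apply: contra pu; rewrite poly_unitE size_polyC p0 /= coefC eqxx.
  by [].
move=> a b; have [n] := ubnP (size a + size b)%N; elim: n => // n IH in a b *.
rewrite ltnS => len [c cE].
have [->|a0] := eqVneq a 0; first by left; exists 0; rewrite mul0r.
have [->|b0] := eqVneq b 0; first by right; exists 0; rewrite mul0r.
have drop_lead (h : {poly R}) : h != 0 ->
    exists h', h = h' + (lead_coef h)%:P * 'X ^+ (size h).-1 /\ (size h' < size h)%N.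
  move=> h0; exists (h - (lead_coef h)%:P * 'X ^+ (size h).-1).
  rewrite subrK; split=> //; rewrite mul_polyC.
  rewrite -(@prednK (size h)) ?size_poly_gt0 // ltnS.
  apply/leq_sizeP => j jle; rewrite coefB coefZ coefXn.
  move: jle; rewrite leq_eqVlt => /predU1P[<-|lt].
    by rewrite eqxx mulr1 subrr.
  by rewrite gtn_eqF // mulr0 subr0 nth_default // -(@prednK (size h)) ?size_poly_gt0.
have lab : divides p (lead_coef a * lead_coef b).
  exists (lead_coef c); rewrite -lead_coefM cE lead_coefM lead_coefC //.
have [[d dE]|[d dE]] := pp _ _ lab.
- have [a' [aE sa]] := drop_lead a a0.
  have pa : divides p%:P ((lead_coef a)%:P * 'X ^+ (size a).-1).
    by exists (d%:P * 'X ^+ (size a).-1); rewrite dE polyCM mulrAC.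
  have [||da|db] := IH a' b; last by right.
  + by apply: leq_trans len; rewrite ltn_add2r.
  + have [e eE] := pa; exists (c - e * b); rewrite mulrBl -cE [in a * b]aE mulrDl eE.
    by rewrite mulrAC addrK.
  by left; rewrite aE; apply: divides_add.
- have [b' [bE sb]] := drop_lead b b0.
  have pb : divides p%:P ((lead_coef b)%:P * 'X ^+ (size b).-1).
    by exists (d%:P * 'X ^+ (size b).-1); rewrite dE polyCM mulrAC.
  have [||da|db] := IH a b'; first by apply: leq_trans len; rewrite ltn_add2l.
  + have [e eE] := pb; exists (c - a * e); rewrite mulrBl -cE [in a * b]bE mulrDr eE.
    by rewrite mulrA addrK.
  + by left.
  by right; rewrite bE; apply: divides_add.
Qed.

(** Content-free polynomials, in a form that avoids greatest common divisors. *)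
Definition primitive f := forall p : R, prime_elt p -> ~ divides p%:P f.

(** A prime dividing [f] divides its leading coefficient, which has finitely many
    prime factors: dividing them out one by one terminates. *)
Lemma primitive_part f : f != 0 ->
  exists (c : R) (f0 : {poly R}), [/\ c != 0, primitive f0 & f = c%:P * f0].
Proof.
move=> f0; have [u [s [uu sp lE]]] : exists u (s : seq R), [/\ u \is a GRing.unit,
    {in s, forall p, prime_elt p} & divides (lead_coef f) (u * \prod_(p <- s) p)].
  have [|u [s [uu sp lE]]] := ufdR (x := lead_coef f); first by rewrite lead_coef_eq0.
  by exists u, s; split=> //; rewrite -lE; apply: divides_refl.
have [n] := ubnP (size s); elim: n => // n IH in f f0 s sp lE *; rewrite ltnS => len.
have [[q [qp qf]]|no] := classic (exists q : R, prime_elt q /\ divides q%:P f); last first.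
  exists 1, f; split; rewrite ?oner_neq0 ?mul1r //.
  by move=> p pp pf; apply: no; exists p.
have ql : divides q (u * \prod_(p <- s) p).
  apply: divides_trans lE; have [c ->] := qf; exists (lead_coef c).
  by rewrite lead_coefM lead_coefC.
have [p ps qdp] := divides_prod qp uu ql.
have [e eE] := qf; have [d dE] := divides_prime qp (sp p ps) qdp.
pose f1 := e * d%:P; have fE : f = f1 * p%:P by rewrite eE dE polyCM mulrA.
have f10 : f1 != 0 by apply: contraNneq f0 => f10; rewrite fE f10 mul0r.
have p0 : p != 0 by have [] := sp p ps.
have [|||c [f2 [c0 f2p f2E]]] := IH f1 f10 (rem p s).
- by move=> x /mem_rem /sp.
- have [z zE] := lE; exists z; apply: (mulIf p0).
  rewrite -[RHS]mulrA -[p in RHS](lead_coefC p) -lead_coefM -fE -zE.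
  by rewrite [in RHS](big_rem p) //= mulrCA mulrC.
- by apply: leq_trans len; rewrite size_rem // prednK //; case: (s) ps.
by exists (c * p), f2; rewrite mulf_neq0 // fE f2E polyCM mulrAC.
Qed.

(** Gauss lemma: the primes of [c] stay prime in the polynomial ring and cannot
    divide [f]. *)
Lemma primitive_gauss f g (c : R) : primitive f -> c != 0 ->
  divides f (c%:P * g) -> divides f g.
Proof.
move=> fp c0; have [u [s [uu sp cE]]] := ufdR c0; rewrite {c c0}cE.
elim: s => [|p s IH] in g sp *.
  rewrite big_nil mulr1 => -[t tE]; exists (u^-1%:P * t).
  by rewrite -mulrA -tE mulrA -polyCM mulVr // mul1r.
have ppr : prime_elt p by apply: sp; rewrite inE eqxx.
rewrite big_cons mulrCA polyCM -mulrA => -[t tE].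
have [_ _ pp] := prime_polyC ppr.
have [|[t' t'E]|] := pp t f; last by move/(fp _ ppr).
  by exists ((u * \prod_(j <- s) j)%:P * g); rewrite -tE mulrC.
apply: IH; first by move=> x xs; apply: sp; rewrite inE xs orbT.
exists t'; have p0 : p%:P != 0 :> {poly R} by rewrite polyC_eq0; case: ppr.
by apply: (mulfI p0); rewrite tE t'E mulrAC mulrC mulrA.
Qed.

Lemma primitive_dvdp f g : primitive f -> (f %| g)%R -> divides f g.
Proof.
move=> fp /Pdiv.WeakIdomain.dvdpP[[c q] /= c0 cE].
by apply: (primitive_gauss fp c0); exists q; rewrite mul_polyC.
Qed.

Lemma divides_dvdp f g : divides f g -> f %| g.
Proof. by move=> [c ->]; apply: dvdp_mull. Qed.

(** Divisibility by a primitive polynomial can be tested up to constants, that is,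
    over the field of fractions, where irreducible elements are prime. *)
Lemma primitive_prime f : primitive f -> (1 < size f)%N -> irreducible_poly f ->
  prime_elt f.
Proof.
move=> fp sf [_ irr]; split.
- by rewrite -size_poly_gt0 (ltn_trans _ sf).
- by rewrite poly_unitE gtn_eqF.
move=> a b /divides_dvdp fab; have [cop|ncop] := boolP (coprimep f a).
  by right; apply: primitive_dvdp => //; rewrite -(Gauss_dvdpr _ cop).
left; apply: primitive_dvdp => //.
have := irr (gcdp f a); rewrite -coprimep_def ncop dvdp_gcdl => /(_ isT isT) e.
by rewrite -(eqp_dvdl _ e) dvdp_gcdr.
Qed.

(** A primitive polynomial without primitive divisor of smaller positive degree is
    irreducible up to constants. *)
Lemma exists_prime_factor f : primitive f -> (1 < size f)%N ->
  exists g, [/\ prime_elt g, (1 < size g)%N & divides g f].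
Proof.
move=> fp sf.
have [n] := ubnP (size f); elim: n => // n IH in f fp sf *; rewrite ltnS => len.
have [[g [gp sg gf lt]]|no] := classic (exists g : {poly R}, [/\ primitive g, (1 < size g)%N,
    divides g f & (size g < size f)%N]).
  have [|h [hp sh hg]] := IH g gp sg; first exact: leq_trans len.
  by exists h; split=> //; apply: divides_trans gf.
exists f; split=> //; last exact: divides_refl.
apply: primitive_prime => //; split=> // q sq qf.
have f0 : f != 0 by rewrite -size_poly_gt0 (ltn_trans _ sf).
have q0 : q != 0 by apply: contraNneq f0 => q0; move: qf; rewrite q0 dvd0p.
have [c [q1 [c0 q1p qE]]] := primitive_part q0.
have sqE : size q = size q1 by rewrite qE mul_polyC size_scale.
have q1f : divides q1 f.
  apply: primitive_dvdp => //; apply: dvdp_trans qf.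
  by rewrite qE dvdp_mull.
rewrite -dvdp_size_eqp //; apply/eqP; rewrite sqE; apply/eqP.
rewrite eqn_leq -sqE dvdp_leq //= sqE leqNgt; apply/negP => lt.
apply: no; exists q1; split=> //.
by rewrite -sqE ltn_neqAle eq_sym sq size_poly_gt0.
Qed.

Lemma ufd_poly : ufd {poly R}.
Proof.
move=> f; have [n] := ubnP (size f); elim: n => // n IH in f *; rewrite ltnS.
move=> len f0; have [c [g [c0 gp fE]]] := primitive_part f0.
have [u [s [uu sp cE]]] := ufdR c0.
have sE : size f = size g by rewrite fE mul_polyC size_scale.
have g0 : g != 0 by apply: contraNneq f0 => g0; rewrite fE g0 mulr0.
have cfact : exists u (s : seq {poly R}), [/\ u \is a GRing.unit,
    {in s, forall p, prime_elt p} & c%:P = u * \prod_(p <- s) p].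
  exists u%:P, (map polyC s); split.
  - have u0 : u != 0 by apply: contraTneq uu => ->; rewrite unitr0.
    by rewrite poly_unitE coefC eqxx size_polyC uu u0.
  - by move=> _ /mapP[p ps ->]; apply/prime_polyC/sp.
  by rewrite cE polyCM big_map rmorph_prod.
have gfact : exists u (s : seq {poly R}), [/\ u \is a GRing.unit,
    {in s, forall p, prime_elt p} & g = u * \prod_(p <- s) p].
  have [sg|sg] := leqP (size g) 1.
    exists g, [::]; rewrite big_nil mulr1; split=> //.
    have s1 : size g == 1 by rewrite eqn_leq sg size_poly_gt0.
    rewrite poly_unitE s1 /=.
    have gE := size1_polyC sg; have c00 : g`_0 != 0 by rewrite -polyC_eq0 -gE.
    have [v [[|p s'] [vu s'p vE]]] := ufdR c00; first by rewrite vE big_nil mulr1.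
    have ppr : prime_elt p by apply: s'p; rewrite inE eqxx.
    case: (gp p ppr); rewrite gE vE big_cons mulrCA mulrC polyCM.
    by apply: divides_mull; apply: divides_refl.
  have [h [hp sh [g1 g1E]]] := exists_prime_factor gp sg.
  have g10 : g1 != 0 by apply: contraNneq g0 => g10; rewrite g1E g10 mul0r.
  have h0 : h != 0 by case: hp.
  have [|v [s' [vu s'p vE]]] := IH g1 _ g10.
    apply: leq_trans len; rewrite sE g1E size_mul // -ltnS prednK ?addn_gt0 ?size_poly_gt0 ?g10 //.
    by rewrite -[X in (X < _)%N]addn1 ltn_add2l.
  exists v, (h :: s'); split=> //; last by rewrite big_cons g1E vE mulrC mulrCA.
  by move=> p; rewrite inE => /predU1P[->|/s'p].
have [u1 [s1 [u1u s1p u1E]]] := cfact; have [u2 [s2 [u2u s2p u2E]]] := gfact.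
exists (u1 * u2), (s1 ++ s2); split; first by rewrite unitrM u1u.
  by move=> p; rewrite mem_cat => /orP[/s1p|/s2p].
by rewrite fE u1E u2E big_cat /= mulrACA.
Qed.

End UFDPoly.

(** * Vectors without common factor *)

Section UFDVector.
Variables (R : idomainType) (m : nat).
Hypothesis ufdR : ufd R.
Implicit Types F G : 'I_m -> R.

Definition parallel F G := forall i j, F i * G j = F j * G i.

(** The universal property of a vector of coprime entries: it generates the
    vectors on the same line. *)
Definition primitive_vector F :=
  forall G, parallel G F -> exists c, forall i, G i = c * F i.

(** If [G] is parallel to [F] then [F i0] divides [G i0 * F j] for all [j]; since no
    prime divides all the [F j], the primes of [F i0] all divide [G i0]. *)
Lemma coprime_entries_primitive F i0 : F i0 != 0 ->
  (forall p, prime_elt p -> ~ forall i, divides p (F i)) -> primitive_vector F.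
Proof.
move=> F0 cop G GF.
have key : forall u (s : seq R), u \is a GRing.unit -> {in s, forall p, prime_elt p} ->
    forall g, (forall j, divides (u * \prod_(p <- s) p) (g * F j)) ->
    divides (u * \prod_(p <- s) p) g.
  move=> u s uu; elim: s => [|p s IH] sp g d.
    by exists (g / u); rewrite big_nil mulr1 divrK.
  have sp' : {in s, forall p, prime_elt p}.
    by move=> x xs; apply: sp; rewrite inE xs orbT.
  have ppr : prime_elt p by apply: sp; rewrite inE eqxx.
  have [|e eE] := IH sp' g.
    by move=> j; apply: divides_trans (d j); exists p; rewrite big_cons mulrCA.
  have p0 : p != 0 by case: ppr.
  have s0 : u * \prod_(j <- s) j != 0.
    rewrite mulf_neq0 //; first by apply: contraTneq uu => ->; rewrite unitr0.
    by rewrite prodf_seq_neq0; apply/allP => x /sp' [].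
  have [pd|pe] := classic (divides p e).
    by have [f fE] := pd; exists f; rewrite eE fE big_cons [u * _ in RHS]mulrCA [RHS]mulrA.
  case: (cop p ppr) => i; have [t tE] := d i.
  have : divides p (e * F i).
    exists t; apply: (mulIf s0); rewrite mulrAC -eE tE big_cons.
    by rewrite [u * _ in LHS]mulrCA [LHS]mulrA.
  by have [_ _ pp] := ppr => /pp[/pe|].
have [u [s [uu sp fE]]] := ufdR F0.
have [|c cE] := key u s uu sp (G i0).
  by move=> j; exists (G j); rewrite -fE GF.
exists c => i; apply: (mulIf F0).
by rewrite -GF cE -fE mulrAC.
Qed.

Lemma exists_primitive_vector F i0 : F i0 != 0 ->
  exists c F', [/\ c != 0, forall i, F i = c * F' i & primitive_vector F'].
Proof.
move=> F0; have [u [s [uu sp fE]]] := ufdR F0.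
have {fE}lE : divides (F i0) (u * \prod_(p <- s) p) by rewrite -fE; apply: divides_refl.
have [n] := ubnP (size s); elim: n => // n IH in F F0 s sp lE *; rewrite ltnS => len.
have [[q [qp qf]]|no] := classic (exists q, prime_elt q /\ forall i, divides q (F i)); last first.
  exists 1, F; split=> [|i|]; first exact: oner_neq0; first by rewrite mul1r.
  by apply: (coprime_entries_primitive F0) => p pp pf; apply: no; exists p.
have [p ps qdp] := divides_prod qp uu (divides_trans (qf i0) lE).
have ppr := sp p ps; have p0 : p != 0 by case: ppr.
have pf i : divides p (F i) := divides_trans (divides_prime qp ppr qdp) (qf i).
have [F1 F1E] := fin_all_exists pf.
have F10 : F1 i0 != 0 by apply: contraNneq F0 => z; rewrite F1E z mul0r.
have [|||c [F2 [c0 F2E F2p]]] := IH F1 F10 (rem p s).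
- by move=> x /mem_rem /sp.
- have [z zE] := lE; exists z; apply: (mulIf p0).
  by rewrite -[RHS]mulrA -F1E -zE [in RHS](big_rem p) //= mulrCA mulrC.
- by apply: leq_trans len; rewrite size_rem // prednK //; case: (s) ps.
by exists (c * p), F2; split=> // [|i]; rewrite ?mulf_neq0 // F1E F2E mulrAC.
Qed.

End UFDVector.

Lemma ufd_iso (R S : idomainType) (f : {rmorphism R -> S}) (g : {rmorphism S -> R}) :
  cancel f g -> cancel g f -> ufd S -> ufd R.
Proof.
move=> fK gK ufdS x x0; have fI := can_inj fK.
have [|u [s [uu sp fE]]] := ufdS (f x); first by rewrite -(rmorph0 f) (inj_eq fI).
have gprime p : prime_elt p -> prime_elt (g p).
  move=> [p0 pu pp]; split.
  - by rewrite -(rmorph0 g) (inj_eq (can_inj gK)).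
  - by apply: contra pu => gu; rewrite -(gK p) rmorph_unit.
  move=> a b [c cE]; have [||] := pp (f a) (f b).
  - by exists (f c); rewrite -rmorphM cE rmorphM gK.
  - by move=> [d dE]; left; exists (g d); rewrite -rmorphM -dE fK.
  - by move=> [d dE]; right; exists (g d); rewrite -rmorphM -dE fK.
exists (g u), (map g s); split; first exact: rmorph_unit.
  by move=> _ /mapP[p ps ->]; apply/gprime/sp.
by rewrite -(fK x) fE rmorphM rmorph_prod big_map.
Qed.

(** * Polynomials in several variables *)

Section MPolyUFD.
Variable k : fieldType.

Lemma mpoly_morph_ext n (S : pzRingType) (f g : {rmorphism {mpoly k[n]} -> S}) :
  (forall c, f c%:MP = g c%:MP) -> (forall i, f 'X_i = g 'X_i) -> f =1 g.
Proof.
move=> fc fX p; rewrite [p]mpolyE !rmorph_sum; apply: eq_bigr => m _.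
rewrite -mul_mpolyC !rmorphM fc mpolyXE_id !rmorph_prod; congr (_ * _).
by apply: eq_bigr => i _; rewrite !rmorphXn fX.
Qed.

Lemma muniX_widen n (i : 'I_n) : muni ('X_(widen_ord (leqnSn n) i) : {mpoly k[n.+1]}) =
  ('X_i : {mpoly k[n]})%:P.
Proof.
rewrite muniE msuppX big_seq1 mcoeffX eqxx scale1r mnmE.
have -> : (widen_ord (leqnSn n) i == ord_max :> 'I_n.+1) = false.
  by apply/eqP => /(congr1 val) /= e; have := ltn_ord i; rewrite e ltnn.
rewrite expr0 -mul_polyC mulr1; congr (_%:P); congr ('X_[ _]).
by apply/mnmP => j; rewrite !mnmE; congr nat_of_bool; apply/eqP/eqP => [/(congr1 val) /val_inj //| ->].
Qed.

Lemma muniX_max n : muni ('X_ord_max : {mpoly k[n.+1]}) = 'X.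
Proof.
rewrite muniE msuppX big_seq1 mcoeffX eqxx scale1r mnmE eqxx expr1.
have -> : [multinom (U_(ord_max : 'I_n.+1))%MM (widen_ord (leqnSn n) i) | i < n] = 0%MM.
  apply/mnmP => j; rewrite !mnmE; case: eqP => // /(congr1 val) /= e.
  by have := ltn_ord j; rewrite -e ltnn.
by rewrite mpolyX0 scale1r.
Qed.

(** The inverse of [muni], which views a polynomial as one in its last variable. *)
Definition muni_inv n (p : {poly {mpoly k[n]}}) : {mpoly k[n.+1]} :=
  (map_poly (@mwiden n k) p).['X_ord_max].

HB.instance Definition _ n := GRing.RMorphism.copy (@muni_inv n)
  (horner_eval 'X_ord_max \o map_poly (@mwiden n k)).

Lemma muni_invX n : muni_inv 'X = 'X_ord_max :> {mpoly k[n.+1]}.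
Proof. by rewrite /muni_inv map_polyX hornerX. Qed.

Lemma muni_invC n (c : {mpoly k[n]}) : muni_inv c%:P = mwiden c.
Proof. by rewrite /muni_inv map_polyC hornerC. Qed.

Lemma mwidenXU n (i : 'I_n) : mwiden ('X_i : {mpoly k[n]}) = 'X_(widen_ord (leqnSn n) i).
Proof. by rewrite mwidenX mnmwiden1. Qed.

Lemma ord_max_or_widen n (i : 'I_n.+1) :
  i = ord_max \/ exists j : 'I_n, i = widen_ord (leqnSn n) j.
Proof.
have [lt|ge] := ltnP i n; first by right; exists (Ordinal lt); apply: val_inj.
by left; apply: val_inj; apply/eqP; rewrite eqn_leq -ltnS ltn_ord.
Qed.

Lemma muniK n : cancel (@muni n k) (@muni_inv n).
Proof.
apply: (mpoly_morph_ext (f := @muni_inv n \o @muni n k) (g := idfun)) => [c|i] /=.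
  by rewrite muniC muni_invC mwidenC.
have [->|[j ->]] := ord_max_or_widen i; first by rewrite muniX_max muni_invX.
by rewrite muniX_widen muni_invC mwidenXU.
Qed.

Lemma muni_invK n : cancel (@muni_inv n) (@muni n k).
Proof.
have wK : forall c : {mpoly k[n]}, muni (mwiden c) = c%:P.
  apply: (mpoly_morph_ext (f := @muni n k \o @mwiden n k) (g := polyC)) => [c|i] /=.
    by rewrite mwidenC muniC.
  by rewrite mwidenXU muniX_widen.
move=> p; rewrite -[p]coefK poly_def !rmorph_sum; apply: eq_bigr => i _.
by rewrite -mul_polyC !rmorphM !rmorphXn /= muni_invC wK muni_invX muniX_max.
Qed.

Lemma ufd_mpoly n : ufd {mpoly k[n]}.
Proof.
elim: n => [|n IH]; last exact: ufd_iso (@muniK n) (@muni_invK n) (ufd_poly IH).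
move=> x x0; exists x, [::]; rewrite big_nil mulr1; split=> //.
have xE : x = (x@_0)%:MP.
  apply/mpolyP => m; rewrite mcoeffC; have -> : m = 0%MM by apply/mnmP; case.
  by rewrite eqxx mulr1.
rewrite xE; apply: rmorph_unit; rewrite unitfE; apply: contraNneq x0 => c0.
by rewrite xE c0 mpolyC0.
Qed.

End MPolyUFD.

Section Substitution.
Variable k : fieldType.

Definition msub n m (h : 'I_n -> {mpoly k[m]}) (p : {mpoly k[n]}) : {mpoly k[m]} :=
  mmap (@mpolyC m k) h p.

HB.instance Definition _ n m (h : 'I_n -> {mpoly k[m]}) :=
  GRing.RMorphism.copy (msub h) (mmap (@mpolyC m k) h).

Lemma msubC n m (h : 'I_n -> {mpoly k[m]}) c : msub h c%:MP = c%:MP.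
Proof. exact: mmapC. Qed.

Lemma msubX n m (h : 'I_n -> {mpoly k[m]}) i : msub h 'X_i = h i.
Proof. by rewrite /msub mmapX mmap1U. Qed.

Lemma msubD n m (h : 'I_n -> {mpoly k[m]}) p q : msub h (p + q) = msub h p + msub h q.
Proof. exact: rmorphD. Qed.

Lemma msubN n m (h : 'I_n -> {mpoly k[m]}) p : msub h (- p) = - msub h p.
Proof. exact: rmorphN. Qed.

Lemma msubM n m (h : 'I_n -> {mpoly k[m]}) p q : msub h (p * q) = msub h p * msub h q.
Proof. exact: rmorphM. Qed.

Lemma msubXn n m (h : 'I_n -> {mpoly k[m]}) p e : msub h (p ^+ e) = msub h p ^+ e.
Proof. exact: rmorphXn. Qed.

Lemma msub_eval n m (h : 'I_n -> {mpoly k[m]}) p v :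
  (msub h p).@[v] = p.@[fun i => (h i).@[v]].
Proof.
apply: (mpoly_morph_ext (f := meval v \o msub h) (g := meval _)) => [c|i] /=.
  by rewrite msubC !mevalC.
by rewrite msubX !mevalXU.
Qed.

Lemma mpoly_generated n (P : {mpoly k[n]} -> Prop) :
  (forall c, P c%:MP) -> (forall p q, P p -> P q -> P (p + q)) ->
  (forall i p, P p -> P ('X_i * p)) -> forall p, P p.
Proof.
move=> PC PD PX p; rewrite [p]mpolyE.
have P0 : P 0 by rewrite -(mpolyC0 n k).
elim/big_ind: _ => // m _.
rewrite -mul_mpolyC mulrC mpolyXE_id.
elim/big_rec: _ => [|i q _ IH]; first by rewrite mul1r.
rewrite -mulrA; elim: (m i) => [|e IHe]; first by rewrite expr0 mul1r.
by rewrite exprS -mulrA; apply: PX.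
Qed.

Lemma meval_curve n (p : {mpoly k[n]}) (c : 'I_n -> {poly k}) :
  exists q : {poly k}, forall t, q.[t] = p.@[fun i => (c i).[t]].
Proof.
exists (mmap polyC c p) => t.
apply: (mpoly_morph_ext (f := horner_eval t \o mmap polyC c) (g := meval _)) => [a|i] /=.
  by rewrite mmapC mevalC /horner_eval hornerC.
by rewrite mmapX mmap1U mevalXU.
Qed.

End Substitution.

Section ClosedField.
Variable k : closedFieldType.

Lemma poly_vanish (p : {poly k}) : (forall t, p.[t] = 0) -> p = 0.
Proof.
move=> p0; apply/eqP/negPn/negP => /closed_nonrootP[x xp].
by move: xp; rewrite /root p0 eqxx.
Qed.

Lemma poly_vanish_generic (p q : {poly k}) : q != 0 ->
  (forall t, q.[t] != 0 -> p.[t] = 0) -> p = 0.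
Proof.
move=> q0 pq; suff /eqP : p * q = 0 by rewrite mulf_eq0 (negPf q0) orbF => /eqP.
apply: poly_vanish => t; rewrite hornerM.
by have [->|/pq ->] := eqVneq q.[t] 0; rewrite ?mulr0 ?mul0r.
Qed.

Lemma nowhere_zero_poly (p : {poly k}) : (forall t, p.[t] != 0) -> p = (p.[0])%:P.
Proof.
move=> p0; rewrite horner_coef0; apply: size1_polyC; rewrite leqNgt; apply/negP => s1.
have /closed_rootP[x /eqP px] : size p != 1 by rewrite gtn_eqF.
by have := p0 x; rewrite px eqxx.
Qed.

Lemma muni_eval n (p : {mpoly k[n.+1]}) (v : 'I_n.+1 -> k) :
  p.@[v] = (map_poly (meval (fun i => v (widen_ord (leqnSn n) i))) (muni p)).[v ord_max].
Proof.
apply: (mpoly_morph_ext (f := meval v)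
  (g := horner_eval (v ord_max) \o map_poly (meval _) \o @muni n k)) => [c|i] /=.
  by rewrite muniC map_polyC /= !mevalC /horner_eval hornerC.
rewrite /horner_eval; have [->|[j ->]] := ord_max_or_widen i.
  by rewrite muniX_max map_polyX hornerX mevalXU.
by rewrite muniX_widen map_polyC hornerC /= !mevalXU.
Qed.

(** An algebraically closed field is infinite; induction on the number of
    variables. *)
Lemma mpoly_vanish n (p : {mpoly k[n]}) : (forall v, p.@[v] = 0) -> p = 0.
Proof.
elim: n p => [|n IH] p p0.
  apply/mpolyP => m; have pE : p = (p@_0)%:MP.
    apply/mpolyP => m'; rewrite mcoeffC; have -> : m' = 0%MM by apply/mnmP; case.
    by rewrite eqxx mulr1.
  have := p0 (fun=> 0); rewrite pE mevalC => ->; by rewrite mpolyC0.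
apply: (can_inj (@muniK k n)); rewrite rmorph0; apply/polyP => i; rewrite coef0.
apply: IH => v; rewrite -coef_map.
set q := map_poly _ _; suff -> : q = 0 by rewrite coef0.
apply: poly_vanish => t.
pose w (j : 'I_n.+1) := if unlift ord_max j is Some j' then v j' else t.
have := p0 w; rewrite muni_eval.
have -> : w ord_max = t by rewrite /w unlift_none.
have wE : (fun j => w (widen_ord (leqnSn n) j)) =1 v.
  move=> j; rewrite /w; have -> : widen_ord (leqnSn n) j = lift ord_max j.
    by apply: val_inj; rewrite /= /bump leqNgt ltn_ord.
  by rewrite liftK.
suff -> : map_poly (meval (fun j => w (widen_ord (leqnSn n) j))) (muni p) = q by [].
by apply/polyP => j; rewrite !coef_map /=; apply: meval_eq.
Qed.

Lemma mpoly_ext n (p q : {mpoly k[n]}) : (forall v, p.@[v] = q.@[v]) -> p = q.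
Proof.
by move=> pq; apply/eqP; rewrite -subr_eq0; apply/eqP/mpoly_vanish => v; rewrite mevalB pq subrr.
Qed.

Lemma mpoly_vanish_generic n (p q : {mpoly k[n]}) : q != 0 ->
  (forall v, q.@[v] != 0 -> p.@[v] = 0) -> p = 0.
Proof.
move=> q0 pq; suff /eqP : p * q = 0 by rewrite mulf_eq0 (negPf q0) orbF => /eqP.
apply: mpoly_vanish => v; rewrite mevalM.
by have [->|/pq ->] := eqVneq q.@[v] 0; rewrite ?mulr0 ?mul0r.
Qed.

(** Reduction modulo a variable, as an endomorphism of the polynomial ring. *)
Definition kill n (i : 'I_n) : {mpoly k[n]} -> {mpoly k[n]} :=
  msub (fun j => if j == i then 0 else 'X_j).

HB.instance Definition _ n (i : 'I_n) := GRing.RMorphism.copy (kill i)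
  (msub (fun j => if j == i then 0 else 'X_j)).

Lemma kill_eval n (i : 'I_n) p v :
  (kill i p).@[v] = p.@[fun j => if j == i then 0 else v j].
Proof.
rewrite msub_eval; apply: meval_eq => j.
by case: eqP => _; rewrite ?meval0 ?mevalXU.
Qed.

Lemma killX n (i j : 'I_n) : kill i 'X_j = if j == i then 0 else 'X_j.
Proof. exact: msubX. Qed.

Lemma killM n (i : 'I_n) : {morph kill i : p q / p * q}.
Proof. exact: rmorphM. Qed.

Lemma killD n (i : 'I_n) : {morph kill i : p q / p + q}.
Proof. exact: rmorphD. Qed.

Lemma kill_mod n (i : 'I_n) p : exists q, p = kill i p + 'X_i * q.
Proof.
elim/mpoly_generated: p => [c|p q [p' pE] [q' qE]|j p [p' pE]].
- by exists 0; rewrite /kill msubC mulr0 addr0.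
- by exists (p' + q'); rewrite killD mulrDr addrACA -pE -qE.
rewrite killM killX; case: eqP => [->|_].
  by exists p; rewrite mul0r add0r.
by exists ('X_j * p'); rewrite mulrCA -mulrDr -pE.
Qed.

Lemma mpolyX_neq0 n (i : 'I_n) : 'X_i != 0 :> {mpoly k[n]}.
Proof.
apply/eqP => /(congr1 (meval (fun=> 1))); rewrite mevalXU meval0 => /eqP.
by rewrite oner_eq0.
Qed.

Lemma kill_eq0P n (i : 'I_n) p : kill i p = 0 <-> divides 'X_i p.
Proof.
split=> [p0|[q ->]]; last by rewrite killM killX eqxx mulr0.
by have [q ->] := kill_mod i p; exists q; rewrite p0 add0r mulrC.
Qed.

Lemma mpolyX_prime n (i : 'I_n) : prime_elt ('X_i : {mpoly k[n]}).
Proof.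
split; first exact: mpolyX_neq0.
  apply/negP => /(rmorph_unit (meval (fun=> 0))); rewrite /= mevalXU.
  by rewrite unitr0.
by move=> a b /kill_eq0P/eqP; rewrite killM mulf_eq0 => /orP[]/eqP/kill_eq0P; [left|right].
Qed.

End ClosedField.

(** * The cubics and the ideal of their cones *)

Notation i0 := (@Ordinal 5 0 isT).
Notation i1 := (@Ordinal 5 1 isT).
Notation i2 := (@Ordinal 5 2 isT).
Notation i3 := (@Ordinal 5 3 isT).
Notation i4 := (@Ordinal 5 4 isT).

Lemma ord5P (P : 'I_5 -> Prop) : P i0 -> P i1 -> P i2 -> P i3 -> P i4 -> forall i, P i.
Proof.
move=> p0 p1 p2 p3 p4 [[|[|[|[|[|//]]]]] lt]; rewrite (bool_irrelevance lt isT) //.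
Qed.

Definition vec5 (T : Type) (a b c d e : T) (i : 'I_5) : T :=
  match val i with 0 => a | 1 => b | 2 => c | 3 => d | _ => e end.

Definition horners (R : comNzRingType) :=
  (@hornerD R, @hornerN R, @hornerM R, @hornerC R, @hornerX R).

Lemma mevalXn (n : nat) (R : comNzRingType) (v : 'I_n -> R) (p : {mpoly R[n]}) m :
  (p ^+ m).@[v] = p.@[v] ^+ m.
Proof. exact: rmorphXn. Qed.

Definition mevals (n : nat) (R : comNzRingType) (v : 'I_n -> R) :=
  (mevalD v, mevalB v, mevalN v, mevalM v, mevalXn v, mevalXU v, mevalC v, mevalZ v).

Section Cubic.
Variable k : closedFieldType.
Variables s r e1 e2 e3 : k.

(** Setting [s = 1], [r = 0] gives the first family, [s = 0], [r = 1] and [e1 = 0]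
    the second. *)
Definition curve_form (R : comNzRingType) (s r e1 e2 e3 c d e : R) : R :=
  c ^+ 2 * e + s * c * d ^+ 2 + r * d ^+ 3 + e1 * d ^+ 2 * e + e2 * d * e ^+ 2 + e3 * e ^+ 3.

Definition cubic : {mpoly k[5]} := 'X_i0 * 'X_i1 * 'X_i4
  + curve_form s%:MP r%:MP e1%:MP e2%:MP e3%:MP 'X_i2 'X_i3 'X_i4.

Local Notation F := cubic.
Local Notation g := (curve_form s r e1 e2 e3).

Lemma cubicE v : F.@[v] = v i0 * v i1 * v i4 + g (v i2) (v i3) (v i4).
Proof.
by rewrite /cubic /curve_form !(mevalD, mevalM, rmorphXn, mevalC, mevalXU) /=.
Qed.

Definition vanishes (P : {mpoly k[5]}) := forall v, F.@[v] = 0 -> P.@[v] = 0.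

(** Any point of the cone with [x_0 = 0] is the limit of a curve in the cone along
    which [x_0] is not identically zero. *)
Lemma vanishes_dense P :
  (forall v, F.@[v] = 0 -> v i0 != 0 -> P.@[v] = 0) -> vanishes P.
Proof.
move=> PF v Fv; have [v0|] := eqVneq (v i0) 0; last exact: PF.
have along (c : 'I_5 -> {poly k}) : c i0 != 0 -> (forall t, F.@[fun i => (c i).[t]] = 0) ->
    (fun i => (c i).[0]) =1 v -> P.@[v] = 0.
  move=> c0 Fc cv; have [q qE] := meval_curve P c.
  have q0 : q = 0 by apply: (poly_vanish_generic c0) => t ct; rewrite qE PF.
  by rewrite -(meval_eq P cv) -qE q0 horner0.
(* If [x_1 x_4 = 0] the equation does not see [x_0]. *)
have [v14|v14] := eqVneq (v i1 * v i4) 0.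
  apply: (along (vec5 'X (v i1)%:P (v i2)%:P (v i3)%:P (v i4)%:P)).
  - by rewrite polyX_eq0.
  - move=> t; rewrite cubicE /vec5 /= !horners -(mulrA t) v14 mulr0 add0r.
    by move: Fv; rewrite cubicE v0 !mul0r add0r.
  by apply: ord5P; rewrite /vec5 /= !horners // v0.
have [v1 v4] : v i1 != 0 /\ v i4 != 0 by apply/andP; rewrite -negb_or -mulf_eq0.
(* Otherwise move [x_2] and solve for [x_0]. *)
pose q : {poly k} := - ((v i1 * v i4)^-1)%:P * 'X * ((v i4)%:P * 'X + (2%:R * v i2 * v i4 + s * v i3 ^+ 2)%:P).
apply: (along (vec5 q (v i1)%:P ((v i2)%:P + 'X) (v i3)%:P (v i4)%:P)).
- rewrite /vec5 /= mulf_neq0 //.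
    by rewrite mulf_neq0 ?polyX_eq0 // oppr_eq0 polyC_eq0 invr_eq0.
  by rewrite -size_poly_eq0 size_MXaddC polyC_eq0 (negPf v4).
- move=> t; rewrite cubicE /vec5 /= /q !horners.
  have := Fv; rewrite cubicE v0 !mul0r add0r /curve_form => Fv'.
  rewrite -[RHS]Fv'; field; rewrite ?v1 ?v4 //.
by apply: ord5P; rewrite /vec5 /= /q !horners // ?v0 ?mulr0 ?mul0r ?addr0.
Qed.

Local Notation c := ('X_i0 * 'X_i4 : {mpoly k[5]}).

(** [F] has degree one in [x_1], with leading coefficient [c], so up to a power of
    [c] every polynomial is congruent modulo [F] to one without [x_1]. *)
Lemma pseudo_division P : exists d Q R,
  c ^+ d * P = Q * F + R /\
  (forall v v', (forall i, i != i1 -> v i = v' i) -> R.@[v] = R.@[v']).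
Proof.
have FE : c * 'X_i1 = F - curve_form s%:MP r%:MP e1%:MP e2%:MP e3%:MP 'X_i2 'X_i3 'X_i4.
  by rewrite /cubic; ring.
elim/mpoly_generated: P => [a|p q [d [Q [R [e Rf]]]] [d' [Q' [R' [e' Rf']]]]|i p [d [Q [R [e Rf]]]]].
- exists 0%N, 0, a%:MP; split; first by rewrite expr0 mul1r mul0r add0r.
  by move=> v v' _; rewrite !mevalC.
- exists (d + d')%N, (c ^+ d' * Q + c ^+ d * Q'), (c ^+ d' * R + c ^+ d * R'); split.
    transitivity (c ^+ d' * (c ^+ d * p) + c ^+ d * (c ^+ d' * q)); last by rewrite e e'; ring.
    by rewrite exprD; ring.
  move=> v v' vv'; rewrite !(mevalD, mevalM, rmorphXn, mevalXU) /= (Rf v v' vv') (Rf' v v' vv').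
  by rewrite ?mevalM ?mevalXU !vv'.
have [->|ni] := eqVneq i i1.
  exists d.+1, (c * 'X_i1 * Q + R), (- curve_form s%:MP r%:MP e1%:MP e2%:MP e3%:MP 'X_i2 'X_i3 'X_i4 * R).
  split.
    transitivity ((c * 'X_i1) * (c ^+ d * p)); first by rewrite exprS; ring.
    by rewrite e mulrDr [X in _ + X = _]mulrC {2}FE; ring.
  move=> v v' vv'; rewrite /curve_form.
  by rewrite !(mevalN, mevalD, mevalM, rmorphXn, mevalXU, mevalC) /= (Rf v v' vv') ?mevalXU !vv'.
exists d, ('X_i * Q), ('X_i * R); split.
  by rewrite mulrCA e; ring.
by move=> v v' vv'; rewrite !mevalM !mevalXU (Rf v v' vv') vv'.
Qed.

Hypothesis sr : (s != 0) || (r != 0).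

Lemma kill_cancel (i : 'I_5) P Q : kill i F != 0 -> 'X_i * P = Q * F -> divides 'X_i Q.
Proof.
move=> F0 e; apply/kill_eq0P; apply: (mulIf F0); rewrite mul0r -killM -e killM killX eqxx.
by rewrite mul0r.
Qed.

Lemma kill_neq0 (i : 'I_5) (v : 'I_5 -> k) : v i = 0 -> F.@[v] != 0 -> kill i F != 0.
Proof.
move=> v0 Fv; apply: contraNneq Fv => z; have := congr1 (meval v) z.
rewrite kill_eval meval0 => <-; apply/eqP/meval_eq => j.
by case: eqP => // ->.
Qed.

Lemma cubic_nonzero_point : F.@[vec5 0 0 (r == 0)%:R 1 0] != 0.
Proof.
rewrite cubicE /vec5 /curve_form /= !(mulr0, mul0r, add0r, addr0, expr1n, mulr1, expr0n).
have [r0|r0] := eqVneq r 0; last by rewrite mulr0 add0r.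
by move: sr; rewrite r0 eqxx orbF mulr1 addr0.
Qed.

Lemma kill_cubic (i : 'I_5) : i \in [:: i0; i1; i4] -> kill i F != 0.
Proof.
move=> ii; apply: kill_neq0 cubic_nonzero_point.
by move: ii; rewrite !inE => /or3P[] /eqP ->.
Qed.

(** [F] generates the ideal of its zeros: the remainder of a pseudo-division by [F]
    vanishes where [c <> 0], as [x_1] can be chosen there to satisfy the equation. The
    powers of [c] cancel because [F] is nonzero modulo [x_0] and modulo
    [x_4]. *)
Lemma vanishes_divides P : vanishes P -> divides F P.
Proof.
move=> PF; have [d [Q [R [e Rf]]]] := pseudo_division P.
have R0 : R = 0.
  apply: (@mpoly_vanish_generic _ _ _ c); first by rewrite mulf_neq0 ?mpolyX_neq0.
  move=> v; rewrite mevalM !mevalXU mulf_eq0 negb_or => /andP[v0 v4].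
  pose v' := vec5 (v i0) (- g (v i2) (v i3) (v i4) / (v i0 * v i4)) (v i2) (v i3) (v i4).
  have Fv' : F.@[v'] = 0 by rewrite cubicE /v' /vec5 /=; field; rewrite v0 v4.
  have <- : R.@[v'] = R.@[v] by apply: Rf; apply: ord5P.
  have := congr1 (meval v') e; rewrite mevalD !mevalM Fv' mulr0 add0r => <-.
  by rewrite PF // mulr0.
move: e; rewrite R0 addr0 => {R R0 Rf}.
elim: d Q => [|d IH] Q; first by rewrite expr0 mul1r => ->; exists Q.
rewrite exprS -!mulrA => e.
have [Q1 Q1E] := kill_cancel (@kill_cubic i0 isT) e.
have {}e : 'X_i4 * (c ^+ d * P) = Q1 * F.
  by apply: (mulfI (mpolyX_neq0 k i0)); rewrite e Q1E; ring.
have [Q2 Q2E] := kill_cancel (@kill_cubic i4 isT) e.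
apply: (IH Q2); apply: (mulfI (mpolyX_neq0 k i4)); rewrite e Q2E; ring.
Qed.

Lemma cubic_homog : F \is 3.-homog.
Proof.
have X1 i : ('X_i : {mpoly k[5]}) \is 1.-homog by rewrite dhomogX /= mdeg1.
have X2 i j : ('X_i * 'X_j : {mpoly k[5]}) \is 2.-homog.
  exact: (dhomogM (X1 i) (X1 j)).
rewrite /cubic /curve_form; do !apply: rpredD; rewrite ?expr2 ?exprS ?expr0 ?mulr1.
- exact: dhomogM (X2 _ _) (X1 _).
- exact: dhomogM (X2 _ _) (X1 _).
- rewrite -mulrA mul_mpolyC; apply: rpredZ; exact: dhomogM (X1 _) (X2 _ _).
- rewrite mul_mpolyC; apply: rpredZ; exact: dhomogM (X1 _) (X2 _ _).
- rewrite -mulrA mul_mpolyC; apply: rpredZ; exact: dhomogM (X2 _ _) (X1 _).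
- rewrite -mulrA mul_mpolyC; apply: rpredZ; exact: dhomogM (X1 _) (X2 _ _).
- rewrite mul_mpolyC; apply: rpredZ; exact: dhomogM (X1 _) (X2 _ _).
Qed.

Lemma cubic_neq0 : F != 0.
Proof. by apply: contraNneq (@kill_cubic i0 isT) => ->; rewrite rmorph0. Qed.

(** In the coordinate ring of the cone, [x_0] and [x_1] form a regular sequence:
    modulo [x_0] the cubic does not involve [x_1]. Hence a fraction with
    denominators both [x_0 ^ N] and [x_1 ^ M] is regular. *)
Lemma vanishes_hartogs N M A B :
  vanishes ('X_i1 ^+ M * A - 'X_i0 ^+ N * B) -> exists C, vanishes (A - 'X_i0 ^+ N * C).
Proof.
elim: N A B => [|N IH] A B van.
  by exists A => v _; rewrite expr0 mul1r subrr meval0.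
have [E EE] := vanishes_divides van.
have E0 : 'X_i1 ^+ M * kill i0 A = kill i0 E * kill i0 F.
  have := congr1 (kill i0) EE; rewrite killM => <-.
  rewrite rmorphB /= !killM !rmorphXn /= !killX /= exprS mul0r mul0r subr0 //.
have [E' E'E] : exists E', kill i0 E = 'X_i1 ^+ M * E'.
  have := E0; elim: (M) (kill i0 E) (kill i0 A) => [|m IHm] e a ea.
    by exists e; rewrite expr0 mul1r.
  have dv : divides 'X_i1 e.
    apply/kill_eq0P; apply: (@mulIf _ (kill i1 (kill i0 F))).
      apply: contraNneq cubic_nonzero_point => /(congr1 (meval (vec5 0 0 (r == 0)%:R 1 0))).
      by rewrite !kill_eval meval0 => e0; rewrite -[eqbRHS]e0; apply/eqP/meval_eq; apply: ord5P.
    rewrite mul0r -killM -ea exprS !killM killX eqxx !mul0r //.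
  have [f fE] := dv; have [|f' f'E] := IHm f a.
    apply: (mulfI (mpolyX_neq0 k i1)); move: ea; rewrite fE exprS -mulrA => ->; ring.
  by exists f'; rewrite fE f'E exprS; ring.
have A0 : kill i0 A = kill i0 F * E'.
  apply: (mulfI (expf_neq0 M (mpolyX_neq0 k i1))); rewrite E0 E'E; ring.
have [A1 A1E] := kill_mod i0 A; have [F1 F1E] := kill_mod i0 F.
have [|C CE] := IH (A1 - F1 * E') B.
  apply: vanishes_dense => v Fv v0.
  have := van v Fv; rewrite A1E A0.
  have := congr1 (meval v) F1E; rewrite Fv !(mevals v) /= ?(mevals v) => /esym f0.
  rewrite exprS => e; apply: (mulfI v0); rewrite mulr0 -e.
  have -> : (kill i0 F).@[v] = - (v i0 * F1.@[v]) by apply/eqP; rewrite -addr_eq0 f0.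
  ring.
exists C => v Fv; have := CE v Fv.
have := congr1 (meval v) F1E; rewrite Fv A1E A0.
rewrite exprS !(mevals v) /= ?(mevals v) => /esym f0 CE'.
have -> : (kill i0 F).@[v] = - (v i0 * F1.@[v]) by apply/eqP; rewrite -addr_eq0 f0.
by rewrite -[RHS](mulr0 (v i0)) -CE'; ring.
Qed.

End Cubic.

(** * Self-maps of the cone and their charts *)

Section Vectors.
Variable k : closedFieldType.

Definition nonzero n (v : 'I_n -> k) := exists i, v i != 0.

(** Equality of points of projective space, on coordinate vectors. *)
Definition proportional n (u v : 'I_n -> k) := exists2 c, c != 0 & forall i, u i = c * v i.

Lemma proportional_refl n (u : 'I_n -> k) : proportional u u.
Proof. by exists 1; rewrite ?oner_neq0 // => i; rewrite mul1r. Qed.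

Lemma proportional_sym n (u v : 'I_n -> k) : proportional u v -> proportional v u.
Proof.
by move=> [c c0 uv]; exists c^-1; rewrite ?invr_eq0 // => i; rewrite uv mulKf.
Qed.

Lemma proportional_trans n (v u w : 'I_n -> k) :
  proportional u v -> proportional v w -> proportional u w.
Proof.
move=> [c c0 uv] [d d0 vw]; exists (c * d); rewrite ?mulf_neq0 // => i.
by rewrite uv vw mulrA.
Qed.

Lemma proportional_eq n (u v : 'I_n -> k) : u =1 v -> proportional u v.
Proof. by exists 1; rewrite ?oner_neq0 // => i; rewrite mul1r. Qed.

Lemma proportional_nonzero n (u v : 'I_n -> k) : proportional u v -> nonzero v -> nonzero u.
Proof. by move=> [c c0 uv] [i vi]; exists i; rewrite uv mulf_neq0. Qed.

Lemma proportional_parallel n (u v w : 'I_n -> k) :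
  proportional u w -> proportional v w -> parallel u v.
Proof. by move=> [c _ uw] [d _ vw] i j; rewrite !uw !vw; ring. Qed.

Lemma homog_eval n (p : {mpoly k[n]}) d c v :
  p \is d.-homog -> p.@[fun i => c * v i] = c ^+ d * p.@[v].
Proof.
move=> /dhomogP hp; rewrite !mevalE mulr_sumr; apply: eq_big_seq => m /hp /= dm.
rewrite mulrCA; congr (_ * _).
under eq_bigr do rewrite exprMn.
rewrite big_split /=; congr (_ * _).
by rewrite -dm mdegE expr_sum.
Qed.

End Vectors.

Section Chart.
Variable k : closedFieldType.
Variables s r e1 e2 e3 : k.
Local Notation F := (cubic s r e1 e2 e3).
Local Notation vanishes := (vanishes s r e1 e2 e3).

(** A regular self-map of the projective variety, on coordinate vectors: [f v] is
    some vector on the image of the line of [v]. *)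
Record map_on_cone (f : ('I_5 -> k) -> 'I_5 -> k) : Prop := MapOnCone {
  map_nonzero : forall v, F.@[v] = 0 -> nonzero v -> nonzero (f v);
  map_proportional : forall u v, F.@[v] = 0 -> nonzero v ->
    proportional u v -> proportional (f u) (f v);
  map_local : forall v0, F.@[v0] = 0 -> nonzero v0 ->
    exists w l d (H : 'I_5 -> {mpoly k[5]}),
    [/\ w \is l.-homog, w.@[v0] != 0, forall i, H i \is d.-homog
      & forall v, F.@[v] = 0 -> nonzero v -> w.@[v] != 0 ->
          proportional (fun i => (H i).@[v]) (f v)] }.

(** A presentation of the slice [x_io = 1] of the cone as a quotient of affine space.
    The group acting is generated by one diagonal automorphism [d], and the
    polynomials that it leaves invariant are those coming from the slice. *)
Record chart (io : 'I_5) (n : nat) (pi : 'I_5 -> {mpoly k[n]}) : Prop := Chart {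
  chart_one : pi io = 1;
  chart_on : forall Y, F.@[fun i => (pi i).@[Y]] = 0;
  chart_surj : forall v, F.@[v] = 0 -> v io = 1 -> exists Y, forall i, (pi i).@[Y] = v i;
  chart_lift : exists d : 'I_n -> k,
    [/\ forall j, d j != 0,
        forall Y i, (pi i).@[fun j => d j * Y j] = (pi i).@[Y]
      & forall p, (forall Y, p.@[fun j => d j * Y j] = p.@[Y]) ->
          exists P, p = msub pi P] }.

Variables (io : 'I_5) (n : nat) (pi : 'I_5 -> {mpoly k[n]}).
Hypothesis ch : chart io pi.
Hypothesis dense : forall P,
  (forall v, F.@[v] = 0 -> v io != 0 -> P.@[v] = 0) -> vanishes P.

Definition chart_pt (Y : 'I_n -> k) : 'I_5 -> k := fun i => (pi i).@[Y].

Lemma chart_rescale v : F.@[v] = 0 -> v io != 0 ->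
  exists Y, forall i, v i = v io * chart_pt Y i.
Proof.
move=> Fv vio; have [|//|Y YE] := chart_surj ch (v := fun i => (v io)^-1 * v i).
- by rewrite (homog_eval _ _ (cubic_homog _ _ _ _ _)) Fv mulr0.
- by rewrite mulVf.
by exists Y => i; rewrite /chart_pt YE mulrA mulfV // mul1r.
Qed.

Lemma chart_pt_nonzero Y : nonzero (chart_pt Y).
Proof. by exists io; rewrite /chart_pt (chart_one ch) meval1 oner_neq0. Qed.

(** Since [x_io] restricts to 1, multiplying by it raises the degree at will. *)
Lemma homogenize P : exists n0, forall m, (n0 <= m)%N ->
  exists2 Q, Q \is m.-homog & msub pi Q = msub pi P.
Proof.
have X1 i : ('X_i : {mpoly k[5]}) \is 1.-homog by rewrite dhomogX /= mdeg1.
elim/mpoly_generated: P => [c|p q [n1 IH1] [n2 IH2]|i p [n1 IH1]].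
- exists 0%N => m _; exists (c%:MP * 'X_io ^+ m).
    by rewrite mul_mpolyC; apply: rpredZ; have := dhomogMn m (X1 io); rewrite mul1n.
  by rewrite rmorphM rmorphXn /= msubX (chart_one ch) expr1n mulr1.
- exists (maxn n1 n2) => m; rewrite geq_max => /andP[/IH1[P hP eP] /IH2[Q hQ eQ]].
  by exists (P + Q); [apply: rpredD | rewrite !rmorphD /= eP eQ].
exists n1.+1 => -[//|m] /IH1[P hP eP]; exists ('X_i * P); first exact: (dhomogM (X1 i) hP).
by rewrite !rmorphM /= eP.
Qed.

Variable f : ('I_5 -> k) -> 'I_5 -> k.
Hypothesis mf : map_on_cone f.

Lemma scale_eval (d : 'I_n -> k) (p : {mpoly k[n]}) Y :
  (msub (fun j => d j *: 'X_j) p).@[Y] = p.@[fun j => d j * Y j].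
Proof. by rewrite msub_eval; apply: meval_eq => j; rewrite mevalZ mevalXU. Qed.

(** All local representations of [f] are parallel to each other, hence multiples
    of one primitive vector. Near each point a local representation
    does not vanish, so the primitive vector cannot vanish either. *)
Lemma chart_primitive_forms : exists al : 'I_5 -> {mpoly k[n]},
  primitive_vector al /\
  forall Y, proportional (fun i => (al i).@[Y]) (f (chart_pt Y)).
Proof.
have fnz Y : nonzero (f (chart_pt Y)).
  by apply: (map_nonzero mf); [exact: (chart_on ch)|exact: chart_pt_nonzero].
have loc Y0 : exists w (H : 'I_5 -> {mpoly k[n]}), w.@[Y0] != 0 /\
    forall Y, w.@[Y] != 0 -> proportional (fun i => (H i).@[Y]) (f (chart_pt Y)).
  have [w [l [d [H [_ w0 _ Hf]]]]] := map_local mf (chart_on ch Y0) (chart_pt_nonzero Y0).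
  exists (msub pi w), (fun i => msub pi (H i)); split; first by rewrite msub_eval.
  move=> Y; rewrite msub_eval => wY.
  apply: proportional_trans (Hf _ (chart_on ch Y) (chart_pt_nonzero Y) wY).
  by apply: proportional_eq => i; exact: msub_eval.
have [w0 [H0 [w00 H0f]]] := loc (fun=> 0).
have [j0 Hj0] := proportional_nonzero (H0f _ w00) (fnz _).
have H0nz : H0 j0 != 0 by apply: contraNneq Hj0 => ->; rewrite meval0.
have [c [al [c0 H0E alp]]] := exists_primitive_vector (@ufd_mpoly k n) H0nz.
exists al; split=> // Y.
have [w [H [wY Hf]]] := loc Y.
have HH0 : parallel H H0.
  move=> i j; apply/eqP; rewrite -subr_eq0; apply/eqP.
  apply: (@mpoly_vanish_generic _ _ _ (w * w0)).
    rewrite mulf_neq0 //; first by apply: contraNneq wY => ->; rewrite meval0.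
    by apply: contraNneq w00 => ->; rewrite meval0.
  move=> Z; rewrite mevalM mulf_eq0 negb_or => /andP[wZ w0Z].
  rewrite mevalB !mevalM; apply/eqP; rewrite subr_eq0; apply/eqP.
  exact: (proportional_parallel (Hf Z wZ) (H0f Z w0Z)).
have [e eE] : exists e, forall i, H i = e * al i.
  apply: alp => i j; apply: (mulfI c0); have := HH0 i j; rewrite !H0E => e.
  by rewrite mulrCA e mulrCA.
have HY := Hf Y wY; have [j Hj] := proportional_nonzero HY (fnz Y).
apply: proportional_trans HY; apply: proportional_sym; exists e.@[Y].
  by apply: contraNneq Hj => e0; rewrite eE mevalM e0 mul0r.
by move=> i; rewrite eE mevalM.
Qed.

(** The primitive vector of [chart_primitive_forms] descends to the slice, hence to
    forms [A] on the cone. It remains universal: up to powers of [x_io], vectors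
    of forms parallel to [A] are multiples of [A]. *)
Lemma chart_forms : exists m (A : 'I_5 -> {mpoly k[5]}),
  [/\ forall i, A i \is m.-homog,
      forall v, F.@[v] = 0 -> v io != 0 -> proportional (fun i => (A i).@[v]) (f v)
    & forall l (H : 'I_5 -> {mpoly k[5]}), (forall i, H i \is l.-homog) ->
       (forall i j, vanishes (H i * A j - H j * A i)) ->
       exists t e P, P \is e.-homog /\ forall i, vanishes ('X_io ^+ t * H i - P * A i)].
Proof.
have [d [d0 pid lift]] := chart_lift ch.
have [al [alp alf]] := chart_primitive_forms.
have fnz Y : nonzero (f (chart_pt Y)).
  by apply: (map_nonzero mf); [exact: (chart_on ch)|exact: chart_pt_nonzero].
have alnz Y : nonzero (fun i => (al i).@[Y]) by apply: proportional_nonzero (alf Y) (fnz Y).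
have twist (d' : 'I_n -> k) : (forall Y i, (pi i).@[fun j => d' j * Y j] = (pi i).@[Y]) ->
    exists c, forall i, msub (fun j => d' j *: 'X_j) (al i) = c * al i.
  move=> pid'; apply: alp => i j; apply: mpoly_ext => Y; rewrite !mevalM !scale_eval.
  apply: (@proportional_parallel _ _ (fun i => (al i).@[fun l => d' l * Y l]) (fun i => (al i).@[Y]) (f (chart_pt Y))) => //.
  apply: proportional_trans (alf _) _; apply: (map_proportional mf).
  - exact: (chart_on ch).
  - exact: chart_pt_nonzero.
  by apply: proportional_eq => l; rewrite /chart_pt pid'.
(* By uniqueness [d] multiplies the primitive vector by a unit, a constant; it is
   1 since the vector is nonzero at the origin, a fixed point of [d]. *)
have [c cE] := twist d pid.
have [|c' c'E] := twist (fun j => (d j)^-1).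
  move=> Y i; rewrite -[RHS](meval_eq _ (v1 := fun j => d j * ((d j)^-1 * Y j))).
    by rewrite -pid.
  by move=> j; rewrite mulrA mulfV // mul1r.
have cc' Y : c'.@[fun j => d j * Y j] * c.@[Y] = 1.
  have [i ai] := alnz Y; apply: (mulIf ai); rewrite mul1r.
  have e1' := congr1 (meval (fun j => d j * Y j)) (c'E i).
  have e2' := congr1 (meval Y) (cE i).
  rewrite scale_eval mevalM in e1'; rewrite scale_eval mevalM in e2'.
  rewrite -mulrA -e2' -e1'; apply: meval_eq => j.
  by rewrite mulrA mulVf // mul1r.
have c1 : c = 1.
  have cu : c * msub (fun j => d j *: 'X_j) c' = 1.
    by apply: mpoly_ext => Y; rewrite mevalM scale_eval mulrC cc' meval1.
  have cC : c = (c@_0)%:MP.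
    have : c \is a GRing.unit by apply/unitrP; exists (msub (fun j => d j *: 'X_j) c'); rewrite mulrC.
    by rewrite unfold_in => /andP[/eqP].
  have [i ai] := alnz (fun=> 0).
  have := congr1 (meval (fun=> 0)) (cE i); rewrite scale_eval mevalM.
  rewrite (meval_eq _ (v2 := fun=> 0)) => [e|j]; last by rewrite mulr0.
  rewrite cC; congr (_%:MP); apply: (mulIf ai); rewrite mul1r [RHS]e.
  by rewrite [in RHS]cC mevalC.
have ald i Y : (al i).@[fun j => d j * Y j] = (al i).@[Y].
  by rewrite -scale_eval cE c1 mul1r.
have [P0 P0E] := fin_all_exists (fun i => lift (al i) (ald i)).
have [n0 n0P] := fin_all_exists (fun i => homogenize (P0 i)).
pose m := \max_i n0 i.
have [A AE2 AE] := fin_all_exists2 (fun i => n0P i m (leq_bigmax i)).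
have Aal i Y : (A i).@[chart_pt Y] = (al i).@[Y].
  by rewrite -msub_eval AE -P0E.
exists m, A; split=> //.
- move=> v Fv vio; have [Y vE] := chart_rescale Fv vio.
  have fv : proportional (f v) (f (chart_pt Y)).
    apply: (map_proportional mf); [exact: (chart_on ch)|exact: chart_pt_nonzero|].
    by exists (v io).
  apply: proportional_trans (proportional_sym fv).
  apply: proportional_trans (alf Y); exists (v io ^+ m); first by rewrite expf_neq0.
  move=> i; rewrite (meval_eq _ vE) (homog_eval _ _ (AE2 i)) Aal //.
move=> l H hH HA.
have [phi phiE] : exists phi, forall i, msub pi (H i) = phi * al i.
  apply: alp => i j; apply: mpoly_ext => Y; rewrite !mevalM !msub_eval -!Aal.
  have := HA i j _ (chart_on ch Y); rewrite mevalB !mevalM => /eqP.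
  by rewrite subr_eq0 => /eqP.
have [|Q QE] := lift phi.
  move=> Y; have [i ai] := alnz Y; apply: (mulIf ai); rewrite -[in LHS]ald -!mevalM -phiE.
  by rewrite !msub_eval; apply: meval_eq => j; rewrite pid.
have [n1 n1P] := homogenize Q; pose e := maxn n1 l.
have [P hP PE] := n1P e (leq_maxl _ _).
exists (e + m - l)%N, e, P; split=> // i; apply: dense => v Fv vio.
have [Y vE] := chart_rescale Fv vio.
rewrite mevalB !mevalM rmorphXn /= mevalXU.
rewrite (meval_eq (H i) vE) (meval_eq P vE) (meval_eq (A i) vE).
rewrite (homog_eval _ _ hP) (homog_eval _ _ (hH i)) (homog_eval _ _ (AE2 i)) Aal.
have -> : P.@[chart_pt Y] = phi.@[Y] by rewrite -msub_eval PE -QE.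
have -> : (H i).@[chart_pt Y] = phi.@[Y] * (al i).@[Y] by rewrite -msub_eval phiE mevalM.
have ve : v io ^+ (e + m - l) * v io ^+ l = v io ^+ e * v io ^+ m.
  rewrite -!exprD subnK //; apply: leq_trans (leq_addr _ _); exact: leq_maxr.
by rewrite [X in X - _]mulrA ve; ring.
Qed.

End Chart.

(** * Gluing the two charts *)

Section TwoCharts.
Variable k : closedFieldType.
Variables s r e1 e2 e3 : k.
Hypothesis sr : (s != 0) || (r != 0).
Local Notation F := (cubic s r e1 e2 e3).
Local Notation vanishes := (vanishes s r e1 e2 e3).
Local Notation map_on_cone := (map_on_cone s r e1 e2 e3).

Lemma cubic_swap v : F.@[vec5 (v i1) (v i0) (v i2) (v i3) (v i4)] = F.@[v].
Proof. by rewrite !cubicE /vec5 /= [v i1 * _]mulrC. Qed.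

Lemma vanishes_dense1 P :
  (forall v, F.@[v] = 0 -> v i1 != 0 -> P.@[v] = 0) -> vanishes P.
Proof.
move=> PF v Fv.
pose h : 'I_5 -> {mpoly k[5]} := vec5 'X_i1 'X_i0 'X_i2 'X_i3 'X_i4.
pose sw (v : 'I_5 -> k) := vec5 (v i1) (v i0) (v i2) (v i3) (v i4).
have hE u : (msub h P).@[u] = P.@[sw u].
  by rewrite msub_eval; apply: meval_eq; apply: ord5P; rewrite mevalXU.
have -> : P.@[v] = (msub h P).@[sw v].
  by rewrite hE; apply: meval_eq; apply: ord5P.
apply: (@vanishes_dense k s r e1 e2 e3); last by rewrite /sw cubic_swap.
by move=> u Fu u0; rewrite hE; apply: PF; rewrite /sw ?cubic_swap.
Qed.

Variables (n : nat) (pi0 pi1 : 'I_5 -> {mpoly k[n]}).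
Hypothesis ch0 : chart s r e1 e2 e3 i0 pi0.
Hypothesis ch1 : chart s r e1 e2 e3 i1 pi1.
(** On the slice [x_1 = 1], the effective principal divisors supported on
    [x_0 = 0] are the multiples of that of [x_0], and all units are constant. *)
Hypothesis units1 : forall P Q m,
  msub pi1 P * msub pi1 Q = pi1 i0 ^+ m ->
  exists c a, [/\ c != 0, (a <= m)%N & msub pi1 P = c *: pi1 i0 ^+ a].

Lemma eq_dense0 P Q : (forall v, F.@[v] = 0 -> v i0 != 0 -> P.@[v] = Q.@[v]) ->
  forall v, F.@[v] = 0 -> P.@[v] = Q.@[v].
Proof.
move=> PQ v Fv; apply/eqP; rewrite -subr_eq0 -mevalB; apply/eqP.
by apply: (@vanishes_dense k s r e1 e2 e3) Fv => u Fu u0; rewrite mevalB PQ // subrr.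
Qed.

Lemma eq_dense1 P Q : (forall v, F.@[v] = 0 -> v i1 != 0 -> P.@[v] = Q.@[v]) ->
  forall v, F.@[v] = 0 -> P.@[v] = Q.@[v].
Proof.
move=> PQ v Fv; apply/eqP; rewrite -subr_eq0 -mevalB; apply/eqP.
by apply: vanishes_dense1 Fv => u Fu u0; rewrite mevalB PQ // subrr.
Qed.

(** The cone is irreducible, being dominated by a line times an affine space. *)
Lemma vanishes_cancel w l Q v0 : w \is l.-homog -> F.@[v0] = 0 -> w.@[v0] != 0 ->
  vanishes (w * Q) -> vanishes Q.
Proof.
move=> hw Fv0 wv0 wQ.
have wpi : msub pi0 w != 0.
  apply: contraNneq wv0 => z; apply/eqP; apply: (@vanishes_dense k s r e1 e2 e3) Fv0.
  move=> v Fv v0'; have [Y vE] := chart_rescale ch0 Fv v0'.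
  by rewrite (meval_eq _ vE) (homog_eval _ _ hw) -msub_eval z meval0 mulr0.
apply: (@vanishes_dense k s r e1 e2 e3) => v Fv vi0; have [Y vE] := chart_rescale ch0 Fv vi0.
pose q := msub pi0 (msub (fun i => v i0 *: 'X_i) Q).
have qE Z : q.@[Z] = Q.@[fun i => v i0 * chart_pt pi0 Z i].
  by rewrite !msub_eval; apply: meval_eq => i; rewrite mevalZ mevalXU.
rewrite (meval_eq _ vE) -qE; suff -> : q = 0 by rewrite meval0.
apply/eqP; have : msub pi0 w * q == 0; last by rewrite mulf_eq0 (negPf wpi).
apply/eqP/mpoly_vanish => Z; rewrite mevalM qE msub_eval.
have [z0|z0] := eqVneq (w.@[chart_pt pi0 Z]) 0; first by rewrite z0 mul0r.
have := wQ (fun i => v i0 * chart_pt pi0 Z i).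
rewrite (homog_eval _ _ (cubic_homog _ _ _ _ _)) (chart_on ch0) mulr0 mevalM => /(_ erefl).
rewrite (homog_eval _ _ hw) => /eqP; rewrite !mulf_eq0 (negPf z0) orbF expf_eq0 (negPf vi0) andbF /=.
by move=> /eqP ->; rewrite mulr0.
Qed.

(** The forms [A] and [B] that represent [f] where [x_0 <> 0] and [x_1 <> 0] are
    multiples of each other up to powers of [x_0] and [x_1]. The multipliers [P] and
    [P'] have product [x_0 ^ t * x_1 ^ t'], so they are monomials by [units1], and
    [vanishes_hartogs] yields forms [C] with [A = x_0 ^ (t - a) * C] and
    [B = c * x_1 ^ (e - a) * C]. Around a point with [x_0 = x_1 = 0] a local
    representation [H] is a multiple of [C] by the same argument. As [C] is
    only determined modulo [F], its homogeneity of degree [m - (t - a)] holds on the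
    cone, and in a form that allows for a negative degree. *)
Lemma global_forms f : map_on_cone f -> exists (C : 'I_5 -> {mpoly k[5]}) m e,
  (forall v c i, F.@[v] = 0 -> c ^+ e * (C i).@[fun j => c * v j] = c ^+ m * (C i).@[v]) /\
  forall v, F.@[v] = 0 -> nonzero v -> proportional (fun i => (C i).@[v]) (f v).
Proof.
move=> mf.
have [m [A [hA Af Ap]]] := chart_forms ch0 (@vanishes_dense k s r e1 e2 e3) mf.
have [m' [B [hB Bf Bp]]] := chart_forms ch1 vanishes_dense1 mf.
have nzi (v : 'I_5 -> k) i : v i != 0 -> nonzero v by exists i.
have Anz v : F.@[v] = 0 -> v i0 != 0 -> nonzero (fun i => (A i).@[v]).
  by move=> Fv v0; exact: (proportional_nonzero (Af v Fv v0) (map_nonzero mf Fv (nzi _ _ v0))).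
have Bnz v : F.@[v] = 0 -> v i1 != 0 -> nonzero (fun i => (B i).@[v]).
  by move=> Fv v1; exact: (proportional_nonzero (Bf v Fv v1) (map_nonzero mf Fv (nzi _ _ v1))).
have BA i j v : F.@[v] = 0 -> (B i * A j).@[v] = (B j * A i).@[v].
  apply: eq_dense0 => {}v Fv v0.
  have key : forall u, F.@[u] = 0 -> ('X_i0 * (B i * A j)).@[u] = ('X_i0 * (B j * A i)).@[u].
    apply: eq_dense1 => u Fu u1; rewrite !mevalM mevalXU.
    have [->|u0] := eqVneq (u i0) 0; first by rewrite !mul0r.
    by congr (_ * _); apply: (proportional_parallel (Bf u Fu u1) (Af u Fu u0)).
  by apply: (mulfI v0); have := key v Fv; rewrite !mevalM mevalXU.
have [t [e [P [hP PE]]]] : exists t e P, P \is e.-homog /\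
    forall i v, F.@[v] = 0 -> ('X_i0 ^+ t * B i).@[v] = (P * A i).@[v].
  have [|t [e [P [hP PE]]]] := Ap _ B hB; first by move=> i j v Fv; rewrite mevalB BA ?subrr.
  exists t, e, P; split=> // i v Fv; apply/eqP; rewrite -subr_eq0 -mevalB.
  exact/eqP/PE.
have [t' [P' PE']] : exists t' P',
    forall i v, F.@[v] = 0 -> ('X_i1 ^+ t' * A i).@[v] = (P' * B i).@[v].
  have [|t' [e' [P' [hP' PE']]]] := Bp _ A hA.
    by move=> i j v Fv; rewrite mevalB [A i * _]mulrC [A j * _]mulrC BA ?subrr.
  exists t', P'; move=> i v Fv; apply/eqP; rewrite -subr_eq0 -mevalB.
  exact/eqP/PE'.
have PP' v : F.@[v] = 0 -> (P * P').@[v] = ('X_i0 ^+ t * 'X_i1 ^+ t').@[v].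
  apply: eq_dense1 => {}v Fv v1; have [i Bi] := Bnz v Fv v1; apply: (mulIf Bi).
  have := PE i v Fv; have := PE' i v Fv; rewrite !mevalM => b' b.
  by rewrite -mulrA -b' mulrCA -b mulrCA mulrA.
have [|c [a [c0 at' PpE]]] := @units1 P P' t.
  apply: mpoly_ext => Y; rewrite mevalM !msub_eval -mevalM PP'; last exact: (chart_on ch1).
  by rewrite mevalM !rmorphXn /= !mevalXU (chart_one ch1) meval1 expr1n mulr1.
have PE1 v : F.@[v] = 0 -> ('X_i1 ^+ a * P).@[v] = (c *: ('X_i1 ^+ e * 'X_i0 ^+ a)).@[v].
  apply: eq_dense1 => {}v Fv v1.
  have [Y vE] := chart_rescale ch1 Fv v1.
  rewrite mevalM mevalZ mevalM !rmorphXn /= !mevalXU (meval_eq P vE) (homog_eval _ _ hP).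
  rewrite -msub_eval PpE mevalZ rmorphXn /= (vE i0) exprMn /chart_pt; ring.
have AB v i : F.@[v] = 0 ->
    ('X_i0 ^+ (t - a) * 'X_i1 ^+ a * B i).@[v] = (c *: ('X_i1 ^+ e * A i)).@[v].
  apply: eq_dense0 => {}v Fv v0; apply: (mulfI (expf_neq0 a v0)).
  have := PE i v Fv; have := PE1 v Fv.
  rewrite !(mevalM, mevalZ, rmorphXn, mevalXU) /= ?mevalXU => p1 p2.
  transitivity (v i1 ^+ a * (v i0 ^+ t * (B i).@[v])).
    by rewrite -[in RHS](subnKC at') exprD; ring.
  by rewrite p2 mulrA p1; ring.
(* If [e < a], then [A] vanishes at the point [1 : 0 : 0 : 0 : 0]. *)
have [ae|ea] := leqP a e; last first.
  pose p : 'I_5 -> k := vec5 1 0 0 0 0.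
  have Fp : F.@[p] = 0.
    by rewrite cubicE /curve_form /p /vec5 /= !(mulr0, mul0r, addr0, expr0n).
  have [i Ai] := Anz p Fp (oner_neq0 k).
  have key : forall u, F.@[u] = 0 ->
      ('X_i0 ^+ (t - a) * 'X_i1 ^+ (a - e) * B i).@[u] = (c *: A i).@[u].
    apply: eq_dense1 => u Fu u1; apply: (mulfI (expf_neq0 e u1)); have := AB u i Fu.
    rewrite !(mevalM, mevalZ, rmorphXn, mevalXU) /= ?mevalXU => ab.
    have ua : u i1 ^+ a = u i1 ^+ e * u i1 ^+ (a - e) by rewrite -exprD subnKC // ltnW.
    by rewrite [RHS]mulrCA -ab ua; ring.
  have := key p Fp; rewrite !(mevalM, mevalZ, rmorphXn, mevalXU) /= ?mevalXU.
  rewrite [p i1]/p /vec5 /= expr0n subn_eq0 leqNgt ea /= mulr0 mul0r => /eqP.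
  by rewrite eq_sym mulf_eq0 (negPf c0) (negPf Ai).
have AB1 v i : F.@[v] = 0 ->
    ('X_i0 ^+ (t - a) * B i).@[v] = (c *: ('X_i1 ^+ (e - a) * A i)).@[v].
  apply: eq_dense1 => {}v Fv v1; apply: (mulfI (expf_neq0 a v1)); have := AB v i Fv.
  rewrite !(mevalM, mevalZ, rmorphXn, mevalXU) /= ?mevalXU => ab.
  have va : v i1 ^+ e = v i1 ^+ a * v i1 ^+ (e - a) by rewrite -exprD subnKC.
  transitivity (v i0 ^+ (t - a) * v i1 ^+ a * (B i).@[v]); first by ring.
  by rewrite ab va; ring.
have Cex i : exists C, forall v, F.@[v] = 0 -> (A i).@[v] = ('X_i0 ^+ (t - a) * C).@[v].
  have [|C CE] := @vanishes_hartogs k s r e1 e2 e3 sr (t - a) (e - a) (A i) (c^-1 *: B i).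
    move=> v Fv; have := AB1 v i Fv.
    rewrite mevalB !(mevalM, mevalZ, rmorphXn, mevalXU) /= ?mevalXU => ab.
    by rewrite mulrCA ab mulrA mulVf // mul1r subrr.
  exists C => v Fv; apply/eqP; rewrite -subr_eq0 -mevalB; exact/eqP/CE.
have [C CA] := fin_all_exists Cex.
have CB i v : F.@[v] = 0 -> (B i).@[v] = (c *: ('X_i1 ^+ (e - a) * C i)).@[v].
  apply: eq_dense0 => {}v Fv v0; apply: (mulfI (expf_neq0 (t - a) v0)).
  have := AB1 v i Fv; have := CA i v Fv.
  rewrite !(mevalM, mevalZ, rmorphXn, mevalXU) /= ?mevalXU => -> ->; ring.
have C0 v : F.@[v] = 0 -> v i0 != 0 -> proportional (fun i => (C i).@[v]) (f v).
  move=> Fv v0; apply: proportional_trans (Af v Fv v0); apply: proportional_sym.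
  exists (v i0 ^+ (t - a)); first by rewrite expf_neq0.
  by move=> i; rewrite CA // mevalM rmorphXn /= mevalXU.
have C1 v : F.@[v] = 0 -> v i1 != 0 -> proportional (fun i => (C i).@[v]) (f v).
  move=> Fv v1; apply: proportional_trans (Bf v Fv v1); apply: proportional_sym.
  exists (c * v i1 ^+ (e - a)); first by rewrite mulf_neq0 ?expf_neq0.
  by move=> i; rewrite CB // mevalZ mevalM rmorphXn /= mevalXU mulrA.
exists C, m, (t - a)%N; split.
  move=> v x i Fv.
  pose sx (Q : {mpoly k[5]}) := msub (fun i => x *: 'X_i) Q.
  have sxE Q u : (sx Q).@[u] = Q.@[fun j => x * u j].
    by rewrite msub_eval; apply: meval_eq => j; rewrite mevalZ mevalXU.
  suff : (x ^+ (t - a) *: sx (C i)).@[v] = (x ^+ m *: C i).@[v] by rewrite !mevalZ sxE.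
  move: v Fv; apply: eq_dense0 => v Fv v0; apply: (mulfI (expf_neq0 (t - a) v0)).
  rewrite !mevalZ sxE.
  have := CA i (fun j => x * v j) _; rewrite (homog_eval _ _ (cubic_homog _ _ _ _ _)) Fv mulr0.
  move=> /(_ erefl); rewrite (homog_eval _ _ (hA i)) CA // !mevalM !rmorphXn /= !mevalXU exprMn.
  by move=> ea; rewrite [RHS]mulrCA ea; ring.
move=> v Fv vnz.
(* There remain the points with [x_0 = x_1 = 0]; the argument covers all points. *)
have [w [l [d [H [hw wv hH Hf]]]]] := map_local mf Fv vnz.
have minor (D : 'I_5 -> {mpoly k[5]}) (io : 'I_5) : io \in [:: i0; i1] ->
    (forall u, F.@[u] = 0 -> u io != 0 -> proportional (fun i => (D i).@[u]) (f u)) ->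
    forall i j, vanishes (H i * D j - H j * D i).
  move=> iop Df i j; apply: (vanishes_cancel hw Fv wv).
  have dense Q : (forall u, F.@[u] = 0 -> u io != 0 -> Q.@[u] = 0) -> vanishes Q.
    by move: iop; rewrite !inE => /orP[]/eqP ->; [exact: vanishes_dense | exact: vanishes_dense1].
  apply: dense => u Fu u0; rewrite mevalM mevalB !mevalM.
  have [->|wu] := eqVneq w.@[u] 0; first by rewrite mul0r.
  by rewrite (proportional_parallel (Hf u Fu (nzi _ _ u0) wu) (Df u Fu u0)) subrr mulr0.
have [t1 [d1 [P1 [_ P1E]]]] := Ap _ H hH (minor A i0 isT Af).
have [t2 [d2 [P2 [_ P2E]]]] := Bp _ H hH (minor B i1 isT Bf).
have {}P1E i u : F.@[u] = 0 -> u i0 ^+ t1 * (H i).@[u] = (P1 * 'X_i0 ^+ (t - a)).@[u] * (C i).@[u].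
  move=> Fu; have := P1E i u Fu; rewrite mevalB !mevalM !rmorphXn /= !mevalXU CA // mevalM rmorphXn /= mevalXU.
  by move=> /eqP; rewrite subr_eq0 => /eqP ->; ring.
have {}P2E i u : F.@[u] = 0 -> u i1 ^+ t2 * (H i).@[u] = (c *: (P2 * 'X_i1 ^+ (e - a))).@[u] * (C i).@[u].
  move=> Fu; have := P2E i u Fu.
  rewrite mevalB mevalZ !mevalM !rmorphXn /= !mevalXU CB // mevalZ mevalM rmorphXn /= mevalXU.
  by move=> /eqP; rewrite subr_eq0 => /eqP ->; ring.
set Q1 := P1 * _ in P1E; set Q2 := c *: _ in P2E; clearbody Q1 Q2.
have [|R RE] := @vanishes_hartogs k s r e1 e2 e3 sr t1 t2 Q1 Q2.
  apply: vanishes_dense => u Fu u0.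
  have [i Ci] := proportional_nonzero (C0 u Fu u0) (map_nonzero mf Fu (nzi _ _ u0)).
  apply: (mulIf Ci); rewrite mul0r mevalB !mevalM !rmorphXn /= !mevalXU mulrBl -!mulrA.
  by rewrite -P1E // -P2E // mulrCA subrr.
have HR i u : F.@[u] = 0 -> (H i).@[u] = (R * C i).@[u].
  apply: eq_dense0 => {}u Fu u0; apply: (mulfI (expf_neq0 t1 u0)).
  rewrite P1E //; have := RE u Fu; rewrite mevalB !mevalM rmorphXn /= mevalXU => /eqP.
  by rewrite subr_eq0 => /eqP ->; rewrite mulrA.
have Hv := Hf v Fv vnz wv; apply: (proportional_trans _ Hv); apply: proportional_sym.
exists R.@[v]; last by move=> i; rewrite HR // mevalM.
have [i Hi] := proportional_nonzero Hv (map_nonzero mf Fv vnz).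
by apply: contraNneq Hi => R0; rewrite HR // mevalM R0 mul0r.
Qed.

End TwoCharts.

(** * Automorphisms are linear *)

Section Linearity.
Variable k : closedFieldType.

Definition mulv n (M : 'M[k]_n) (v : 'I_n -> k) : 'I_n -> k := fun i => \sum_j M i j * v j.

Lemma mulv_scale n (M : 'M[k]_n) c v i : mulv M (fun j => c * v j) i = c * mulv M v i.
Proof. by rewrite /mulv mulr_sumr; apply: eq_bigr => j _; rewrite mulrCA. Qed.

Lemma mulv_lin n (M : 'M[k]_n) a b u v i :
  mulv M (fun j => a * u j + b * v j) i = a * mulv M u i + b * mulv M v i.
Proof.
rewrite -!mulv_scale /mulv -big_split /=; apply: eq_bigr => j _.
by rewrite mulrDr.
Qed.

Lemma eq_mulv n (M : 'M[k]_n) u v : u =1 v -> mulv M u =1 mulv M v.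
Proof. by move=> uv i; apply: eq_bigr => j _; rewrite uv. Qed.

Lemma mulv_mul n (M N : 'M[k]_n) v : mulv (M *m N) v =1 mulv M (mulv N v).
Proof.
move=> i; rewrite /mulv; under eq_bigr do rewrite mxE mulr_suml.
rewrite exchange_big /=; apply: eq_bigr => j _; rewrite mulr_sumr.
by apply: eq_bigr => l _; rewrite mulrA.
Qed.

Lemma mulv1 n (v : 'I_n -> k) : mulv 1%:M v =1 v.
Proof.
move=> i; rewrite /mulv (bigD1 i) //= mxE eqxx mul1r big1 ?addr0 // => j ji.
by rewrite mxE eq_sym (negPf ji) mul0r.
Qed.

Lemma mulv_proportional n (M : 'M[k]_n) u v :
  proportional u v -> proportional (mulv M u) (mulv M v).
Proof.
by move=> [c c0 uv]; exists c => // i; rewrite -mulv_scale; apply: eq_mulv.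
Qed.

Definition mulv_poly n (M : 'M[k]_n) i : {mpoly k[n]} := \sum_j M i j *: 'X_j.

Lemma mulv_polyE n (M : 'M[k]_n) i v : (mulv_poly M i).@[v] = mulv M v i.
Proof. by rewrite rmorph_sum; apply: eq_bigr => j _; rewrite /= mevalZ mevalXU. Qed.

(** The Taylor expansion at the origin to first order, in terms of values only. *)
Lemma linear_part n (p : {mpoly k[n]}) : exists c (l : 'I_n -> k), forall v,
  exists q : {poly k}, forall t,
    p.@[fun i => t * v i] = c + t * (\sum_j l j * v j) + t ^+ 2 * q.[t].
Proof.
elim/mpoly_generated: p => [a|p q [c [l lE]] [c' [l' lE']]|i p [c [l lE]]].
- exists a, (fun=> 0) => v; exists 0 => t; rewrite mevalC horner0 big1 ?mulr0 ?addr0 // => j _.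
  by rewrite mul0r.
- exists (c + c'), (fun j => l j + l' j) => v.
  have [u uE] := lE v; have [u' uE'] := lE' v; exists (u + u') => t.
  rewrite mevalD uE uE' hornerD; under [in RHS]eq_bigr do rewrite mulrDl.
  by rewrite big_split /=; ring.
exists 0, (fun j => if j == i then c else 0) => v; have [u uE] := lE v.
exists ((v i * \sum_j l j * v j)%:P + v i *: ('X * u)) => t.
have -> : \sum_j (if j == i then c else 0) * v j = c * v i.
  by rewrite (bigD1 i) //= eqxx big1 ?addr0 // => j /negPf ->; rewrite mul0r.
by rewrite mevalM mevalXU uE hornerD hornerC hornerZ hornerM hornerX; ring.
Qed.

Lemma eq_poly_generic (p q : {poly k}) : (forall t, t != 0 -> p.[t] = q.[t]) -> p = q.
Proof.
move=> pq; apply/eqP; rewrite -subr_eq0; apply/eqP.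
apply: (@poly_vanish_generic _ _ 'X); first by rewrite polyX_eq0.
by move=> t; rewrite hornerX => t0; rewrite hornerD hornerN pq ?subrr.
Qed.

Variables s r e1 e2 e3 : k.
Hypothesis sr : (s != 0) || (r != 0).
Local Notation F := (cubic s r e1 e2 e3).
Local Notation vanishes := (vanishes s r e1 e2 e3).
Local Notation map_on_cone := (map_on_cone s r e1 e2 e3).

Lemma cubic_scale c v : F.@[fun i => c * v i] = c ^+ 3 * F.@[v].
Proof. exact/homog_eval/cubic_homog. Qed.

Lemma scale_curve (p : {mpoly k[5]}) v : exists q : {poly k}, forall t, q.[t] = p.@[fun i => t * v i].
Proof.
have [q qE] := meval_curve p (fun i => v i *: 'X); exists q => t.
by rewrite qE; apply: meval_eq => i; rewrite hornerZ hornerX mulrC.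
Qed.

Lemma cubic_generic p q : (forall v, F.@[v] != 0 -> p.@[v] = q.@[v]) -> forall v, p.@[v] = q.@[v].
Proof.
move=> pq v; apply/eqP; rewrite -subr_eq0 -mevalB.
have -> : p - q = 0; last by rewrite meval0.
by apply: (mpoly_vanish_generic (cubic_neq0 e1 e2 e3 sr)) => u Fu; rewrite mevalB pq ?subrr.
Qed.

(** A multiple of [F] that is homogeneous of degree two is zero, for [F] has degree
    three. *)
Lemma vanishes_quadric P : vanishes P ->
  (forall c v, P.@[fun i => c * v i] = c ^+ 2 * P.@[v]) -> forall v, P.@[v] = 0.
Proof.
move=> /(vanishes_divides sr)[Q PE] hP v.
rewrite -[RHS](meval0 v); move: v; apply: cubic_generic => v Fv.
rewrite meval0 PE mevalM; have [q qE] := scale_curve Q v.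
have : 'X * q = q.[1]%:P.
  apply: eq_poly_generic => t t0; rewrite hornerM hornerX hornerC !qE.
  apply: (mulIf Fv); apply: (mulfI (expf_neq0 2 t0)).
  have := hP t v; rewrite PE !mevalM cubic_scale => e.
  rewrite (meval_eq Q (v1 := fun i => 1 * v i) (v2 := v)); last by move=> i; rewrite mul1r.
  by rewrite -e; ring.
move=> /(congr1 (horner_eval 0)); rewrite /horner_eval hornerM hornerX mul0r hornerC qE.
rewrite (meval_eq Q (v1 := fun i => 1 * v i) (v2 := v)); last by move=> i; rewrite mul1r.
by move=> <-; rewrite mul0r.
Qed.

Lemma vanishes_cubic_form P : vanishes P ->
  (forall c v, P.@[fun i => c * v i] = c ^+ 3 * P.@[v]) ->
  exists c, forall v, P.@[v] = c * F.@[v].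
Proof.
move=> /(vanishes_divides sr)[Q PE] hP; exists Q.@[fun=> 0] => v.
rewrite -[Q.@[_]](mevalC v) -mevalM PE; move: v; apply: cubic_generic => v Fv.
rewrite !mevalM mevalC; congr (_ * _); have [q qE] := scale_curve Q v.
have : q = q.[1]%:P.
  apply: eq_poly_generic => t t0; rewrite hornerC !qE.
  apply: (mulIf Fv); apply: (mulfI (expf_neq0 3 t0)).
  have := hP t v; rewrite PE !mevalM cubic_scale => e.
  rewrite (meval_eq Q (v1 := fun i => 1 * v i) (v2 := v)); last by move=> i; rewrite mul1r.
  by rewrite -e; ring.
move=> /(congr1 (horner_eval 0)); rewrite /horner_eval hornerC !qE.
rewrite (meval_eq Q (v1 := fun i => 1 * v i) (v2 := v)); last by move=> i; rewrite mul1r.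
by move=> <-; apply: meval_eq => i; rewrite mul0r.
Qed.

(** Homogeneity is only required on the cone, since the entries are determined
    modulo [F]. *)
Definition global_rep (C : 'I_5 -> {mpoly k[5]}) (d : nat) (f : ('I_5 -> k) -> 'I_5 -> k) :=
  (forall v c i, F.@[v] = 0 -> c != 0 -> (C i).@[fun j => c * v j] = c ^+ d * (C i).@[v]) /\
  forall v, F.@[v] = 0 -> nonzero v -> proportional (fun i => (C i).@[v]) (f v).

Lemma cubic_line a b : F.@[vec5 a b 0 0 0] = 0.
Proof. by rewrite cubicE /curve_form /vec5 /= !(mulr0, mul0r, addr0, expr0n). Qed.

(** A negative degree is impossible, since the entries are polynomials and do not
    all vanish at [1 : 0 : 0 : 0 : 0]. *)
Lemma global_repP f : map_on_cone f -> (exists (C : 'I_5 -> {mpoly k[5]}) m e,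
  (forall v c i, F.@[v] = 0 -> c ^+ e * (C i).@[fun j => c * v j] = c ^+ m * (C i).@[v]) /\
  forall v, F.@[v] = 0 -> nonzero v -> proportional (fun i => (C i).@[v]) (f v)) ->
  exists C d, global_rep C d f.
Proof.
move=> mf [C [m [e [hC Cf]]]]; exists C, (m - e)%N; split=> // v c i Fv c0.
have [em|me] := leqP e m.
  apply: (mulfI (expf_neq0 e c0)); rewrite hC // mulrA -exprD subnKC //.
pose p : 'I_5 -> k := vec5 1 0 0 0 0.
have Fp : F.@[p] = 0 := cubic_line 1 0.
have pnz : nonzero p by exists i0; apply: oner_neq0.
have [j] := proportional_nonzero (Cf p Fp pnz) (map_nonzero mf Fp pnz).
have [q qE] := scale_curve (C j) p; have : 'X ^+ (e - m) * q = ((C j).@[p])%:P.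
  apply: eq_poly_generic => t t0; rewrite hornerM hornerXn hornerC qE.
  by apply: (mulfI (expf_neq0 m t0)); rewrite mulrA -exprD subnKC ?(ltnW me) // hC.
move=> /(congr1 (horner_eval 0)); rewrite /horner_eval hornerM hornerXn hornerC.
by rewrite expr0n subn_eq0 leqNgt me mul0r => <-; rewrite eqxx.
Qed.

Variables (f g : ('I_5 -> k) -> 'I_5 -> k).
Hypotheses (mf : map_on_cone f) (mg : map_on_cone g).
Hypothesis fF : forall v, F.@[v] = 0 -> nonzero v -> F.@[f v] = 0.
Hypothesis fK : forall v, F.@[v] = 0 -> nonzero v -> proportional (g (f v)) v.

Lemma rep_on_cubic C d v : global_rep C d f -> F.@[v] = 0 -> nonzero v ->
  F.@[fun i => (C i).@[v]] = 0.
Proof.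
move=> [_ Cf] Fv vnz; have [c c0 cE] := Cf v Fv vnz.
by rewrite (meval_eq _ cE) cubic_scale fF ?mulr0.
Qed.

Lemma rep_comp C d C' d' v : global_rep C d f -> global_rep C' d' g ->
  F.@[v] = 0 -> nonzero v ->
  proportional (fun i => (C' i).@[fun j => (C j).@[v]]) v.
Proof.
move=> hC [_ Cg] Fv vnz; have Cv := hC.2 v Fv vnz.
have fnz := map_nonzero mf Fv vnz.
apply: proportional_trans (Cg _ (rep_on_cubic hC Fv vnz) (proportional_nonzero Cv fnz)) _.
apply: proportional_trans (fK Fv vnz).
by apply: (map_proportional mg) => //; apply: fF.
Qed.

(** On the line [x_2 = x_3 = x_4 = 0], which lies in [X], the composite [E] of the two
    representations is the identity up to scalars. At [t : 1] its second coordinate is a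
    polynomial in [t] without zeros, hence a constant, and so is the first coordinate
    at [1 : t]; comparing them leaves only degree one. *)
Lemma rep_degree C d C' d' : global_rep C d f -> global_rep C' d' g -> (d * d' = 1)%N.
Proof.
move=> hC hC'.
pose E i := msub C (C' i).
have EE i v : (E i).@[v] = (C' i).@[fun j => (C j).@[v]] by rewrite msub_eval.
have Ehom v c i : F.@[v] = 0 -> nonzero v -> c != 0 ->
    (E i).@[fun j => c * v j] = c ^+ (d * d') * (E i).@[v].
  move=> Fv vnz c0; rewrite !EE.
  rewrite (meval_eq _ (v2 := fun j => c ^+ d * (C j).@[v])); last first.
    by move=> j; apply: hC.1.
  by rewrite hC'.1 ?expf_neq0 // ?(rep_on_cubic hC) // exprM.
have Epar v : F.@[v] = 0 -> nonzero v -> proportional (fun i => (E i).@[v]) v.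
  move=> Fv vnz; have := rep_comp hC hC' Fv vnz; apply: proportional_trans.
  exact: proportional_eq.
have [p pE] := meval_curve (E i1) (vec5 'X 1%:P 0 0 0).
have [q qE] := meval_curve (E i0) (vec5 1%:P 'X 0 0 0).
have {}pE t : p.[t] = (E i1).@[vec5 t 1 0 0 0].
  by rewrite pE; apply: meval_eq; apply: ord5P; rewrite /vec5 /= ?hornerX ?hornerC ?horner0.
have {}qE t : q.[t] = (E i0).@[vec5 1 t 0 0 0].
  by rewrite qE; apply: meval_eq; apply: ord5P; rewrite /vec5 /= ?hornerX ?hornerC ?horner0.
have nz0 (t : k) : nonzero (vec5 1 t 0 0 0) by exists i0; apply: oner_neq0.
have nz1 (t : k) : nonzero (vec5 t 1 0 0 0) by exists i1; apply: oner_neq0.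
have pC : p = (p.[0])%:P.
  apply: nowhere_zero_poly => t; rewrite pE.
  by have [c c0 ->] := Epar _ (cubic_line t 1) (nz1 t); rewrite /vec5 /= mulr1.
have qC : q = (q.[0])%:P.
  apply: nowhere_zero_poly => t; rewrite qE.
  by have [c c0 ->] := Epar _ (cubic_line 1 t) (nz0 t); rewrite /vec5 /= mulr1.
have p0 : p.[0] != 0.
  by rewrite pE; have [c c0 ->] := Epar _ (cubic_line 0 1) (nz1 0); rewrite /vec5 /= mulr1.
have q0 : q.[0] != 0.
  by rewrite qE; have [c c0 ->] := Epar _ (cubic_line 1 0) (nz0 0); rewrite /vec5 /= mulr1.
have pq : (p.[0])%:P * 'X = (q.[0])%:P * 'X ^+ (d * d').
  apply: eq_poly_generic => t t0; rewrite !hornerM !hornerC hornerX hornerXn.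
  have -> : p.[0] = p.[t] by rewrite [in RHS]pC hornerC.
  have -> : q.[0] = q.[t^-1] by rewrite [in RHS]qC hornerC.
  have [c c0 cE] := Epar _ (cubic_line t 1) (nz1 t).
  have := Ehom _ _ i0 (cubic_line 1 t^-1) (nz0 t^-1) t0; rewrite -qE mulrC => <-.
  rewrite (meval_eq _ (v2 := vec5 t 1 0 0 0)).
    by rewrite pE !cE /vec5 /= mulr1 mulrC.
  by apply: ord5P; rewrite /vec5 /= ?mulr0 ?mulr1 ?mulfV.
have := congr1 (fun x : {poly k} => size x) pq.
by rewrite !mul_polyC !size_scale // size_polyX size_polyXn => -[].
Qed.

(** The entries of the representation agree on the cone with their linear terms. *)
Lemma rep_linear C : global_rep C 1 f ->
  exists M : 'M[k]_5, forall v, F.@[v] = 0 -> nonzero v -> proportional (mulv M v) (f v).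
Proof.
move=> [hC Cf]; have [c cl] := fin_all_exists (fun i => linear_part (C i)).
have [l lE] := fin_all_exists cl.
exists (\matrix_(i, j) l i j) => v Fv vnz.
apply: proportional_trans (Cf v Fv vnz); apply: proportional_eq => i.
have [q qE] := lE i v.
have : ((C i).@[v]) *: 'X = (c i)%:P + (\sum_j l i j * v j) *: 'X + 'X ^+ 2 * q.
  apply: eq_poly_generic => t t0; rewrite !hornerD hornerM !hornerZ hornerXn hornerC hornerX.
  by have := qE t; rewrite hC // expr1 => e; rewrite mulrC e [in RHS](mulrC _ t).
move=> /(congr1 (fun p : {poly k} => p`_1)); rewrite !coefD !coefZ coefX coefC coefXnM /= !mulr1.
by rewrite add0r addr0 => ->; apply: eq_bigr => j _; rewrite mxE.
Qed.

Lemma parallel_scalar n (K : 'M[k]_n) : (forall v, parallel (mulv K v) v) ->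
  exists c, K = c%:M.
Proof.
move=> Kv; pose e (j : 'I_n) : 'I_n -> k := fun l => (l == j)%:R.
have Ke i j : mulv K (e j) i = K i j.
  rewrite /mulv (bigD1 j) //= /e eqxx mulr1 big1 ?addr0 // => l /negPf ->.
  by rewrite mulr0.
have off i j : i != j -> K i j = 0.
  move=> ij; have := Kv (e j) i j; rewrite !Ke /e eqxx mulr1 => ->.
  by rewrite (negPf ij) mulr0.
have diag i j : K i i = K j j.
  have [->//|ij] := eqVneq i j.
  have := Kv (fun l => e i l + e j l) i j.
  have KD l : mulv K (fun l => e i l + e j l) l = K l i + K l j.
    by rewrite -!Ke /mulv -big_split /=; apply: eq_bigr => m _; rewrite mulrDr.
  rewrite !KD /e !eqxx [j == i]eq_sym (negPf ij) addr0 add0r !mulr1.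
  by rewrite (off i j) // (off j i) 1?eq_sym // addr0 add0r.
case: n K Kv @e Ke off diag => [|n] K Kv e Ke off diag.
  by exists 0; apply/matrixP => -[].
exists (K ord0 ord0); apply/matrixP => i j; rewrite mxE.
by have [->|ij] := eqVneq i j; [rewrite mulr1n (diag j ord0) | rewrite mulr0n off].
Qed.

(** The two-by-two minors of [M v] and [N v] are quadratic forms in [v]. *)
Lemma parallel_on_cubic (M N : 'M[k]_5) :
  (forall v, F.@[v] = 0 -> nonzero v -> parallel (mulv M v) (mulv N v)) ->
  forall v, parallel (mulv M v) (mulv N v).
Proof.
move=> MN v i j.
pose Q := mulv_poly M i * mulv_poly N j - mulv_poly M j * mulv_poly N i.
have QE u : Q.@[u] = mulv M u i * mulv N u j - mulv M u j * mulv N u i.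
  by rewrite mevalB !mevalM !mulv_polyE.
have Q0 : Q.@[v] = 0.
  apply: vanishes_quadric => [u Fu|c u]; last by rewrite !QE !mulv_scale; ring.
  rewrite QE; have [unz|uz] := classic (nonzero u).
    by rewrite (MN u Fu unz i j) subrr.
  have u0 l : u l = 0 by apply/eqP; apply: contra_notT uz => ul; exists l.
  by rewrite /mulv !big1 ?mul0r ?subrr // => l _; rewrite u0 mulr0.
by apply/eqP; rewrite -subr_eq0 -QE Q0.
Qed.

Lemma parallel_right_unit (M N : 'M[k]_5) : M \in unitmx ->
  (forall v, F.@[v] = 0 -> nonzero v -> parallel (mulv N v) (mulv M v)) ->
  exists c, N = c *: M.
Proof.
move=> uM /parallel_on_cubic MN; have [|c cE] := @parallel_scalar _ (N *m invmx M).
  move=> v i j; have := MN (mulv (invmx M) v) i j.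
  by rewrite -!mulv_mul mulmxV // !mulv1.
by exists c; rewrite -[N](mulmxKV uM) cE mul_scalar_mx.
Qed.

End Linearity.

Section LinearAutomorphism.
Variable k : closedFieldType.
Variables s r e1 e2 e3 : k.
Hypothesis sr : (s != 0) || (r != 0).
Local Notation F := (cubic s r e1 e2 e3).
Local Notation map_on_cone := (map_on_cone s r e1 e2 e3).
Local Notation global_rep := (global_rep s r e1 e2 e3).
Variables (f g : ('I_5 -> k) -> 'I_5 -> k).
Hypotheses (mf : map_on_cone f) (mg : map_on_cone g).
Hypothesis fF : forall v, F.@[v] = 0 -> nonzero v -> F.@[f v] = 0.
Hypothesis fK : forall v, F.@[v] = 0 -> nonzero v -> proportional (g (f v)) v.
Hypothesis repf : exists C d, global_rep C d f.
Hypothesis repg : exists C d, global_rep C d g.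

Lemma linear_automorphism : exists M : 'M[k]_5, [/\ M \in unitmx,
  forall v, F.@[v] = 0 -> nonzero v -> proportional (mulv M v) (f v)
  & exists c, forall v, F.@[mulv M v] = c * F.@[v]].
Proof.
have [C [d hC]] := repf; have [C' [d' hC']] := repg.
have dd' := rep_degree mf mg fF fK hC hC'.
have /andP[/eqP d1 /eqP d1'] : (d == 1)%N && (d' == 1)%N by rewrite -muln_eq1 dd'.
rewrite d1 in hC; rewrite d1' in hC'.
have [M Mf] := rep_linear hC; have [N Ng] := rep_linear hC'.
have MF v : F.@[v] = 0 -> nonzero v -> F.@[mulv M v] = 0.
  move=> Fv vnz; have [c c0 cE] := Mf v Fv vnz.
  by rewrite (meval_eq _ cE) cubic_scale fF ?mulr0.
have NM v : F.@[v] = 0 -> nonzero v -> proportional (mulv (N *m M) v) v.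
  move=> Fv vnz; have Mv := Mf v Fv vnz; have fnz := map_nonzero mf Fv vnz.
  apply: proportional_trans (proportional_eq (mulv_mul N M v)) _.
  apply: proportional_trans (Ng _ (MF _ Fv vnz) (proportional_nonzero Mv fnz)) _.
  apply: proportional_trans (fK Fv vnz).
  by apply: (map_proportional mg) => //; apply: fF.
have [c cE] : exists c, N *m M = c%:M.
  apply: parallel_scalar => v i j.
  have := @parallel_on_cubic _ s r e1 e2 e3 sr (N *m M) 1%:M _ v i j.
  rewrite !mulv1; apply => u Fu unz i' j'; rewrite !mulv1.
  by apply: (proportional_parallel (NM u Fu unz)); apply: proportional_refl.
have c0 : c != 0.
  have Fp := cubic_line s r e1 e2 e3 1 0.
  have pnz : nonzero (vec5 (1 : k) 0 0 0 0) by exists i0; apply: oner_neq0.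
  have [x x0 xE] := NM _ Fp pnz; apply: contraNneq x0 => c0.
  have := xE i0; rewrite cE c0 /vec5 /= mulr1 => <-.
  by rewrite /mulv big1 // => j _; rewrite mxE mul0rn mul0r.
have uM : M \in unitmx.
  have : (c^-1 *: N) *m M = 1%:M by rewrite -scalemxAl cE scale_scalar_mx mulVf.
  by move/mulmx1_unit => -[].
exists M; split=> //.
have FE v : (msub (mulv_poly M) F).@[v] = F.@[mulv M v].
  by rewrite msub_eval; apply: meval_eq => i; rewrite mulv_polyE.
have [||x xE] := @vanishes_cubic_form _ s r e1 e2 e3 sr (msub (mulv_poly M) F).
- move=> v Fv; rewrite FE; have [vnz|vz] := classic (nonzero v); first exact: MF.
  have v0 l : v l = 0 by apply/eqP; apply: contra_notT vz => vl; exists l.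
  rewrite -Fv; apply: meval_eq => i; rewrite v0 /mulv big1 // => l _.
  by rewrite v0 mulr0.
- by move=> x v; rewrite !FE -cubic_scale; apply: meval_eq => i; rewrite mulv_scale.
by exists x => v; rewrite -FE xE.
Qed.

End LinearAutomorphism.

(** * Factors of a power of a quadratic polynomial *)

Section QuadraticDivisors.
Variable D : idomainType.
Hypothesis ufdD : ufd D.
Variables A B C : D.
Hypothesis Airr : A \is a GRing.unit \/ prime_elt A.
Hypothesis disc : forall t, B ^+ 2 - 4%:R * A * C != t ^+ 2.

Local Notation h := (A *: 'X^2 + B *: 'X + C%:P : {poly D}).

Lemma quadratic_lead_neq0 : A != 0.
Proof. by apply: contraNneq (disc B) => ->; rewrite mulr0 mul0r subr0. Qed.

Lemma size_quadratic : size h = 3%N.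
Proof.
rewrite -addrA size_polyDl size_scale ?quadratic_lead_neq0 ?size_polyXn //.
apply: leq_ltn_trans (size_polyD _ _) _; rewrite gtn_max; apply/andP; split.
  by apply: leq_ltn_trans (size_scale_leq _ _) _; rewrite size_polyX.
by apply: leq_ltn_trans (size_polyC_leq1 _) _.
Qed.

Lemma divides_lead a : divides a A ->
  a \is a GRing.unit \/ exists2 u, u \is a GRing.unit & a = u * A.
Proof.
move=> [b bE]; have [Au|[A0 _ Ap]] := Airr.
  by left; move: Au; rewrite bE unitrM => /andP[].
have [|[c cE]|[c cE]] := Ap b a; first by rewrite -bE; apply: divides_refl.
- left; apply/unitrP; exists c; have ca : c * a = 1.
    by apply: (mulfI A0); rewrite mulr1 [RHS]bE cE; ring.
  by rewrite ca mulrC ca.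
- right; exists c => //; apply/unitrP; exists b; have cb : c * b = 1.
    by apply: (mulfI A0); rewrite mulr1 [RHS]bE cE; ring.
  by rewrite cb mulrC cb.
Qed.

Lemma unit_polyC (u : D) : u \is a GRing.unit -> u%:P \is a GRing.unit.
Proof.
move=> uu; have u0 : u != 0 by apply: contraTneq uu => ->; rewrite unitr0.
by rewrite poly_unitE coefC eqxx size_polyC u0.
Qed.

(** A factorization into two linear polynomials would make the discriminant a
    square. *)
Lemma prime_divides_quadratic p : prime_elt p -> divides p h ->
  exists2 u, u \is a GRing.unit &
    [\/ p = (u * A)%:P, p = u *: h | A *: p = u *: h].
Proof.
move=> [p0 pu _] [q hE]; have h0 : h != 0 by rewrite -size_poly_gt0 size_quadratic.
have q0 : q != 0 by apply: contraNneq h0 => q0; rewrite hE q0 mul0r.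
have sz : (size q + size p = 4)%N.
  have := congr1 (fun x : {poly D} => size x) hE; rewrite size_quadratic size_mul //.
  by case: (_ + _)%N => // n /= ->.
have cE i : h`_i = (q * p)`_i by rewrite -hE.
have h2 : h`_2 = A by rewrite !coefD !coefZ coefXn coefX coefC /= mulr1 mulr0 !addr0.
have h1 : h`_1 = B by rewrite !coefD !coefZ coefXn coefX coefC /= mulr1 mulr0 add0r addr0.
have h0' : h`_0 = C by rewrite !coefD !coefZ coefXn coefX coefC /= !mulr0 !add0r.
have sp : size p != 0%N by rewrite size_poly_eq0.
have sq : size q != 0%N by rewrite size_poly_eq0.
have [sp1|sp1] := eqVneq (size p) 1%N.
  have pC : p = (p`_0)%:P by apply: size1_polyC; rewrite sp1.
  have Ap : A = q`_2 * p`_0 by rewrite -h2 cE pC coefMC coefC eqxx.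
  have [pu0|[u uu uE]] := @divides_lead p`_0 (ex_intro _ _ Ap).
    by move: pu; rewrite pC unit_polyC.
  by exists u => //; constructor 1; rewrite -uE.
have [sq1|sq1] := eqVneq (size q) 1%N.
  have qC : q = (q`_0)%:P by apply: size1_polyC; rewrite sq1.
  have [|qu0|[u uu uE]] := @divides_lead q`_0.
  - by exists p`_2; rewrite -h2 cE qC coefCM coefC eqxx mulrC.
  - exists (q`_0)^-1; first by rewrite unitrV.
    by constructor 2; rewrite hE [X in X * p]qC mul_polyC scalerA mulVr // scale1r.
  - exists u^-1; first by rewrite unitrV.
    by constructor 3; rewrite hE [X in X * p]qC uE mul_polyC scalerA mulKr.
have sp2 : size p = 2%N.
  by move: sz sp sq sp1 sq1; lia.
have sq2 : size q = 2%N by move: sz; rewrite sp2 addnC => -[].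
have lin (x : {poly D}) : size x = 2%N -> x = x`_1 *: 'X + (x`_0)%:P.
  move=> sx; apply/polyP => -[|[|i]]; rewrite coefD coefZ coefX coefC /= ?mulr0 ?mulr1 ?add0r ?addr0 //.
  by rewrite nth_default // sx.
set a := q`_1; set b := q`_0; set c := p`_1; set d := p`_0.
have qpE : q * p = (a * c) *: 'X^2 + (a * d + b * c) *: 'X + (b * d)%:P.
  by rewrite (lin q sq2) (lin p sp2) -/a -/b -/c -/d -!mul_polyC !polyCD !polyCM; ring.
have AE : A = a * c.
  by rewrite -h2 cE qpE !coefD !coefZ coefXn coefX coefC /= mulr1 mulr0 !addr0.
have BE : B = a * d + b * c.
  by rewrite -h1 cE qpE !coefD !coefZ coefXn coefX coefC /= mulr1 mulr0 add0r addr0.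
have CE : C = b * d.
  by rewrite -h0' cE qpE !coefD !coefZ coefXn coefX coefC /= !mulr0 !add0r.
by have /eqP[] := disc (b * c - a * d); rewrite AE BE CE; ring.
Qed.

(** Each prime factor of [p] is the leading coefficient [A], or [h], or [h] divided
    by [A], up to units. *)
Lemma quadratic_factor p q m : p * q = h ^+ m ->
  exists u i l j, u \is a GRing.unit /\ A ^+ i *: p = (u * A ^+ l) *: h ^+ j.
Proof.
move=> pq; have h0 : h != 0 by rewrite -size_poly_gt0 size_quadratic.
have p0 : p != 0.
  by apply: contraTneq (expf_neq0 m h0) => p0; rewrite -pq p0 mul0r eqxx.
have [v [ps [vu psp pE]]] := ufd_poly ufdD p0.
have psh : {in ps, forall x, divides x h}.
  move=> x xps; have [_ xu xp] := psp x xps.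
  have : divides x (h ^+ m).
    rewrite -pq pE (big_rem x) //=; exists (v * \prod_(y <- rem x ps) y * q).
    by rewrite !mulrA; ring.
  elim: (m) => [[c cE]|m' IH]; last by rewrite exprS => /xp[].
  by case/negP: xu; apply/unitrP; exists c; rewrite [x * c]mulrC -cE expr0.
move: pE; elim: ps p {pq p0} psp psh => [|x ps IH] p psp psh pE.
  exists v`_0, 0%N, 0%N, 0%N; move: vu; rewrite poly_unitE => /andP[/eqP sv uv].
  split=> //; rewrite pE big_nil mulr1 !expr0 mulr1 scale1r alg_polyC.
  by apply: size1_polyC; rewrite sv.
have [||u [i [l [j [uu IHE]]]]] := IH (v * \prod_(y <- ps) y) _ _ erefl.
- by move=> y yps; apply: psp; rewrite inE yps orbT.
- by move=> y yps; apply: psh; rewrite inE yps orbT.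
have [w wu] := prime_divides_quadratic (psp x (mem_head _ _)) (psh x (mem_head _ _)).
have {}pE : p = x * (v * \prod_(y <- ps) y) by rewrite pE big_cons mulrCA.
case=> xE.
- exists (w * u), i, l.+1, j; rewrite unitrM wu uu; split=> //.
  rewrite pE xE mul_polyC scalerA [A ^+ i * _]mulrC -(scalerA _ (A ^+ i)) IHE scalerA (exprS A).
  by congr (_ *: _); ring.
- exists (w * u), i, l, j.+1; rewrite unitrM wu uu; split=> //.
  rewrite pE xE -scalerAl scalerA [A ^+ i * w]mulrC -(scalerA w (A ^+ i)) scalerAr IHE -scalerAr scalerA (exprS h).
  by congr (_ *: _); ring.
- exists (w * u), i.+1, l, j.+1; rewrite unitrM wu uu; split=> //.
  rewrite pE exprSr -scalerA [A *: _]scalerAl xE -scalerAl scalerA [A ^+ i * w]mulrC -(scalerA w (A ^+ i)).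
  by rewrite scalerAr IHE -scalerAr scalerA (exprS h); congr (_ *: _); ring.
Qed.

End QuadraticDivisors.

Section ChartTools.
Variable k : closedFieldType.

Lemma nth_root n (x : k) : (0 < n)%N -> exists y, y ^+ n = x.
Proof.
move=> n0; have : size ('X^n - x%:P) != 1%N by rewrite size_XnsubC // eqSS -lt0n.
move=> /closed_rootP[y]; rewrite /root hornerD hornerN hornerXn hornerC subr_eq0 => /eqP.
by exists y.
Qed.

Lemma cubic_monomial_not_square c (q : {poly k}) : c != 0 -> c *: 'X^3 != q ^+ 2.
Proof.
move=> c0; apply/eqP => e; have := congr1 (fun p : {poly k} => size p) e.
rewrite size_scale // size_polyXn expr2; have [->|q0] := eqVneq q 0.
  by rewrite mul0r size_poly0.
rewrite size_mul //; lia.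
Qed.

Lemma msub_diag n (d : 'I_n -> k) p m :
  (msub (fun j => d j *: 'X_j) p)@_m = (\prod_j d j ^+ m j) * p@_m.
Proof.
have XE m' : msub (fun j => d j *: 'X_j) 'X_[m'] = (\prod_j d j ^+ m' j) *: 'X_[m'].
  rewrite mpolyXE_id rmorph_prod /= -scaler_prod; apply: eq_bigr => j _.
  by rewrite rmorphXn /= msubX exprZn.
rewrite [in LHS](mpolyE p) rmorph_sum raddf_sum /=.
rewrite [in RHS](mpolyE p) raddf_sum /= mulr_sumr; apply: eq_bigr => m' _.
rewrite -mul_mpolyC rmorphM /= msubC XE -mul_mpolyC !mcoeffCM mcoeffX.
by case: (eqVneq m' m) => [->|_]; rewrite ?mulr0 ?mulr1 // mulrC.
Qed.

(** A diagonal automorphism scales each monomial, so an invariant polynomial only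
    involves invariant monomials. *)
Lemma diag_support n (d : 'I_n -> k) (p : {mpoly k[n]}) :
  (forall Y, p.@[fun j => d j * Y j] = p.@[Y]) ->
  forall m, m \in msupp p -> \prod_j d j ^+ m j = 1.
Proof.
move=> dp m mp; have pm : p@_m != 0 by rewrite -mcoeff_msupp.
apply: (mulIf pm); rewrite mul1r -msub_diag; congr (_@_m).
apply: mpoly_ext => Y; rewrite -dp msub_eval; apply: meval_eq => j.
by rewrite mevalZ mevalXU.
Qed.

Lemma lift_monomials n m (pi : 'I_m -> {mpoly k[n]}) (p : {mpoly k[n]}) :
  (forall e, e \in msupp p -> exists P, 'X_[e] = msub pi P) -> exists P, p = msub pi P.
Proof.
move=> pe; rewrite [p]mpolyE big_seq.
elim/big_ind: _ => [|_ _ [P ->] [Q ->]|e /pe[P ->]].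
- by exists 0; rewrite rmorph0.
- by exists (P + Q); rewrite rmorphD.
- by exists ((p@_e)%:MP * P); rewrite rmorphM /= msubC mul_mpolyC.
Qed.

Lemma unit_mpoly n (u : {mpoly k[n]}) : u \is a GRing.unit ->
  exists2 c, c != 0 & u = c%:MP.
Proof.
move=> uu; have u0 : u != 0 by apply: contraTneq uu => ->; rewrite unitr0.
move: uu; rewrite unfold_in => /andP[/eqP uE _]; exists u@_0 => //.
by apply: contraNneq u0 => u00; rewrite uE u00 mpolyC0.
Qed.

Lemma muni_widenX n (i : 'I_n.+1) (j : 'I_n) : val i = val j ->
  muni ('X_i : {mpoly k[n.+1]}) = ('X_j : {mpoly k[n]})%:P.
Proof. by move=> ij; rewrite -muniX_widen; congr (muni 'X_ _); apply: val_inj. Qed.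

Lemma muni_maxX n (i : 'I_n.+1) : val i = n -> muni ('X_i : {mpoly k[n.+1]}) = 'X.
Proof. by move=> ij; rewrite -(muniX_max k n); congr (muni 'X_ _); apply: val_inj. Qed.

(** The condition [units1] in coordinates, when [h] is quadratic in the last
    variable. By [quadratic_factor], [p] is a power of [h] up to powers of [A]. Either
    [A] is a unit, or [d] scales it by an element [x] of infinite order, and
    then invariance of [p] and [h] under [d] forces the powers of [A] to cancel. As [h]
    vanishes at the origin it is not a unit, which bounds the exponent. *)
Lemma chart_units n (h : {mpoly k[n.+1]}) (A B C : {mpoly k[n]}) (d : 'I_n.+1 -> k) (x : k) :
  muni h = A *: 'X^2 + B *: 'X + C%:P ->
  A \is a GRing.unit \/ prime_elt A ->
  (forall t, B ^+ 2 - 4%:R * A * C != t ^+ 2) ->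
  (forall Y, h.@[fun j => d j * Y j] = h.@[Y]) -> h.@[fun=> 0] = 0 ->
  (forall Y, (mwiden A).@[fun j => d j * Y j] = x * (mwiden A).@[Y]) ->
  (A \is a GRing.unit \/ forall i l, x ^+ i = x ^+ l -> i = l) ->
  forall p q m, (forall Y, p.@[fun j => d j * Y j] = p.@[Y]) -> p * q = h ^+ m ->
  exists c a, [/\ c != 0, (a <= m)%N & p = c *: h ^+ a].
Proof.
move=> hE Airr disc dh h0 Ax Aux p q m dp pq.
have hnz : h != 0.
  rewrite -(rmorph0 (@muni_inv k n)) -(inj_eq (can_inj (@muniK k n))) muni_invK hE.
  by rewrite -size_poly_gt0 (size_quadratic disc).
have pnz : p != 0.
  by apply: contraTneq (expf_neq0 m hnz) => p0; rewrite -pq p0 mul0r eqxx.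
have Anz : mwiden A != 0.
  by rewrite -(mwiden0 n k) (inj_eq (@inj_mwiden n k)) (quadratic_lead_neq0 disc).
suff [c [a [c0 pE]]] : exists c a, c != 0 /\ p = c *: h ^+ a.
  exists c, a; split=> //; rewrite leqNgt; apply/negP => lt.
  have : c *: h ^+ (a - m) * q = 1.
    apply: (mulfI (expf_neq0 m hnz)); rewrite mulr1 -[RHS]pq pE.
    by rewrite -[in RHS](subnKC (ltnW lt)) exprD -!mul_mpolyC; ring.
  move=> /(congr1 (meval (fun=> 0))); rewrite mevalM mevalZ rmorphXn /= h0 meval1.
  by rewrite expr0n subn_eq0 leqNgt lt mulr0 mul0r => /esym/eqP; rewrite oner_eq0.
have [|u [i [l [j [uu e]]]]] := quadratic_factor (@ufd_mpoly k n) Airr disc (p := muni p) (q := muni q) (m := m).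
  by rewrite -rmorphM pq rmorphXn /= hE.
have [c c0 uE] := unit_mpoly uu.
have {}e : mwiden A ^+ i * p = c *: (mwiden A ^+ l * h ^+ j).
  apply: (can_inj (@muniK k n)).
  rewrite -mul_mpolyC !rmorphM !rmorphXn /= hE muniC.
  have -> : muni (mwiden A) = A%:P by rewrite -muni_invC muni_invK.
  by rewrite -uE -!polyC_exp !mul_polyC e scalerA.
case: Aux => [/unit_mpoly[a a0 AE]|xi].
  exists (a ^- i * (c * a ^+ l)), j; split; first by rewrite !mulf_neq0 ?invr_eq0 ?expf_neq0.
  have aX t : (a%:MP : {mpoly k[n.+1]}) ^+ t = (a ^+ t)%:MP by rewrite rmorphXn.
  move: e; rewrite AE mwidenC !aX !mul_mpolyC => e.
  by rewrite -scalerA -scalerA -e scalerA mulVf ?scale1r ?expf_neq0.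
exists c, j; split=> //; have il : i = l.
  apply: xi; have : mwiden A ^+ i * p != 0 by rewrite mulf_neq0 ?expf_neq0.
  move=> nz; have [Y] : exists Y, (mwiden A ^+ i * p).@[Y] != 0.
    by apply: NNPP => no; case/eqP: nz; apply: mpoly_vanish => Y; apply/eqP; apply: contra_notT no; exists Y.
  move=> nzY; apply: (mulIf nzY).
  have := congr1 (meval (fun j => d j * Y j)) e.
  have := congr1 (meval Y) e.
  rewrite !(mevalM, mevalZ, rmorphXn) /= Ax dp dh !exprMn => e0.
  by rewrite -mulrA e0 => ->; ring.
by apply: (mulfI (expf_neq0 i Anz)); rewrite e il -scalerAr.
Qed.

Variables s r e1 e2 e3 : k.

(** Both cubics are symmetric in [x_0] and [x_1]. *)
Lemma chart_swap n (h a2 a3 a4 : {mpoly k[n]}) :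
  chart s r e1 e2 e3 i1 (vec5 h 1 a2 a3 a4) ->
  chart s r e1 e2 e3 i0 (vec5 1 h a2 a3 a4).
Proof.
move=> [_ on surj [d [d0 pd lift]]].
have sw Y : (fun i => (vec5 1 h a2 a3 a4 i).@[Y]) =1
   (let v := fun i => (vec5 h 1 a2 a3 a4 i).@[Y] in vec5 (v i1) (v i0) (v i2) (v i3) (v i4)).
  by apply: ord5P.
split=> //.
- by move=> Y; rewrite (meval_eq _ (sw Y)) cubic_swap on.
- move=> v Fv v0.
  have [||Y YE] := surj (vec5 (v i1) (v i0) (v i2) (v i3) (v i4)); rewrite ?cubic_swap //.
  by exists Y; apply: ord5P; [have := YE i1|have := YE i0|have := YE i2|have := YE i3|have := YE i4].
exists d; split=> //.
  by move=> Y; apply: ord5P; [apply: (pd Y i1)|apply: (pd Y i0)|apply: (pd Y i2)|apply: (pd Y i3)|apply: (pd Y i4)].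
move=> p /lift[P PE]; exists (msub (vec5 'X_i1 'X_i0 'X_i2 'X_i3 'X_i4) P).
rewrite PE; apply: mpoly_ext => Y; rewrite !msub_eval; apply: meval_eq.
by apply: ord5P; rewrite /vec5 /= msub_eval || rewrite /vec5 /= mevalXU.
Qed.

End ChartTools.

(** * The chart of the second family *)

Section CuspidalChart.
Variable k : closedFieldType.
Hypothesis char0 : [pchar k] =i pred0.
Variables e2 e3 : k.

Local Notation a := ('X_(@Ordinal 3 0 isT) : {mpoly k[3]}).
Local Notation b := ('X_(@Ordinal 3 1 isT) : {mpoly k[3]}).
Local Notation c := ('X_(@Ordinal 3 2 isT) : {mpoly k[3]}).
Local Notation h := (- (c ^+ 2 + a ^+ 3 + e2%:MP * a * b ^+ 4 + e3%:MP * b ^+ 6)).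
Local Notation pi1 := (vec5 h 1 c (a * b) (b ^+ 3)).

Lemma natr_neq0 n : n.+1%:R != 0 :> k.
Proof. by rewrite ((pcharf0P k).1 char0). Qed.

Lemma primitive_cube_root : exists2 z : k, z != 1 & z ^+ 3 = 1.
Proof.
have : size ('X^2 + 'X + 1 : {poly k}) != 1%N.
  rewrite -addrA size_polyDl size_polyXn // -[1]polyC1 size_XaddC //.
move=> /closed_rootP[z]; rewrite /root !hornerD hornerXn hornerX hornerC => /eqP ze.
exists z; last by apply/eqP; rewrite -subr_eq0; apply/eqP; rewrite -[RHS](mulr0 (z - 1)) -ze; ring.
apply/eqP => z1; have := natr_neq0 2; rewrite -ze z1 => /eqP[]; ring.
Qed.

(** On [x_1 = 1] the equation reads [U * x_4 = x_3 ^ 3], where [U] is [- x_0] minus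
    a polynomial in the other coordinates. This is a surface singularity of type
    [A_2] times a line: the quotient of a plane by the cube roots of unity acting by
    [(z, z ^ 2)], with invariants [U = a ^ 3], [x_4 = b ^ 3], [x_3 = a b]. *)
Lemma cuspidal_chart : chart 0 1 0 e2 e3 i1 pi1.
Proof.
split=> //.
- by move=> Y; rewrite cubicE /curve_form /vec5 /= !(mevals Y) ?mevalXU; ring.
- move=> v Fv v1; have [y yE] := @nth_root k 3 (v i4) isT.
  pose vec3 (x y z : k) (i : 'I_3) := match val i with 0 => x | 1 => y | _ => z end.
  have piE x u w : w = v i2 -> x * u = v i3 -> u ^+ 3 = v i4 ->
      - (w ^+ 2 + x ^+ 3 + e2 * x * u ^+ 4 + e3 * u ^+ 6) = v i0 ->
      exists Y, forall i, (pi1 i).@[Y] = v i.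
    move=> w2 xu u3 hE; exists (vec3 x u w).
    by apply: ord5P; rewrite /vec5 /= ?meval1 // !(mevals _).
  move: Fv; rewrite cubicE v1 /curve_form => Fv.
  have [y0|y0] := eqVneq y 0.
    have v4 : v i4 = 0 by rewrite -yE y0 expr0n.
    have v3 : v i3 = 0.
      have : v i3 ^+ 3 = 0 by rewrite -[RHS]Fv v4; ring.
      by move/eqP; rewrite expf_eq0 => /eqP.
    have [x xE] := @nth_root k 3 (- (v i0 + v i2 ^+ 2)) isT.
    by apply: (piE x 0 (v i2)); rewrite ?v3 ?v4 ?xE; ring.
  apply: (piE (v i3 / y) y (v i2)); rewrite ?divfK //.
  apply: (mulIf (expf_neq0 3 y0)); rewrite yE; apply/eqP; rewrite -subr_eq0; apply/eqP.
  by rewrite -[RHS]oppr0 -Fv -yE; field; exact: y0.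
have [z z1 z3] := primitive_cube_root.
have z0 : z != 0 by apply: contra_eq_neq z3 => ->; rewrite expr0n eq_sym oner_neq0.
pose d (i : 'I_3) := match val i with 0 => z | 1 => z ^+ 2 | _ => 1 end.
exists d; split.
- by move=> [[|[|[|//]]] lt]; rewrite /d /= ?oner_neq0 ?expf_neq0.
- move=> Y; apply: ord5P; rewrite /vec5 ?meval1 // !(mevals _) /d /=.
  + set w := Y _; set x := Y _; set y := Y _.
    transitivity (- (w ^+ 2 + z ^+ 3 * x ^+ 3 + (z ^+ 3) ^+ 3 * (e2 * x * y ^+ 4)
                   + (z ^+ 3) ^+ 4 * (e3 * y ^+ 6))); first by ring.
    by rewrite z3 !expr1n !mul1r.
  + by rewrite mul1r.
  + by set x := Y _; set y := Y _; transitivity (z ^+ 3 * (x * y)); [ring | rewrite z3 mul1r].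
  + by set y := Y _; transitivity ((z ^+ 3) ^+ 2 * y ^+ 3); [ring | rewrite z3 expr1n mul1r].
move=> p dp; apply: lift_monomials => m /(diag_support dp).
rewrite mpolyXE_id !big_ord_recr !big_ord0 /= !mul1r /d /= expr1n mulr1 -exprM -exprD.
have -> : widen_ord (leqnSn 2) (widen_ord (leqnSn 1) ord_max) = @Ordinal 3 0 isT by apply: val_inj.
have -> : widen_ord (leqnSn 2) ord_max = @Ordinal 3 1 isT by apply: val_inj.
have -> : ord_max = @Ordinal 3 2 isT by apply: val_inj.
set i := m _; set j := m _; set l := m _ => zij.
(* A monomial is invariant if and only if its exponents satisfy [3 | i + 2 j], and
   then it is a product of powers of [c], of [a b], and of [a ^ 3] or [b ^ 3]. *)
have dvd3 : (3 %| i + 2 * j)%N.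
  rewrite /dvdn; have : z ^+ ((i + 2 * j) %% 3) = 1.
    by move: zij; rewrite {1}(divn_eq (i + 2 * j) 3) exprD mulnC exprM z3 expr1n mul1r.
  have := ltn_mod (i + 2 * j) 3; case: (_ %% 3)%N => [|[|[|//]]] // _; first by rewrite expr1 => /eqP; rewrite (negPf z1).
  by move=> z2; case/eqP: z1; rewrite -z3 exprS z2 mulr1.
have piX : [/\ msub pi1 'X_i0 = h, msub pi1 'X_i2 = c, msub pi1 'X_i3 = a * b
    & msub pi1 'X_i4 = b ^+ 3] by rewrite !msubX.
have [X0 X2 X3 X4] := piX.
pose A3 : {mpoly k[5]} := - ('X_i0 + 'X_i2 ^+ 2 + e2%:MP * 'X_i3 * 'X_i4 + e3%:MP * 'X_i4 ^+ 2).
have A3E : msub pi1 A3 = a ^+ 3.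
  by rewrite rmorphN !rmorphD !(rmorphXn, rmorphM) /= !msubC X0 X2 X3 X4; ring.
have [ji|ij] := leqP j i.
  have [q iE] : exists q, i = (j + 3 * q)%N.
    by exists ((i - j) %/ 3)%N; lia.
  exists ('X_i2 ^+ l * 'X_i3 ^+ j * A3 ^+ q).
  rewrite !(rmorphXn, rmorphM) /= A3E X2 X3 iE exprD exprM [(a * b) ^+ j]exprMn; ring.
have [q jE] : exists q, j = (i + 3 * q)%N.
  by exists ((j - i) %/ 3)%N; lia.
exists ('X_i2 ^+ l * 'X_i3 ^+ i * 'X_i4 ^+ q).
rewrite !(rmorphXn, rmorphM) /= X2 X3 X4 jE exprD exprM [(a * b) ^+ i]exprMn; ring.
Qed.

Lemma cuspidal_units p q m : msub pi1 p * msub pi1 q = h ^+ m ->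
  exists x a, [/\ x != 0, (a <= m)%N & msub pi1 p = x *: h ^+ a].
Proof.
have [_ _ _ [d [d0 pid _]]] := cuspidal_chart.
pose a' : {mpoly k[2]} := 'X_(@Ordinal 2 0 isT); pose b' : {mpoly k[2]} := 'X_(@Ordinal 2 1 isT).
pose D := - (a' ^+ 3 + e2%:MP * a' * b' ^+ 4 + e3%:MP * b' ^+ 6).
apply: (@chart_units k 2 h (- 1) 0 D d 1).
- rewrite rmorphN !rmorphD !(rmorphXn, rmorphM) /= (@muni_maxX k 2 (@Ordinal 3 2 isT)) //.
  rewrite (@muni_widenX k 2 (@Ordinal 3 0 isT) (@Ordinal 2 0 isT)) //.
  rewrite (@muni_widenX k 2 (@Ordinal 3 1 isT) (@Ordinal 2 1 isT)) // !muniC.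
  rewrite scale0r addr0 scaleN1r /D polyCN !polyCD !polyCM -!polyC_exp -/a' -/b'; ring.
- by left; rewrite unitrN unitr1.
(* At [b = 0] the discriminant becomes a cubic monomial in [a]. *)
- move=> t; pose v2 (i : 'I_2) : {poly k} := if val i == 0%N then 'X else 0.
  have ev : mmap polyC v2 (0 ^+ 2 - 4%:R * -1 * D) = (- 4%:R) *: 'X^3.
    have -> : 0 ^+ 2 - 4%:R * -1 * D =
        (- 4%:R)%:MP * (a' ^+ 3 + e2%:MP * a' * b' ^+ 4 + e3%:MP * b' ^+ 6).
      by rewrite mpolyCN mpolyC_nat /D; ring.
    rewrite rmorphM !rmorphD !(rmorphXn, rmorphM) /= /a' /b' !mmapC !mmapX !mmap1U /v2 /=.
    by rewrite -mul_polyC; ring.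
  apply/eqP => e; move: ev; rewrite e rmorphXn /= => /esym/eqP.
  by apply/negP/cubic_monomial_not_square; rewrite oppr_eq0 natr_neq0.
- by move=> Y; have := pid Y i0.
- by rewrite !(mevals _); ring.
- by move=> Y; rewrite mul1r rmorphN rmorph1 /= !mevalN !meval1.
- by left; rewrite unitrN unitr1.
by move=> Y; rewrite !msub_eval; apply: meval_eq => i; rewrite pid.
Qed.

End CuspidalChart.

(** * The chart of the first family *)

Section ToricChart.
Variable k : closedFieldType.
Hypothesis char0 : [pchar k] =i pred0.
Variables e1 e2 e3 : k.

Local Notation a := ('X_(@Ordinal 4 0 isT) : {mpoly k[4]}).
Local Notation b := ('X_(@Ordinal 4 1 isT) : {mpoly k[4]}).
Local Notation c := ('X_(@Ordinal 4 2 isT) : {mpoly k[4]}).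
Local Notation d := ('X_(@Ordinal 4 3 isT) : {mpoly k[4]}).
Local Notation z := (a * c).
Local Notation y5 := (a * b ^+ 2).
Local Notation h := (- (c * d ^+ 2 + z ^+ 2 - (2%:R * e1)%:MP * z * y5 + e2%:MP * (b * d) * y5
                        + (e3 + e1 ^+ 2)%:MP * y5 ^+ 2)).
Local Notation pi1 := (vec5 h 1 (z - e1%:MP * y5) (b * d) y5).

Lemma expr2_inj i j : (2%:R : k) ^+ i = 2%:R ^+ j -> i = j.
Proof.
wlog ij : i j / (i <= j)%N => [H|].
  by have [ij|ji] := leqP i j; [apply: H | move=> /esym /H; move=> /(_ (ltnW ji))].
rewrite -!natrX => /eqP; rewrite eq_sym -subr_eq0 -natrB ?leq_exp2l // ((pcharf0P k).1 char0).
rewrite subn_eq0 leq_exp2l // => ji; apply/eqP; rewrite eqn_leq ij //.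
Qed.

(** On [x_1 = 1] the equation reads [z * x_3 ^ 2 = U * x_4], where [z = x_2 + e1 x_4]
    and [U] is [- x_0] minus a polynomial in the other coordinates. It defines a
    toric variety, the quotient of affine space by the torus acting with weights
    [(2, -1, -2, 1)]: [z = a c], [x_3 = b d], [x_4 = a b ^ 2] and [U = c d ^ 2]. The single
    element 2 of the torus has the same invariants, as its powers are
    distinct. *)
Lemma toric_chart : chart 1 0 e1 e2 e3 i1 pi1.
Proof.
have two0 : (2%:R : k) != 0 := natr_neq0 char0 1.
have four0 : (4%:R : k) != 0 := natr_neq0 char0 3.
split=> //.
- by move=> Y; rewrite cubicE /curve_form /vec5 /= !(mevals Y) /= ?(mevals Y); ring.
- move=> v Fv v1.
  pose Z := v i2 + e1 * v i4.
  pose U := - (v i0 + Z ^+ 2 - 2%:R * e1 * Z * v i4 + e2 * v i3 * v i4 + (e3 + e1 ^+ 2) * v i4 ^+ 2).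
  pose vec4 (x y w t : k) (i : 'I_4) := match val i with 0 => x | 1 => y | 2 => w | _ => t end.
  have piE x y w t : x * w = Z -> y * t = v i3 -> x * y ^+ 2 = v i4 -> w * t ^+ 2 = U ->
      exists Y, forall i, (pi1 i).@[Y] = v i.
    move=> xw yt xy wt; exists (vec4 x y w t).
    have xwE : x * w - e1 * (x * y ^+ 2) = v i2 by rewrite xw xy /Z; ring.
    apply: ord5P; rewrite /vec5 ?meval1 // !(mevals _) //.
    change (- (w * t ^+ 2 + (x * w) ^+ 2 - 2%:R * e1 * (x * w) * (x * y ^+ 2)
               + e2 * (y * t) * (x * y ^+ 2) + (e3 + e1 ^+ 2) * (x * y ^+ 2) ^+ 2) = v i0).
    by rewrite wt xw xy yt /U; ring.
  have ZU : Z * v i3 ^+ 2 = U * v i4.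
    apply/eqP; rewrite -subr_eq0; apply/eqP; rewrite -[RHS]Fv cubicE v1 /curve_form /U /Z; ring.
  have [v4|v4] := eqVneq (v i4) 0; last first.
    apply: (piE (v i4) 1 (Z / v i4) (v i3)); rewrite ?expr1n ?mul1r ?mulr1 //.
      by rewrite mulrC divfK.
    by rewrite mulrAC ZU mulfK.
  have [v3|v3] := eqVneq (v i3) 0.
    have [x xE] := @nth_root k 2 U isT.
    by apply: (piE Z 0 1 x); rewrite ?v3 ?v4 ?xE; ring.
  have Z0 : Z = 0.
    by apply/eqP; move: ZU; rewrite v4 mulr0 => /eqP; rewrite mulf_eq0 expf_eq0 (negPf v3) andbF orbF.
  by apply: (piE 0 (v i3) U 1); rewrite ?Z0 ?v4; ring.
pose dd (i : 'I_4) : k := match val i with 0 => 2%:R ^+ 2 | 1 => 2%:R^-1 | 2 => 2%:R ^- 2 | _ => 2%:R end.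
exists dd; split.
- by move=> [[|[|[|[|//]]]] lt]; rewrite /dd /= ?invr_eq0 ?expf_neq0.
- move=> Y; apply: ord5P; rewrite /vec5 ?meval1 // !(mevals _) /dd /=; field; rewrite ?two0 ?four0 //.
move=> p dp; apply: lift_monomials => m /(diag_support dp).
rewrite mpolyXE_id !big_ord_recr !big_ord0 /= !mul1r /dd /=.
have -> : widen_ord (leqnSn 3) (widen_ord (leqnSn 2) (widen_ord (leqnSn 1) ord_max)) = @Ordinal 4 0 isT by apply: val_inj.
have -> : widen_ord (leqnSn 3) (widen_ord (leqnSn 2) ord_max) = @Ordinal 4 1 isT by apply: val_inj.
have -> : widen_ord (leqnSn 3) ord_max = @Ordinal 4 2 isT by apply: val_inj.
have -> : ord_max = @Ordinal 4 3 isT by apply: val_inj.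
set i := m _; set j := m _; set l := m _; set n := m _ => zij.
(* Weight zero; such monomials are products of [a c], [b d] and of either [c d ^ 2]
   or [a b ^ 2]. *)
have E : (2 * i + n = j + 2 * l)%N.
  apply: expr2_inj; rewrite (exprD _ (2 * i)) (exprD _ j) !exprM.
  move: zij; rewrite !exprVn.
  have : (2%:R : k) ^+ j != 0 by rewrite expf_neq0.
  have : ((2%:R : k) ^+ 2) ^+ l != 0 by rewrite !expf_neq0.
  move: (_ ^+ j) (_ ^+ l) (_ ^+ n) (_ ^+ i) => u w x y w0 u0 e.
  by rewrite -[RHS]mul1r -e; field; rewrite w0 u0.
have [X0 X2 X3 X4] : [/\ msub pi1 'X_i0 = h, msub pi1 'X_i2 = z - e1%:MP * y5,
    msub pi1 'X_i3 = b * d & msub pi1 'X_i4 = y5] by rewrite !msubX.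
pose Z : {mpoly k[5]} := 'X_i2 + e1%:MP * 'X_i4.
have ZE : msub pi1 Z = z.
  by rewrite msubD msubM !msubC X2 X4; ring.
clearbody Z.
pose U : {mpoly k[5]} := - ('X_i0 + Z ^+ 2 - (2%:R * e1)%:MP * Z * 'X_i4
  + e2%:MP * 'X_i3 * 'X_i4 + (e3 + e1 ^+ 2)%:MP * 'X_i4 ^+ 2).
have UE : msub pi1 U = c * d ^+ 2.
  by rewrite !(msubXn, msubN, msubD, msubM) ZE !msubC X0 X3 X4; ring.
clearbody U.
have [jn|nj] := leqP j n.
  have [q [lE nE]] : exists q, l = (i + q)%N /\ n = (j + 2 * q)%N.
    by exists (l - i)%N; lia.
  exists (Z ^+ i * 'X_i3 ^+ j * U ^+ q).
  rewrite !(msubXn, msubM) ZE UE X3 lE nE (exprD _ i q) (exprD _ j (2 * q)) exprM [z ^+ i]exprMn [(b * d) ^+ j]exprMn.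
  by rewrite [(c * _) ^+ q]exprMn; ring.
have [q [iE jE]] : exists q, i = (l + q)%N /\ j = (n + 2 * q)%N.
  by exists (i - l)%N; lia.
exists (Z ^+ l * 'X_i3 ^+ n * 'X_i4 ^+ q).
rewrite !(msubXn, msubM) ZE X3 X4 iE jE (exprD _ l q) (exprD _ n (2 * q)) exprM [z ^+ l]exprMn [(b * d) ^+ n]exprMn.
by rewrite [y5 ^+ q]exprMn; ring.
Qed.

Lemma prime_eltN (R : idomainType) (p : R) : prime_elt p -> prime_elt (- p).
Proof.
have dN (x y : R) : divides (- x) y <-> divides x y.
  by split=> -[w ->]; exists (- w); rewrite ?mulrN ?mulNr // opprK.
move=> [p0 pu pp]; split; rewrite ?oppr_eq0 ?unitrN //.
by move=> x y /dN/pp[]/dN; [left|right].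
Qed.

Lemma toric_units p q m : msub pi1 p * msub pi1 q = h ^+ m ->
  exists x l, [/\ x != 0, (l <= m)%N & msub pi1 p = x *: h ^+ l].
Proof.
have two0 : (2%:R : k) != 0 := natr_neq0 char0 1.
have four0 : (4%:R : k) != 0 := natr_neq0 char0 3.
pose a' : {mpoly k[3]} := 'X_(@Ordinal 3 0 isT); pose b' : {mpoly k[3]} := 'X_(@Ordinal 3 1 isT).
pose c' : {mpoly k[3]} := 'X_(@Ordinal 3 2 isT).
pose B := - (e2%:MP * b' * (a' * b' ^+ 2)).
pose D := - ((a' * c') ^+ 2 - (2%:R * e1)%:MP * (a' * c') * (a' * b' ^+ 2)
  + (e3 + e1 ^+ 2)%:MP * (a' * b' ^+ 2) ^+ 2).
pose dd (i : 'I_4) : k := match val i with 0 => 2%:R ^+ 2 | 1 => 2%:R^-1 | 2 => 2%:R ^- 2 | _ => 2%:R end.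
have pid Y : forall i, (pi1 i).@[fun j => dd j * Y j] = (pi1 i).@[Y].
  apply: ord5P; rewrite /vec5 ?meval1 // !(mevals _) /dd /=; field; rewrite ?two0 ?four0 //.
apply: (@chart_units k 3 h (- c') B D dd (2%:R ^- 2)).
- have muniXn (x : {mpoly k[4]}) e : muni (x ^+ e) = muni x ^+ e by exact: rmorphXn.
  rewrite !(muniXn, muniN, muniD, muniM) (@muni_maxX k 3 (@Ordinal 4 3 isT)) //.
  rewrite (@muni_widenX k 3 (@Ordinal 4 0 isT) (@Ordinal 3 0 isT)) //.
  rewrite (@muni_widenX k 3 (@Ordinal 4 1 isT) (@Ordinal 3 1 isT)) //.
  rewrite (@muni_widenX k 3 (@Ordinal 4 2 isT) (@Ordinal 3 2 isT)) // !muniC.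
  rewrite -/a' -/b' -/c' /B /D -!mul_polyC !(polyC_exp, polyCN, polyCD, polyCM); ring.
- by right; apply: prime_eltN; apply: mpolyX_prime.
(* At [a = 1], [b = 0] the discriminant becomes a cubic monomial in [c]. *)
- move=> t; pose v3 (i : 'I_3) : {poly k} := match val i with 0 => 1 | 1 => 0 | _ => 'X end.
  have ev : mmap polyC v3 (B ^+ 2 - 4%:R * - c' * D) = (- 4%:R) *: 'X^3.
    have -> : B ^+ 2 - 4%:R * - c' * D = (- 4%:R)%:MP * (a' ^+ 2 * c' ^+ 3)
      + b' * ((4%:R)%:MP * c' * ((2%:R * e1)%:MP * (a' * c') * (a' * b')
          - (e3 + e1 ^+ 2)%:MP * (a' * b') ^+ 2 * b') + e2%:MP ^+ 2 * b' ^+ 5 * a' ^+ 2).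
      by rewrite mpolyCN mpolyC_nat /B /D; ring.
    rewrite rmorphD [X in _ + X]rmorphM /= /b' mmapX mmap1U {2}/v3 /= mul0r addr0.
    rewrite !(rmorphXn, rmorphM) /= /a' /c' !mmapC !mmapX !mmap1U /v3 /=.
    by rewrite -mul_polyC; ring.
  apply/eqP => e; move: ev; rewrite e rmorphXn /= => /esym/eqP.
  by apply/negP/cubic_monomial_not_square; rewrite oppr_eq0 natr_neq0.
- by move=> Y; have := pid Y i0.
- by rewrite !(mevals _); ring.
- move=> Y; rewrite rmorphN /= mwidenX mnmwiden1 !(mevals _).
  have -> : widen_ord (leqnSn 3) (@Ordinal 3 2 isT) = @Ordinal 4 2 isT by apply: val_inj.
  by rewrite /dd /= mulrN.
- right=> i l; rewrite -!exprVn -!exprM !exprVn => /(can_inj invrK)/expr2_inj; lia.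
by move=> Y; rewrite !msub_eval; apply: meval_eq => i; rewrite pid.
Qed.

End ToricChart.

(** * From automorphisms to matrices *)

Section Points.
Variable k : closedFieldType.

Definition coords n (p : proj k n) : 'I_n -> k := fun i => hcoord p i 0.
Definition colv n (v : 'I_n -> k) : 'cV[k]_n := \col_i v i.

Lemma colv_eq0 n (v : 'I_n -> k) : nonzero v <-> colv v != 0.
Proof.
split=> [[i vi]|v0]; first by apply: contraNneq vi => /matrixP/(_ i 0); rewrite !mxE => ->.
apply: NNPP => vz; case/eqP: v0; apply/matrixP => i j; rewrite !mxE.
by apply/eqP; apply: contra_notT vz => vi; exists i.
Qed.

Lemma colv_coords n (p : proj k n) : colv (coords p) = hcoord p.
Proof. by apply/matrixP => i j; rewrite mxE ord1. Qed.

Lemma coords_nonzero n (p : proj k n) : nonzero (coords p).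
Proof.
apply/colv_eq0; rewrite colv_coords /hcoord vpick0 -dimv_eq0.
by have := line_dim p => /eqP ->.
Qed.

Lemma line_colv n (p : proj k n) : line p = <[colv (coords p)]>%VS.
Proof.
apply/esym/eqP; rewrite eqEdim -memvE colv_coords memv_pick /= (eqP (line_dim p)).
by rewrite -colv_coords dim_vline (introT idP ((colv_eq0 _).1 (coords_nonzero p))).
Qed.

Lemma vline_proportional n (u v : 'I_n -> k) : nonzero u ->
  <[colv u]>%VS = <[colv v]>%VS <-> proportional u v.
Proof.
move=> unz; split=> [e|[c c0 uv]].
  have : colv u \in <[colv v]>%VS by rewrite -e memv_line.
  move=> /vlineP[c uE]; exists c; last first.
    by move=> i; have /matrixP/(_ i 0) := uE; rewrite !mxE.
  by apply: contraTneq ((colv_eq0 _).1 unz) => c0; rewrite uE c0 scale0r eqxx.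
have uE : colv u = c *: colv v by apply/matrixP => i j; rewrite !mxE uv.
apply/eqP; rewrite eqEsubv -!memvE uE rpredZ ?memv_line //=.
by apply/vlineP; exists c^-1; rewrite scalerA mulVf ?scale1r.
Qed.

Lemma proj_eq n (p q : proj k n) : proportional (coords p) (coords q) -> p = q.
Proof.
move=> pq; apply: val_inj; rewrite /= !line_colv.
exact/(vline_proportional _ (coords_nonzero p)).
Qed.

Lemma line_coords n (p : proj k n) (v : 'I_n -> k) : line p = <[colv v]>%VS ->
  proportional (coords p) v.
Proof.
by move=> e; apply/(vline_proportional _ (coords_nonzero p)); rewrite -line_colv.
Qed.

Lemma exists_proj n (v : 'I_n -> k) : nonzero v -> exists p : proj k n, line p = <[colv v]>%VS.
Proof.
move=> vnz; have d1 : \dim <[colv v]>%VS == 1%N by rewrite dim_vline (introT idP ((colv_eq0 _).1 vnz)).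
by exists (Proj d1).
Qed.

Lemma homog_proportional n (p : {mpoly k[n]}) d u v : p \is d.-homog ->
  proportional u v -> (p.@[u] == 0) = (p.@[v] == 0).
Proof.
by move=> hp [c c0 uv]; rewrite (meval_eq _ uv) (homog_eval _ _ hp) mulf_eq0 expf_eq0 (negPf c0) andbF.
Qed.

Lemma open_form n (W : pred (proj k n)) p : zariski_open W -> W p ->
  exists w d, [/\ w \is d.-homog, w.@[coords p] != 0 &
    forall q, w.@[coords q] != 0 -> W q].
Proof.
move=> [S [hS SE]] Wp; have := SE p; rewrite /= Wp => /esym/allPn[w wS wp].
have [d hw] := hS w wS; exists w, d; split=> // q wq.
apply: contraNT wq => nW; have := SE q; rewrite /= nW => /esym/allP/(_ w wS).
by [].
Qed.

End Points.

Section AbstractMap.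
Variable k : closedFieldType.
Variables s r e1 e2 e3 : k.
Local Notation F := (cubic s r e1 e2 e3).
Local Notation X := {p : proj k 5 | hypersurface F p}.
Local Notation map_on_cone := (map_on_cone s r e1 e2 e3).

Lemma hypersurfaceE p : hypersurface F p = (F.@[coords p] == 0).
Proof. by rewrite /hypersurface /zeros /= andbT. Qed.

Lemma exists_point v : F.@[v] = 0 -> nonzero v ->
  exists x : X, line (val x) = <[colv v]>%VS.
Proof.
move=> Fv /exists_proj[p pE].
have Xp : hypersurface F p.
  rewrite hypersurfaceE (homog_proportional (cubic_homog _ _ _ _ _) (line_coords pE)).
  exact/eqP.
by exists (exist _ p Xp).
Qed.

Lemma point_on_cone (x : X) : F.@[coords (val x)] = 0.
Proof. by apply/eqP; rewrite -hypersurfaceE; exact: (valP x). Qed.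

Definition cone_map (a : X -> X) (v : 'I_5 -> k) : 'I_5 -> k :=
  if insub <[colv v]>%VS is Some p then
    if insub p is Some x then coords (val (a x)) else fun=> 0
  else fun=> 0.

Lemma cone_mapE a v (x : X) : line (val x) = <[colv v]>%VS ->
  cone_map a v = coords (val (a x)).
Proof. by move=> e; rewrite /cone_map -e valK valK. Qed.

Lemma cone_map_coords a (x : X) : cone_map a (coords (val x)) = coords (val (a x)).
Proof. by apply: cone_mapE; exact: line_colv. Qed.

Lemma cone_map_on_cubic a v : F.@[v] = 0 -> nonzero v -> F.@[cone_map a v] = 0.
Proof.
by move=> Fv vnz; have [x xE] := exists_point Fv vnz; rewrite (cone_mapE _ xE) point_on_cone.
Qed.

Lemma cone_map_cancel a b v : cancel a b -> F.@[v] = 0 -> nonzero v ->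
  proportional (cone_map b (cone_map a v)) v.
Proof.
move=> ab Fv vnz; have [x xE] := exists_point Fv vnz.
rewrite (cone_mapE _ xE) cone_map_coords ab; exact: line_coords.
Qed.

Lemma regular_cone_map a : regular (fun x => val (a x)) -> map_on_cone (cone_map a).
Proof.
move=> reg; split.
- move=> v Fv vnz; have [x xE] := exists_point Fv vnz; rewrite (cone_mapE _ xE).
  exact: coords_nonzero.
- move=> u v Fv vnz uv; have [x xE] := exists_point Fv vnz.
  rewrite (cone_mapE _ xE) (@cone_mapE _ u x); first exact: proportional_refl.
  by rewrite xE; apply/esym/vline_proportional => //; apply: proportional_nonzero uv vnz.
move=> v0 Fv0 v0nz; have [x0 x0E] := exists_point Fv0 v0nz.
have [W [d [H [oW Wx0 hH WH]]]] := reg x0.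
have [w [l [hw wx0 wW]]] := open_form oW Wx0.
exists w, l, d, H; split=> //.
  by rewrite -(homog_proportional hw (line_coords x0E)).
move=> v Fv vnz wv; have [x xE] := exists_point Fv vnz; have vx := line_coords xE.
have Wx : W (val x) by apply: wW; rewrite (homog_proportional hw vx).
have := WH x Wx => /line_coords ax.
rewrite (cone_mapE _ xE); apply: proportional_sym.
apply: proportional_trans ax _; have [c c0 cE] := vx.
exists (c ^+ d); rewrite ?expf_neq0 // => i.
by rewrite -(homog_eval _ _ (hH i)) /eval_at; apply: meval_eq.
Qed.

Lemma automorphism_matrix (charts : forall f, map_on_cone f ->
    exists C d, global_rep s r e1 e2 e3 C d f) (sr : (s != 0) || (r != 0))
    (a : X -> X) : is_automorphism a ->
  exists M : 'M[k]_5, [/\ M \in unitmx,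
    forall x, proportional (mulv M (coords (val x))) (coords (val (a x)))
    & exists c, forall v, F.@[mulv M v] = c * F.@[v]].
Proof.
move=> [ra [b [ab ba rb]]].
have ma := regular_cone_map ra; have mb := regular_cone_map rb.
have [M [uM Ma FM]] := linear_automorphism sr ma mb
  (@cone_map_on_cubic a) (fun v Fv vnz => @cone_map_cancel a b v ab Fv vnz)
  (charts _ ma) (charts _ mb).
exists M; split=> // x; rewrite -cone_map_coords; apply: Ma.
  exact: point_on_cone.
exact: coords_nonzero.
Qed.

End AbstractMap.

Section GlobalRepresentatives.
Variable k : closedFieldType.
Hypothesis char0 : [pchar k] =i pred0.

Lemma toric_global_rep e1 e2 e3 f : map_on_cone 1 0 e1 e2 e3 f ->
  exists (C : 'I_5 -> {mpoly k[5]}) d, global_rep 1 0 e1 e2 e3 C d f.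
Proof.
have sr : ((1 : k) != 0) || ((0 : k) != 0) by rewrite oner_neq0.
have ch1 := toric_chart char0 e1 e2 e3.
move=> mf; apply: (global_repP mf).
by apply: (global_forms sr (chart_swap ch1) ch1) => // P Q m; apply: toric_units.
Qed.

Lemma cuspidal_global_rep e2 e3 f : map_on_cone 0 1 0 e2 e3 f ->
  exists (C : 'I_5 -> {mpoly k[5]}) d, global_rep 0 1 0 e2 e3 C d f.
Proof.
have sr : ((0 : k) != 0) || ((1 : k) != 0) by rewrite oner_neq0 orbT.
have ch1 := cuspidal_chart char0 e2 e3.
move=> mf; apply: (global_repP mf).
by apply: (global_forms sr (chart_swap ch1) ch1) => // P Q m; apply: cuspidal_units.
Qed.

End GlobalRepresentatives.

(** * The shape of linear symmetries *)

Section LinearSymmetries.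
Variable k : closedFieldType.
Hypothesis char0 : [pchar k] =i pred0.
Variables s r e1 e2 e3 : k.
Hypothesis sr : (s == 1) && (r == 0) || [&& s == 0, r == 1 & e1 == 0].
Local Notation F := (cubic s r e1 e2 e3).

Definition bvec (j : 'I_5) : 'I_5 -> k := fun i => (i == j)%:R.

Lemma mulvE (M : 'M[k]_5) v i :
  mulv M v i = M i i0 * v i0 + M i i1 * v i1 + M i i2 * v i2 + M i i3 * v i3 + M i i4 * v i4.
Proof.
rewrite /mulv !big_ord_recr big_ord0 /= add0r.
by do !congr (_ + _); congr (M i _ * v _); apply: val_inj.
Qed.

Lemma cubic_coefs (A B C D : k) :
  (forall t, A + B * t + C * t ^+ 2 + D * t ^+ 3 = 0) -> [/\ A = 0, B = 0, C = 0 & D = 0].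
Proof.
move=> H; have : A%:P + B *: 'X + C *: 'X^2 + D *: 'X^3 = 0.
  by apply: poly_vanish => t; rewrite !hornerD !hornerZ !hornerXn hornerX hornerC H.
move=> e; have cE i := congr1 (fun p : {poly k} => p`_i) e.
by split; [have := cE 0|have := cE 1|have := cE 2|have := cE 3];
  rewrite !coefD !coefZ !coefXn coefX coefC coef0 /= ?mulr0 ?mulr1 ?addr0 ?add0r.
Qed.

Lemma two_neq0 : (2%:R : k) != 0.
Proof. exact: (natr_neq0 char0 1). Qed.

Section PlaneStability.
Variables (M : 'M[k]_5) (c : k).
Hypotheses (uM : M \in unitmx) (FM : forall v, F.@[mulv M v] = c * F.@[v]).

Lemma mulv_inj0 v : mulv M v =1 (fun=> 0) -> v =1 (fun=> 0).
Proof.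
move=> Mv i; rewrite -(mulv1 v i) -(mulVmx uM) mulv_mul.
by rewrite (eq_mulv _ Mv) /mulv big1 // => j _; rewrite mulr0.
Qed.

(** The symmetry maps the singular conic, parametrized by
    [(a ^ 2, - b ^ 2, a b, 0, 0)], to points [u] where all partial derivatives of [F]
    vanish. These are read off as the linear terms of [F(u + t w)]. *)
Lemma singular_equations a b : let u := mulv M (vec5 (a ^+ 2) (- b ^+ 2) (a * b) 0 0) in
  [/\ u i1 * u i4 = 0, u i0 * u i4 = 0, 2%:R * u i2 * u i4 + s * u i3 ^+ 2 = 0,
      2%:R * s * u i2 * u i3 + 3%:R * r * u i3 ^+ 2 + 2%:R * e1 * u i3 * u i4 + e2 * u i4 ^+ 2 = 0
    & u i0 * u i1 + u i2 ^+ 2 + e1 * u i3 ^+ 2 + 2%:R * e2 * u i3 * u i4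
      + 3%:R * e3 * u i4 ^+ 2 = 0].
Proof.
move=> u; pose v := vec5 (a ^+ 2) (- b ^+ 2) (a * b) 0 0.
have along w : forall t, F.@[fun i => u i + t * w i] =
    c * F.@[fun i => v i + t * mulv (invmx M) w i].
  move=> t; rewrite -FM; apply: meval_eq => i.
  have wE : w i = mulv M (mulv (invmx M) w) i by rewrite -mulv_mul mulmxV // mulv1.
  by rewrite wE -mulv_scale /u /mulv -big_split /=; apply: eq_bigr => j _; rewrite mulrDr.
have deriv w : exists C D, forall t, F.@[fun i => u i + t * w i] = C * t ^+ 2 + D * t ^+ 3.
  pose x := mulv (invmx M) w.
  exists (c * ((a ^+ 2 * x i1 - b ^+ 2 * x i0 + 2%:R * a * b * x i2) * x i4
    + s * a * b * x i3 ^+ 2)), (c * F.@[x]).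
  by move=> t; rewrite along !cubicE /curve_form -/x /v /vec5 /=; ring.
have part j A B C D : (forall t, F.@[fun i => u i + t * bvec j i] = A + B * t + C * t ^+ 2 + D * t ^+ 3) ->
    B = 0.
  move=> E; have [C' [D' E']] := deriv (bvec j).
  have [|_ -> //] := @cubic_coefs A B (C - C') (D - D').
  by move=> t; rewrite -(subrr (F.@[fun i => u i + t * bvec j i])) [X in _ = X - _]E E'; ring.
split.
- by apply: (part i0 F.@[u] _ 0 0) => t; rewrite !cubicE /curve_form /bvec /=; ring.
- by apply: (part i1 F.@[u] _ 0 0) => t; rewrite !cubicE /curve_form /bvec /=; ring.
- by apply: (part i2 F.@[u] _ (u i4) 0) => t; rewrite !cubicE /curve_form /bvec /=; ring.
- by apply: (part i3 F.@[u] _ (s * u i2 + 3%:R * r * u i3 + e1 * u i4) r) => t;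
    rewrite !cubicE /curve_form /bvec /=; ring.
- by apply: (part i4 F.@[u] _ (e2 * u i3 + 3%:R * e3 * u i4) e3) => t;
    rewrite !cubicE /curve_form /bvec /=; ring.
Qed.

Lemma binary_form_root (x y z : k) : exists a b, ((a != 0) || (b != 0)) /\
  x * a ^+ 2 - y * b ^+ 2 + z * (a * b) = 0.
Proof.
have [->|x0] := eqVneq x 0.
  by exists 1, 0; rewrite oner_neq0; split=> //; ring.
have : size (x *: 'X^2 + z *: 'X - y%:P) != 1%N.
  rewrite -addrA size_polyDl size_scale // size_polyXn //.
  apply: leq_ltn_trans (size_polyD _ _) _; rewrite gtn_max size_polyN.
  rewrite (leq_ltn_trans (size_scale_leq _ _)) ?size_polyX //=.
  exact: leq_ltn_trans (size_polyC_leq1 _) _.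
move=> /closed_rootP[a]; rewrite /root !hornerD hornerN !hornerZ hornerXn hornerX hornerC => /eqP e.
by exists a, 1; rewrite oner_neq0 orbT; split=> //; rewrite -[RHS]e; ring.
Qed.

(** The plane [x_3 = x_4 = 0] is stable: it is spanned by the singular conic. If the
    image [u] of the conic did not lie in [x_4 = 0], then the equations
    [u_0 u_4 = u_1 u_4 = 0] would give [u_0 = u_1 = 0] along the whole conic. At a
    point of the conic with [u_4 = 0] the remaining equations yield [u = 0],
    against invertibility. *)
Lemma plane_rows j : j \in [:: i0; i1; i2] -> M i3 j = 0 /\ M i4 j = 0.
Proof.
pose vv a b : 'I_5 -> k := vec5 (a ^+ 2) (- b ^+ 2) (a * b) 0 0.
pose u a b i := mulv M (vv a b) i.
have uE a b i : u a b i = M i i0 * a ^+ 2 - M i i1 * b ^+ 2 + M i i2 * (a * b).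
  by rewrite /u mulvE /vv /vec5 /=; ring.
have u3 a b : u a b i4 = 0 -> u a b i3 = 0.
  move=> u4; have [_ _] := singular_equations a b; rewrite -/(vv a b) -!/(u a b _) u4.
  case/orP: sr => [/andP[/eqP -> /eqP ->]|/and3P[/eqP -> /eqP -> _]].
    by rewrite mulr0 add0r mul1r => /eqP; rewrite expf_eq0 => /eqP.
  rewrite !(mulr0, mul0r, expr0n, addr0, add0r, mulr1) => _ /eqP.
  by rewrite mulf_eq0 expf_eq0 (negPf (natr_neq0 char0 2)) => /eqP.
have u40 a b : u a b i4 = 0.
  apply: NNPP => /eqP nz.
  pose X0 : {mpoly k[2]} := 'X_(@Ordinal 2 0 isT); pose X1 : {mpoly k[2]} := 'X_(@Ordinal 2 1 isT).
  pose U i := M i i0 *: X0 ^+ 2 - M i i1 *: X1 ^+ 2 + M i i2 *: (X0 * X1).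
  have UE i v : (U i).@[v] = u (v (@Ordinal 2 0 isT)) (v (@Ordinal 2 1 isT)) i.
    by rewrite uE !(mevals v).
  have U4 : U i4 != 0.
    pose w (i : 'I_2) := if val i == 0%N then a else b.
    by apply: contraNneq nz => z; have := UE i4 w; rewrite z meval0 => ->.
  have U0 i : i \in [:: i0; i1] -> forall a b, u a b i = 0.
    move=> ii a' b'; pose w (i : 'I_2) := if val i == 0%N then a' else b'.
    have : U i = 0; last by move=> z; rewrite -[LHS](UE i w) z meval0.
    apply: (mpoly_vanish_generic U4) => v; rewrite !UE => u4.
    have [eq1 eq0 _ _ _] := singular_equations (v (@Ordinal 2 0 isT)) (v (@Ordinal 2 1 isT)).
    by move: ii; rewrite !inE => /orP[]/eqP ->; apply: (mulIf u4); rewrite mul0r.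
  have [a' [b' [ab0 root]]] := binary_form_root (M i4 i0) (M i4 i1) (M i4 i2).
  have u4' : u a' b' i4 = 0 by rewrite uE.
  have [_ _ _ _] := singular_equations a' b'; rewrite -/(vv a' b') -!/(u a' b' _).
  rewrite u4' (u3 _ _ u4') (U0 i0 isT) (U0 i1 isT) !(mulr0, mul0r, expr0n, addr0, add0r) => /eqP.
  rewrite expf_eq0 => /eqP u2.
  have v0 : vv a' b' =1 (fun=> 0).
    by apply: mulv_inj0; apply: ord5P; rewrite -/(u a' b' _) ?u4' ?(u3 _ _ u4') ?(U0 i0 isT) ?(U0 i1 isT).
  move: ab0; have := v0 i0; have := v0 i1; rewrite /vv /vec5 /=.
  move=> /eqP; rewrite oppr_eq0 expf_eq0 /= => -> /eqP; rewrite expf_eq0 /= => -> //.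
have rows i : (forall a b, u a b i = 0) -> [/\ M i i0 = 0, M i i1 = 0 & M i i2 = 0].
  move=> ui; have m0 : M i i0 = 0 by rewrite -(ui 1 0) uE; ring.
  have m1 : M i i1 = 0 by apply/eqP; rewrite -oppr_eq0 -(ui 0 1) uE; apply/eqP; ring.
  by split=> //; rewrite -(ui 1 1) uE m0 m1; ring.
have [m0 m1 m2] := rows i4 u40; have [n0 n1 n2] := rows i3 (fun a b => u3 a b (u40 a b)).
by rewrite !inE => /or3P[] /eqP ->.
Qed.

Lemma plane_stable v : v i3 = 0 -> v i4 = 0 -> mulv M v i3 = 0 /\ mulv M v i4 = 0.
Proof.
move=> v3 v4; have [a0 b0] := @plane_rows i0 isT; have [a1 b1] := @plane_rows i1 isT.
have [a2 b2] := @plane_rows i2 isT.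
by rewrite !mulvE v3 v4 a0 a1 a2 b0 b1 b2 !(mulr0, mul0r, addr0).
Qed.

End PlaneStability.

Section MatrixShape.
Variables (M : 'M[k]_5) (c : k).
Hypotheses (uM : M \in unitmx) (FM : forall v, F.@[mulv M v] = c * F.@[v]).

Lemma sr_neq0 : (s != 0) || (r != 0).
Proof.
by case/orP: sr => [/andP[/eqP -> _]|/and3P[_ /eqP -> _]]; rewrite oner_neq0 ?orbT.
Qed.

Lemma scaling_neq0 : c != 0.
Proof.
have := cubic_nonzero_point e1 e2 e3 sr_neq0; set v := vec5 _ _ _ _ _.
have vE : v =1 mulv M (mulv (invmx M) v) by move=> i; rewrite -mulv_mul mulmxV // mulv1.
by rewrite (meval_eq _ vE) FM; apply: contraNneq => ->; rewrite mul0r.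
Qed.

Lemma inverse_stable v : v i3 = 0 -> v i4 = 0 ->
  mulv (invmx M) v i3 = 0 /\ mulv (invmx M) v i4 = 0.
Proof.
apply: (@plane_stable _ c^-1); rewrite ?unitmx_inv // => u.
apply: (mulfI scaling_neq0); rewrite -FM mulrA mulfV ?scaling_neq0 // mul1r.
by apply: meval_eq => i; rewrite -mulv_mul mulmxV // mulv1.
Qed.

Definition plane_pt (x y z : k) : 'I_5 -> k := vec5 x y z 0 0.

Lemma plane_preimage (y0 y1 y2 : k) : exists x0 x1 x2,
  mulv M (plane_pt x0 x1 x2) =1 plane_pt y0 y1 y2.
Proof.
pose y := plane_pt y0 y1 y2; pose x := mulv (invmx M) y.
have [x3 x4] : x i3 = 0 /\ x i4 = 0 by apply: inverse_stable.
exists (x i0), (x i1), (x i2) => i.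
rewrite -[RHS](mulv1 _ i) -(mulmxV uM) mulv_mul; apply: eq_mulv.
by apply: ord5P; rewrite /plane_pt /vec5 /= -/x.
Qed.

(** The hyperplane [x_4 = 0] is the only one that contains the plane [x_3 = x_4 = 0]
    and meets [X] there with multiplicity at least two along the plane. *)
Lemma hyperplane_row : M i4 i3 = 0.
Proof.
have [x0 [x1 [x2 xE]]] := plane_preimage 0 0 1.
pose u := mulv M (plane_pt x0 x1 x2); pose w := mulv M (bvec i3).
have uE t i : mulv M (vec5 x0 x1 x2 t 0) i = u i + t * w i.
  by rewrite /u /w !mulvE /plane_pt /vec5 /bvec /=; ring.
have wE : w i4 = M i4 i3 by rewrite /w mulvE /bvec /=; ring.
have [|_ w4 _ _] := @cubic_coefs 0 (w i4)
   (2%:R * w i2 * w i4 + s * w i3 ^+ 2 - c * s * x2)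
   (w i0 * w i1 * w i4 + w i2 ^+ 2 * w i4 + s * w i2 * w i3 ^+ 2 + r * w i3 ^+ 3
     + e1 * w i3 ^+ 2 * w i4 + e2 * w i3 * w i4 ^+ 2 + e3 * w i4 ^+ 3 - c * r); last by rewrite -wE.
move=> t; have := FM (vec5 x0 x1 x2 t 0); rewrite (meval_eq _ (uE t)) !cubicE /curve_form.
rewrite /u !xE /plane_pt /vec5 /= => e.
by move/eqP: e; rewrite -subr_eq0 => /eqP e; rewrite -[RHS]e; ring.
Qed.

Lemma hyperplane_coef : M i4 i4 != 0.
Proof.
pose v := mulv (invmx M) (bvec i4).
have : mulv M v i4 = 1 by rewrite -mulv_mul mulmxV // mulv1 /bvec eqxx.
have [_ a0] := plane_rows uM FM (j := i0) isT; have [_ a1] := plane_rows uM FM (j := i1) isT.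
have [_ a2] := plane_rows uM FM (j := i2) isT.
rewrite mulvE a0 a1 a2 hyperplane_row !mul0r !add0r; apply: contra_eq_neq => ->.
by rewrite mul0r eq_sym oner_neq0.
Qed.

Hypothesis M44 : M i4 i4 = 1.

Lemma hyperplane_coord v : mulv M v i4 = v i4.
Proof.
have [_ a0] := plane_rows uM FM (j := i0) isT; have [_ a1] := plane_rows uM FM (j := i1) isT.
have [_ a2] := plane_rows uM FM (j := i2) isT.
by rewrite mulvE a0 a1 a2 hyperplane_row M44 !mul0r !add0r mul1r.
Qed.

Lemma coord3 v : mulv M v i3 = M i3 i3 * v i3 + M i3 i4 * v i4.
Proof.
have [a0 _] := plane_rows uM FM (j := i0) isT; have [a1 _] := plane_rows uM FM (j := i1) isT.
have [a2 _] := plane_rows uM FM (j := i2) isT.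
by rewrite mulvE a0 a1 a2 !mul0r !add0r.
Qed.

Lemma diag3_neq0 : M i3 i3 != 0.
Proof.
pose v := mulv (invmx M) (bvec i3).
have vE i : mulv M v i = bvec i3 i by rewrite -mulv_mul mulmxV // mulv1.
have := vE i3; rewrite coord3 -[v i4]hyperplane_coord vE /bvec /= mulr0 addr0.
by apply: contra_eq_neq => ->; rewrite mul0r eq_sym oner_neq0.
Qed.

Local Notation w i := (M i i3).
Local Notation z i := (M i i4).

(** The coefficients of [t] and [l] in the identity [F(M v) = c F(v)] at
    [v = (x_0, x_1, x_2, l t, t)]. *)
Lemma symmetry_expansion x0 x1 x2 : let y := mulv M (plane_pt x0 x1 x2) in
  [/\ y i0 * y i1 + y i2 ^+ 2 = c * (x0 * x1 + x2 ^+ 2),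
     y i0 * z i1 + y i1 * z i0 + 2%:R * y i2 * z i2 + s * z i3 ^+ 2 * y i2 = 0,
     y i0 * w i1 + y i1 * w i0 + 2%:R * y i2 * w i2 + 2%:R * s * w i3 * z i3 * y i2 = 0
   & s * (w i3 ^+ 2 * y i2 - c * x2) = 0] /\
  [/\ s * w i2 * w i3 ^+ 2 + r * w i3 ^+ 3 = c * r,
      w i0 * w i1 + w i2 ^+ 2 + 2%:R * s * w i2 * w i3 * z i3 + s * z i2 * w i3 ^+ 2
        + 3%:R * r * w i3 ^+ 2 * z i3 + e1 * w i3 ^+ 2 = c * e1,
      w i0 * z i1 + w i1 * z i0 + 2%:R * w i2 * z i2 + s * w i2 * z i3 ^+ 2
        + 2%:R * s * z i2 * w i3 * z i3 + 3%:R * r * w i3 * z i3 ^+ 2 + 2%:R * e1 * w i3 * z i3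
        + e2 * w i3 = c * e2
    & z i0 * z i1 + z i2 ^+ 2 + s * z i2 * z i3 ^+ 2 + r * z i3 ^+ 3 + e1 * z i3 ^+ 2
        + e2 * z i3 + e3 = c * e3].
Proof.
move=> y; have [y3 y4] : y i3 = 0 /\ y i4 = 0 by apply: (plane_stable uM FM).
pose q2 l := y i0 * (l * w i1 + z i1) + y i1 * (l * w i0 + z i0) + 2%:R * y i2 * (l * w i2 + z i2)
  + s * y i2 * (l * w i3 + z i3) ^+ 2 - c * s * x2 * l ^+ 2.
pose q3 l := (l * w i0 + z i0) * (l * w i1 + z i1) + (l * w i2 + z i2) ^+ 2
  + s * (l * w i2 + z i2) * (l * w i3 + z i3) ^+ 2 + r * (l * w i3 + z i3) ^+ 3
  + e1 * (l * w i3 + z i3) ^+ 2 + e2 * (l * w i3 + z i3) + e3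
  - c * (r * l ^+ 3 + e1 * l ^+ 2 + e2 * l + e3).
have key l : [/\ y i0 * y i1 + y i2 ^+ 2 - c * (x0 * x1 + x2 ^+ 2) = 0, q2 l = 0 & q3 l = 0].
  have [|_ ? ? ?] := @cubic_coefs 0 (y i0 * y i1 + y i2 ^+ 2 - c * (x0 * x1 + x2 ^+ 2)) (q2 l) (q3 l); last by [].
  move=> t; have := FM (vec5 x0 x1 x2 (l * t) t).
  have uE i : mulv M (vec5 x0 x1 x2 (l * t) t) i = y i + t * (l * w i + z i).
    by rewrite /y !mulvE /plane_pt /vec5 /=; ring.
  rewrite !cubicE hyperplane_coord !uE y3 /curve_form /vec5 /= => /eqP; rewrite -subr_eq0 => /eqP e.
  by rewrite -[RHS]e /q2 /q3; ring.
have [|L0 L1 L2 _] := @cubic_coefs (y i0 * z i1 + y i1 * z i0 + 2%:R * y i2 * z i2 + s * z i3 ^+ 2 * y i2)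
    (y i0 * w i1 + y i1 * w i0 + 2%:R * y i2 * w i2 + 2%:R * s * w i3 * z i3 * y i2)
    (s * (w i3 ^+ 2 * y i2 - c * x2)) 0.
  by move=> l; have [_ e _] := key l; rewrite -[RHS]e /q2; ring.
have sub0 (u v : k) : u - v = 0 -> u = v by move/eqP; rewrite subr_eq0 => /eqP.
split; first by have [/sub0] := key 0.
have [|K0 K1 K2 K3] := @cubic_coefs
   (z i0 * z i1 + z i2 ^+ 2 + s * z i2 * z i3 ^+ 2 + r * z i3 ^+ 3 + e1 * z i3 ^+ 2
        + e2 * z i3 + e3 - c * e3)
   (w i0 * z i1 + w i1 * z i0 + 2%:R * w i2 * z i2 + s * w i2 * z i3 ^+ 2
        + 2%:R * s * z i2 * w i3 * z i3 + 3%:R * r * w i3 * z i3 ^+ 2 + 2%:R * e1 * w i3 * z i3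
        + e2 * w i3 - c * e2)
   (w i0 * w i1 + w i2 ^+ 2 + 2%:R * s * w i2 * w i3 * z i3 + s * z i2 * w i3 ^+ 2
        + 3%:R * r * w i3 ^+ 2 * z i3 + e1 * w i3 ^+ 2 - c * e1)
   (s * w i2 * w i3 ^+ 2 + r * w i3 ^+ 3 - c * r).
  by move=> l; have [_ _ e] := key l; rewrite -[RHS]e /q3; ring.
by split; apply: sub0.
Qed.

Lemma symmetry_columns :
  [/\ forall i, i != i3 -> w i = 0, forall i, i != i4 -> z i = 0,
     r = 0 \/ c = w i3 ^+ 3, e2 * w i3 = c * e2 & e3 = c * e3].
Proof.
have a0 := diag3_neq0.
have w4 := hyperplane_row.
have ex (y0 y1 y2 : k) :
   y0 * z i1 + y1 * z i0 + 2%:R * y2 * z i2 + s * z i3 ^+ 2 * y2 = 0 /\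
   y0 * w i1 + y1 * w i0 + 2%:R * y2 * w i2 + 2%:R * s * w i3 * z i3 * y2 = 0.
  have [x0 [x1 [x2 xE]]] := plane_preimage y0 y1 y2.
  by have [[_ L0 L1 _] _] := symmetry_expansion x0 x1 x2; move: L0 L1; rewrite !xE.
have [z1 w1] : z i1 = 0 /\ w i1 = 0.
  by have [ez ew] := ex 1 0 0; split; [rewrite -[RHS]ez|rewrite -[RHS]ew]; ring.
have [z0 w0] : z i0 = 0 /\ w i0 = 0.
  by have [ez ew] := ex 0 1 0; split; [rewrite -[RHS]ez|rewrite -[RHS]ew]; ring.
have [z2 w2] : 2%:R * z i2 + s * z i3 ^+ 2 = 0 /\ w i2 + s * w i3 * z i3 = 0.
  have [ez ew] := ex 0 0 1; split; first by rewrite -[RHS]ez; ring.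
  by apply: (mulfI two_neq0); rewrite mulr0 -[RHS]ew; ring.
have [_ [K3 K2 K1 K0]] := symmetry_expansion 0 0 0.
have [w2' z3] : w i2 = 0 /\ z i3 = 0.
  case/orP: sr => [/andP[/eqP s1 /eqP r0]|/and3P[/eqP s0 /eqP r1 /eqP e10]].
    have w20 : w i2 = 0.
      move: K3 => /eqP; rewrite s1 r0 mul1r mul0r mulr0 addr0 mulf_eq0 expf_eq0 (negPf a0) orbF.
      by move/eqP.
    split=> //; move: w2 => /eqP; rewrite s1 w20 add0r mul1r mulf_eq0 (negPf a0).
    by move/eqP.
  have w20 : w i2 = 0 by rewrite -[RHS]w2 s0; ring.
  split=> //; move: K2 => /eqP; rewrite s0 r1 e10 w20 w0 !(mul0r, mulr0, expr0n, add0r, addr0, mulr1).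
  by rewrite !mulf_eq0 (negPf a0) (negPf (natr_neq0 char0 2)) => /eqP.
have z2' : z i2 = 0.
  by apply: (mulfI two_neq0); rewrite mulr0 -[RHS]z2 z3; ring.
split.
- by apply: ord5P; rewrite ?w4.
- by apply: ord5P.
- case/orP: sr => [/andP[_ /eqP ->]|/and3P[_ /eqP r1 _]]; first by left.
  by right; rewrite -[c]mulr1 -r1 -K3 w2' r1; ring.
- by rewrite -K1 w0 w2' z2' z3 z0; ring.
- by rewrite -K0 z0 z2' z3; ring.
Qed.

Lemma symmetry_quadric x0 x1 x2 : let y := mulv M (plane_pt x0 x1 x2) in
  y i0 * y i1 + y i2 ^+ 2 = c * (x0 * x1 + x2 ^+ 2).
Proof. by have [[]] := symmetry_expansion x0 x1 x2. Qed.

(** In the first family [s x_3 ^ 2 x_2] is the part of [F] of degree two in [x_3]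
    on the hyperplane [x_4 = 0], so the linear form [x_2] is preserved up to a scalar on the
    plane, and so is its orthogonal for the quadratic form [x_0 x_1 + x_2 ^ 2]. *)
Lemma symmetry_row2 : s = 1 -> [/\ M i2 i0 = 0, M i2 i1 = 0, M i0 i2 = 0 & M i1 i2 = 0].
Proof.
move=> s1; have a0 := diag3_neq0.
have L2 x0 x1 x2 : w i3 ^+ 2 * mulv M (plane_pt x0 x1 x2) i2 = c * x2.
  have [[_ _ _ +] _] := symmetry_expansion x0 x1 x2.
  by rewrite s1 mul1r => /eqP; rewrite subr_eq0 => /eqP.
have m2 x0 x1 x2 : mulv M (plane_pt x0 x1 x2) i2 = M i2 i0 * x0 + M i2 i1 * x1 + M i2 i2 * x2.
  by rewrite mulvE /plane_pt /vec5 /= !mulr0 !addr0.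
have m20 : M i2 i0 = 0.
  by apply: (mulfI (expf_neq0 2 a0)); have := L2 1 0 0; rewrite m2 => e; rewrite mulr0 -[RHS](mulr0 c) -e; ring.
have m21 : M i2 i1 = 0.
  by apply: (mulfI (expf_neq0 2 a0)); have := L2 0 1 0; rewrite m2 => e; rewrite mulr0 -[RHS](mulr0 c) -e; ring.
have dual (y0 y1 : k) : M i0 i2 * y1 + M i1 i2 * y0 = 0.
  have [x0 [x1 [x2 xE]]] := plane_preimage y0 y1 0.
  have x20 : x2 = 0.
    by apply: (mulfI scaling_neq0); rewrite mulr0 -(L2 x0 x1) xE /plane_pt /vec5 /= mulr0.
  have y0E : M i0 i0 * x0 + M i0 i1 * x1 = y0.
    by have := xE i0; rewrite mulvE /plane_pt /vec5 /= x20 !mulr0 !addr0.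
  have y1E : M i1 i0 * x0 + M i1 i1 * x1 = y1.
    by have := xE i1; rewrite mulvE /plane_pt /vec5 /= x20 !mulr0 !addr0.
  have [|_ e _ _] := @cubic_coefs 0 (M i0 i2 * y1 + M i1 i2 * y0)
      (M i0 i2 * M i1 i2 + M i2 i2 ^+ 2 - c) 0; last by [].
  move=> t; have /= := symmetry_quadric x0 x1 t; have /= := symmetry_quadric x0 x1 0.
  rewrite !mulvE /plane_pt /vec5 /= m20 m21 -y0E -y1E => e0 /eqP; rewrite -subr_eq0 => /eqP e1'.
  move/eqP: e0; rewrite -subr_eq0 => /eqP e0.
  have e := etrans (congr2 (fun u v => u - v) e1' e0) (subrr 0).
  by rewrite -[RHS]e; ring.
have d1 : M i1 i2 = 0 by rewrite -[RHS](dual 1 0); ring.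
have d0 : M i0 i2 = 0 by rewrite -[RHS](dual 0 1); ring.
by [].
Qed.

End MatrixShape.
End LinearSymmetries.

(** * A criterion for unirationality *)

Section Criterion.
Variable k : closedFieldType.
Variables s r e1 e2 e3 : k.
Local Notation F := (cubic s r e1 e2 e3).
Local Notation X := {p : proj k 5 | hypersurface F p}.
Variables (n : nat) (pi0 : 'I_5 -> {mpoly k[n]}).
Hypothesis ch0 : chart s r e1 e2 e3 i0 pi0.
Variables (gT : finGroupType) (a : gT -> X -> X) (M : gT -> 'M[k]_5).
Hypothesis Ma : forall g x, proportional (mulv (M g) (coords (val x))) (coords (val (a g x))).
Variables (N : nat) (rG : mx_representation k [set: gT] N).
Variables (Phi : 'I_5 -> {mpoly k[N]}) (D : nat) (w : {mpoly k[N]}) (E : nat).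
Hypotheses (hPhi : forall i, Phi i \is D.-homog) (hw : w \is E.-homog).
Local Notation ev y := (fun i => (Phi i).@[y]).
Hypothesis Phi_nonzero : forall y, w.@[y] != 0 -> nonzero (ev y).
Hypothesis Phi_on : forall y, w.@[y] != 0 -> F.@[ev y] = 0.
Hypothesis Phi_equivariant : forall g y,
  exists2 c, c != 0 & forall i, (Phi i).@[mulv (rG g) y] = c * mulv (M g) (ev y) i.
Variables (m : {mpoly k[5]}) (l : nat) (v0 : 'I_5 -> k).
Hypotheses (hm : m \is l.-homog) (Fv0 : F.@[v0] = 0) (mv0 : m.@[v0] != 0).
Hypothesis Phi_dominant : forall x, F.@[x] = 0 -> m.@[x] != 0 ->
  exists y, [/\ nonzero y, w.@[y] != 0 & proportional (ev y) x].

Lemma ev_proportional y z : proportional y z -> proportional (ev y) (ev z).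
Proof.
move=> [c c0 yz]; exists (c ^+ D); first by rewrite expf_neq0.
by move=> i; rewrite (meval_eq _ yz) (homog_eval _ _ (hPhi i)).
Qed.

Lemma proj_repr_coords g (p : proj k N) :
  proportional (coords (proj_repr rG g p)) (mulv (rG g) (coords p)).
Proof.
apply: line_coords; rewrite /proj_repr /= line_colv limg_line lfunE /=; congr <[_]>%VS.
by apply/matrixP => i j; rewrite !mxE; apply: eq_bigr => t _; rewrite mxE.
Qed.

(** Forms [Phi] on a representation give the rational map, regular on [w <> 0]. A
    closed set containing its image contains the points with [m <> 0], and these
    are dense because the cone is irreducible. *)
Lemma unirational_criterion : G_unirational a.
Proof.
pose U : pred (proj k N) := fun p => w.@[coords p] != 0.
have ex (p : {p : proj k N | U p}) :
    exists x : X, line (val x) == <[colv (ev (coords (val p)))]>%VS.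
  have Up : w.@[coords (val p)] != 0 := valP p.
  by have [x xE] := exists_point (Phi_on Up) (Phi_nonzero Up); exists x; apply/eqP.
pose phi p := xchoose (ex p).
have phiE p : line (val (phi p)) = <[colv (ev (coords (val p)))]>%VS.
  exact/eqP/(xchooseP (ex p)).
exists N, rG, U, phi; split.
- split.
    exists [:: w]; split; first by move=> ?; rewrite inE => /eqP ->; exists E.
    by move=> p; rewrite /= andbT negbK.
  have [y [ynz wy _]] := Phi_dominant Fv0 mv0.
  have [p pE] := exists_proj ynz; exists p.
  by rewrite /U (homog_proportional hw (line_coords pE)).
- move=> p; exists predT, D, Phi; split=> //.
  exists [:: 1]; split; last by move=> q; rewrite /= andbT /eval_at meval1 oner_eq0.
  by move=> ?; rewrite inE => /eqP ->; exists 0%N; apply: dhomog1.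
- move=> g p q qE; apply: val_inj; apply: proj_eq.
  apply: proportional_trans (line_coords (phiE q)) _.
  apply: proportional_trans (Ma g (phi p)).
  have pp := mulv_proportional (M g) (line_coords (phiE p)).
  apply: proportional_trans (proportional_sym pp).
  have := proj_repr_coords g (val p); rewrite -qE => /ev_proportional.
  move=> h; apply: proportional_trans h _.
  by have [c c0 cE] := Phi_equivariant g (coords (val p)); exists c.
move=> C [S [hS CE]] Cphi x Xx; rewrite CE; apply/allP => Q QS.
have [d hQ] := hS Q QS.
have Q0 : forall v, F.@[v] = 0 -> Q.@[v] = 0.
  apply: (vanishes_cancel ch0 hm Fv0 mv0) => v Fv; rewrite mevalM.
  have [->|mv] := eqVneq m.@[v] 0; first by rewrite mul0r.
  have [y [ynz wy yv]] := Phi_dominant Fv mv.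
  have [p pE] := exists_proj ynz; have py := line_coords pE.
  have Up : U p by rewrite /U (homog_proportional hw py).
  have := Cphi (exist _ p Up); rewrite CE => /allP/(_ Q QS); rewrite /eval_at => Qp.
  have := homog_proportional hQ (line_coords (phiE (exist _ p Up))); rewrite /coords Qp /=.
  rewrite (homog_proportional hQ (ev_proportional py)) (homog_proportional hQ yv).
  by move=> /esym/eqP ->; rewrite mulr0.
by apply/eqP/Q0/eqP; rewrite -hypersurfaceE.
Qed.

End Criterion.

Section GroupMatrices.
Variable k : closedFieldType.
Hypothesis char0 : [pchar k] =i pred0.
Variables s r e1 e2 e3 : k.
Hypothesis sr : (s == 1) && (r == 0) || [&& s == 0, r == 1 & e1 == 0].
Local Notation F := (cubic s r e1 e2 e3).
Local Notation X := {p : proj k 5 | hypersurface F p}.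
Hypothesis reps : forall f, map_on_cone s r e1 e2 e3 f ->
    exists C d, global_rep s r e1 e2 e3 C d f.
Variables (gT : finGroupType) (a : gT -> X -> X).
Hypothesis ha : finite_subgroup_of_Aut a.

(** A matrix representing an automorphism is determined up to a scalar. Its coefficient
    [M i4 i4] is nonzero and multiplicative, because symmetries scale
    [x_4]; normalizing it to 1 turns the projective representation into a linear
    one. *)
Lemma group_matrices : exists M : gT -> 'M[k]_5,
  [/\ forall g, M g \in unitmx, forall g, M g i4 i4 = 1,
      forall g, exists c, forall v, F.@[mulv (M g) v] = c * F.@[v],
      forall g x, proportional (mulv (M g) (coords (val x))) (coords (val (a g x)))
    & mx_repr [set: gT] M].
Proof.
have [aut aM _] := ha; have sr0 := sr_neq0 sr.
have ex g : exists M : 'M[k]_5, [/\ M \in unitmx, M i4 i4 = 1,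
    exists c, forall v, F.@[mulv M v] = c * F.@[v]
  & forall x, proportional (mulv M (coords (val x))) (coords (val (a g x)))].
  have [M [uM Ma [c FM]]] := automorphism_matrix reps sr0 (aut g).
  have M44 := hyperplane_coef char0 sr uM FM.
  have ME v i : mulv ((M i4 i4)^-1 *: M) v i = (M i4 i4)^-1 * mulv M v i.
    by rewrite /mulv mulr_sumr; apply: eq_bigr => j _; rewrite mxE mulrA.
  exists ((M i4 i4)^-1 *: M); split.
  - by rewrite unitmxZ // unitrV unitfE.
  - by rewrite mxE mulVf.
  - exists ((M i4 i4)^-1 ^+ 3 * c) => v.
    by rewrite (meval_eq _ (ME v)) cubic_scale FM mulrA.
  move=> x; apply: proportional_trans (Ma x).
  by exists (M i4 i4)^-1; rewrite ?invr_eq0 // => i; rewrite ME.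
have [M MP] := fin_all_exists ex.
have uM g : M g \in unitmx by have [] := MP g.
have M44 g : M g i4 i4 = 1 by have [] := MP g.
have Ma g x : proportional (mulv (M g) (coords (val x))) (coords (val (a g x))).
  by have [] := MP g.
have hyp g v : mulv (M g) v i4 = v i4.
  by have [_ _ [c FM] _] := MP g; apply: (hyperplane_coord char0 sr (uM g) FM).
have mulM g h : M (g * h)%g = M g *m M h.
  have [||c cE] := @parallel_right_unit k s r e1 e2 e3 sr0 (M g *m M h) (M (g * h)%g).
  - by rewrite unitmx_mul !uM.
  - move=> v Fv vnz; have [x xE] := exists_point Fv vnz; have vx := line_coords xE.
    apply: (@proportional_parallel _ _ _ _ (coords (val (a (g * h)%g x)))).
      apply: proportional_trans (Ma _ _); apply: mulv_proportional; exact: proportional_sym.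
    apply: proportional_trans (proportional_eq (mulv_mul _ _ _)) _.
    rewrite aM /=; apply: proportional_trans (Ma _ _); apply: mulv_proportional.
    apply: proportional_trans (Ma _ _); apply: mulv_proportional; exact: proportional_sym.
  have e (K : 'M[k]_5) : K i4 i4 = mulv K (bvec k i4) i4.
    by rewrite mulvE /bvec /=; ring.
  have MM : (M g *m M h) i4 i4 = 1 by rewrite e mulv_mul !hyp /bvec eqxx.
  have := M44 (g * h)%g; rewrite cE mxE MM mulr1 => ->; by rewrite scale1r.
exists M; split=> //; first by move=> g; have [] := MP g.
split; last by move=> g h _ _; apply: mulM.
by have := mulM 1%g 1%g; rewrite mulg1 => e; rewrite -[M 1%g](mulmxK (uM 1%g)) -e mulmxV.
Qed.

Definition double_mx (M : gT -> 'M[k]_5) g : 'M[k]_(5 + 5) := block_mx (M g) 0 0 (M g).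

Lemma double_mx_repr M : mx_repr [set: gT] M -> mx_repr [set: gT] (double_mx M).
Proof.
move=> [M1 MM]; split; first by rewrite /double_mx M1 scalar_mx_block.
move=> g h gG hG; rewrite /double_mx MM // mulmx_block.
by rewrite !mulmx0 !mul0mx !addr0 !add0r.
Qed.

Lemma mulv_double M g (y : 'I_(5 + 5) -> k) :
  (forall i, mulv (double_mx M g) y (lshift 5 i) = mulv (M g) (fun j => y (lshift 5 j)) i) /\
  (forall i, mulv (double_mx M g) y (rshift 5 i) = mulv (M g) (fun j => y (rshift 5 j)) i).
Proof.
split=> i; rewrite /mulv big_split_ord /=.
  under eq_bigr do rewrite block_mxEul.
  by rewrite [X in _ + X]big1 ?addr0 // => j _; rewrite block_mxEur mxE mul0r.
under [X in _ + X]eq_bigr do rewrite block_mxEdr.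
by rewrite [X in X + _]big1 ?add0r // => j _; rewrite block_mxEdl mxE mul0r.
Qed.

End GroupMatrices.

Section Homogeneity.
Variable k : closedFieldType.

(** Homogeneity can be tested on values, since the field is infinite. *)
Lemma homog_of_scaling n (p : {mpoly k[n]}) d :
  (forall c v, p.@[fun i => c * v i] = c ^+ d * p.@[v]) -> p \is d.-homog.
Proof.
move=> hp; apply/dhomogP => m mp /=; have pm : p@_m != 0 by rewrite -mcoeff_msupp.
have sE (c : k) : c ^+ mdeg m = c ^+ d.
  apply: (mulIf pm); transitivity ((msub (fun j => c *: 'X_j) p)@_m).
    by rewrite msub_diag mdegE expr_sum.
  rewrite -mcoeffZ; congr (_@_m); apply: mpoly_ext => v.
  rewrite mevalZ -hp msub_eval; apply: meval_eq => j; by rewrite mevalZ mevalXU.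
have : ('X^(mdeg m) : {poly k}) = 'X^d.
  by apply: eq_poly_generic => t _; rewrite !hornerXn.
by move=> /(congr1 (fun p : {poly k} => size p)); rewrite !size_polyXn => -[].
Qed.

End Homogeneity.

(** * Residual points on tangent lines, for the first family *)

Section ToricMap.
Variable k : closedFieldType.
Hypothesis char0 : [pchar k] =i pred0.

Section Formula.
Variables (R : comNzRingType) (e1 e2 e3 : R) (v z : 'I_5 -> R).

Definition cubic_at (x : 'I_5 -> R) :=
  x i0 * x i1 * x i4 + curve_form 1 0 e1 e2 e3 (x i2) (x i3) (x i4).

(** For the point [p = plane_part v] of the plane [x_2 = x_4 = 0], which lies in the
    cubic, the expansion of [F(p + t x)] in [t] is
    [t * polar1 x + t ^ 2 * polar2 x + t ^ 3 * F(x)]. *)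
Definition polar1 (x : 'I_5 -> R) :=
  v i3 ^+ 2 * x i2 + (v i0 * v i1 + e1 * v i3 ^+ 2) * x i4.

Definition polar2 (x : 'I_5 -> R) :=
  (v i0 * x i1 + v i1 * x i0) * x i4 + 2%:R * v i3 * x i2 * x i3
  + 2%:R * e1 * v i3 * x i3 * x i4 + e2 * v i3 * x i4 ^+ 2.

Definition plane_part : 'I_5 -> R := vec5 (v i0) (v i1) 0 (v i3) 0.

(** The last basis vector has [polar1] equal to [A]; it is preserved by
    symmetries, and subtracting the right multiple of it from [A z] gives a tangent
    direction at [plane_part v]. *)
Definition tangent_vec : 'I_5 -> R :=
  let A := v i0 * v i1 + e1 * v i3 ^+ 2 in let B := polar1 z in
  vec5 (A * z i0) (A * z i1) (A * z i2) (A * z i3) (A * z i4 - B).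

(** The third point of the cubic on the tangent line through [p] with direction
    [W]: on it [F(p + t W) = t ^ 2 (polar2 W + t F(W))]. *)
Definition toric_map (i : 'I_5) : R :=
  cubic_at tangent_vec * plane_part i - polar2 tangent_vec * tangent_vec i.

End Formula.

Lemma toric_map_scale (e1 e2 e3 : k) v z c i :
  toric_map e1 e2 e3 (fun j => c * v j) (fun j => c * z j) i
  = c ^+ 10 * toric_map e1 e2 e3 v z i.
Proof.
have WE j : tangent_vec e1 (fun j => c * v j) (fun j => c * z j) j = c ^+ 3 * tangent_vec e1 v z j.
  by move: j; apply: ord5P; rewrite /tangent_vec /polar1 /vec5 /=; ring.
have FE : cubic_at e1 e2 e3 (tangent_vec e1 (fun j => c * v j) (fun j => c * z j))
    = c ^+ 9 * cubic_at e1 e2 e3 (tangent_vec e1 v z).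
  by rewrite /cubic_at /curve_form !WE; ring.
have QE : polar2 e1 e2 (fun j => c * v j) (tangent_vec e1 (fun j => c * v j) (fun j => c * z j))
    = c ^+ 7 * polar2 e1 e2 v (tangent_vec e1 v z).
  by rewrite /polar2 !WE; ring.
have pE j : plane_part (fun j => c * v j) j = c * plane_part v j.
  by move: j; apply: ord5P; rewrite /plane_part /vec5 /= ?mulr0.
by rewrite /toric_map FE QE WE pE; ring.
Qed.

Lemma toric_map_eval n (e1 e2 e3 : k) (v z : 'I_5 -> {mpoly k[n]}) y i :
  (toric_map e1%:MP e2%:MP e3%:MP v z i).@[y] =
  toric_map e1 e2 e3 (fun j => (v j).@[y]) (fun j => (z j).@[y]) i.
Proof.
have WE j : (tangent_vec e1%:MP v z j).@[y] =
    tangent_vec e1 (fun j => (v j).@[y]) (fun j => (z j).@[y]) j.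
  by move: j; apply: ord5P; rewrite /tangent_vec /polar1 /vec5 /= !(mevals y).
have pE : (plane_part v i).@[y] = plane_part (fun j => (v j).@[y]) i.
  by move: i; apply: ord5P; rewrite /plane_part /vec5 /= ?meval0.
rewrite /toric_map; move: (tangent_vec e1%:MP v z) WE => W WE.
rewrite mevalB !mevalM pE !WE /cubic_at /polar2 /curve_form.
by rewrite !(mevals y) !WE ?meval1 ?meval0; ring.
Qed.

Variables e1 e2 e3 : k.
Local Notation F := (cubic 1 0 e1 e2 e3).

Lemma cubic_atE x : F.@[x] = cubic_at e1 e2 e3 x.
Proof. by rewrite cubicE. Qed.

Lemma plane_expansion v x a b :
  F.@[fun i => a * plane_part v i + b * x i] =
  a ^+ 2 * b * polar1 e1 v x + a * b ^+ 2 * polar2 e1 e2 v x + b ^+ 3 * F.@[x].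
Proof.
by rewrite !cubicE /curve_form /polar1 /polar2 /plane_part /vec5 /=; ring.
Qed.

Lemma tangent_vec_polar v z : polar1 e1 v (tangent_vec e1 v z) = 0.
Proof. by rewrite /polar1 /tangent_vec /polar1 /vec5 /=; ring. Qed.

Lemma toric_map_on v z : F.@[toric_map e1 e2 e3 v z] = 0.
Proof.
pose W := tangent_vec e1 v z.
have E i : toric_map e1 e2 e3 v z i = F.@[W] * plane_part v i + (- polar2 e1 e2 v W) * W i.
  by rewrite cubic_atE /toric_map mulNr.
by rewrite (meval_eq _ E) plane_expansion tangent_vec_polar; ring.
Qed.

Section Equivariance.
Variables (M : 'M[k]_5) (c : k).
Hypothesis FM : forall v, F.@[mulv M v] = c * F.@[v].
Hypothesis M4 : forall v, mulv M v i4 = v i4.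
Hypothesis Mcol4 : forall i, i != i4 -> M i i4 = 0.
Hypothesis Mplane : forall v i, mulv M (plane_part v) i = plane_part (mulv M v) i.

Lemma polar_equivariant v x :
  polar1 e1 (mulv M v) (mulv M x) = c * polar1 e1 v x /\
  polar2 e1 e2 (mulv M v) (mulv M x) = c * polar2 e1 e2 v x.
Proof.
have [|_ p1 p2 _] := @cubic_coefs k 0 (polar1 e1 (mulv M v) (mulv M x) - c * polar1 e1 v x)
    (polar2 e1 e2 (mulv M v) (mulv M x) - c * polar2 e1 e2 v x) 0.
  move=> t; have := FM (fun i => 1 * plane_part v i + t * x i).
  have E i : mulv M (fun i => 1 * plane_part v i + t * x i) i =
      1 * plane_part (mulv M v) i + t * mulv M x i.
    by rewrite mulv_lin Mplane.
  rewrite (meval_eq _ E) !plane_expansion FM => /eqP; rewrite -subr_eq0 => /eqP e.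
  by rewrite -[RHS]e; ring.
by split; apply/eqP; rewrite -subr_eq0; apply/eqP.
Qed.

Lemma toric_map_equivariant v z i :
  toric_map e1 e2 e3 (mulv M v) (mulv M z) i = c ^+ 4 * mulv M (toric_map e1 e2 e3 v z) i.
Proof.
have [p1z _] := polar_equivariant v z.
have m4 j : mulv M (bvec k i4) j = bvec k i4 j.
  have [->|j4] := eqVneq j i4; first by rewrite M4.
  by rewrite mulvE /bvec /= (negPf j4) !mulr0 !add0r mulr1 Mcol4.
have [pA _] := polar_equivariant v (bvec k i4).
have AE : mulv M v i0 * mulv M v i1 + e1 * mulv M v i3 ^+ 2 = c * (v i0 * v i1 + e1 * v i3 ^+ 2).
  move: pA; rewrite /polar1 !m4 /bvec /= => e.
  by rewrite -[RHS](mulr1 _) -[RHS]addr0; move: e; rewrite !mulr0 !add0r !mulr1 addr0.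
have WE j : tangent_vec e1 (mulv M v) (mulv M z) j = c * mulv M (tangent_vec e1 v z) j.
  have E l : tangent_vec e1 v z l =
      (v i0 * v i1 + e1 * v i3 ^+ 2) * z l + (- polar1 e1 v z) * bvec k i4 l.
    by move: l; apply: ord5P; rewrite /tangent_vec /bvec /vec5 /=; ring.
  have E' l : tangent_vec e1 (mulv M v) (mulv M z) l =
      (mulv M v i0 * mulv M v i1 + e1 * mulv M v i3 ^+ 2) * mulv M z l
      + (- polar1 e1 (mulv M v) (mulv M z)) * bvec k i4 l.
    by move: l; apply: ord5P; rewrite /tangent_vec /bvec [vec5]lock /= -lock /vec5 /=; ring.
  rewrite E' AE p1z (eq_mulv _ E) -m4.
  rewrite mulv_lin.
  by ring.
pose W := tangent_vec e1 v z.
have FE : cubic_at e1 e2 e3 (tangent_vec e1 (mulv M v) (mulv M z)) = c ^+ 4 * F.@[W].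
  by rewrite -cubic_atE (meval_eq _ WE) cubic_scale FM; ring.
have QE : polar2 e1 e2 (mulv M v) (tangent_vec e1 (mulv M v) (mulv M z)) = c ^+ 3 * polar2 e1 e2 v W.
  have [_ p2] := polar_equivariant v W.
  transitivity (c ^+ 2 * polar2 e1 e2 (mulv M v) (mulv M W)); last by rewrite p2; ring.
  by rewrite /polar2 !WE; ring.
have E l : toric_map e1 e2 e3 v z l = F.@[W] * plane_part v l + (- polar2 e1 e2 v W) * W l.
  by rewrite /toric_map mulNr -cubic_atE.
rewrite (eq_mulv _ E) mulv_lin /toric_map FE QE WE -Mplane -/W.
by ring.
Qed.

End Equivariance.

(** A given point [x] is its own residual point, with [z = x], as soon as [x] itself is a
    tangent direction at [p]. For [p = (t, mu / t, 0, 1, 0)] this condition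
    determines [mu], and [t] only has to avoid 0 and the zeros of [polar2 x]. *)
Lemma toric_map_dominant x : F.@[x] = 0 -> x i1 * x i2 * x i4 != 0 ->
  exists v c, c != 0 /\ forall i, toric_map e1 e2 e3 v x i = c * x i.
Proof.
move=> Fx; rewrite !mulf_eq0 !negb_or => /andP[/andP[x1 x2] x4].
pose mu := - (x i2 / x i4) - e1.
pose C := 2%:R * x i2 * x i3 + 2%:R * e1 * x i3 * x i4 + e2 * x i4 ^+ 2.
pose q : {poly k} := (x i1 * x i4) *: 'X^2 + C *: 'X + (mu * x i0 * x i4)%:P.
have q0 : 'X * q != 0.
  rewrite mulf_neq0 ?polyX_eq0 //; apply/eqP => /(congr1 (fun p : {poly k} => p`_2)).
  rewrite !coefD !coefZ coefXn coefX coefC coef0 /= mulr1 mulr0 !addr0 => /eqP.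
  by rewrite mulf_eq0 (negPf x1) (negPf x4).
have [t] := elimT (closed_nonrootP _) q0; rewrite /root hornerM hornerX mulf_eq0 negb_or => /andP[t0 qt].
pose v : 'I_5 -> k := vec5 t (mu / t) 0 1 0.
have AE : v i0 * v i1 + e1 * v i3 ^+ 2 = - (x i2 / x i4).
  by rewrite /v /vec5 /= /mu; field; rewrite ?t0 ?x4.
have BE : polar1 e1 v x = 0 by rewrite /polar1 AE /v /vec5 /=; field; rewrite ?x4 ?t0.
pose A := - (x i2 / x i4).
have WE i : tangent_vec e1 v x i = A * x i.
  by rewrite /tangent_vec AE BE subr0; move: i; apply: ord5P.
have QE : polar2 e1 e2 v (tangent_vec e1 v x) = A ^+ 2 * (q.[t] / t).
  rewrite /polar2 !WE /q !hornerD !hornerZ hornerXn hornerX hornerC /v /vec5 /= /C.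
  by field; rewrite ?t0 ?x4.
exists v, (- (A ^+ 3 * (q.[t] / t))); split.
  have A0 : A != 0 by rewrite /A oppr_eq0 mulf_neq0 ?invr_eq0.
  by rewrite oppr_eq0 !mulf_neq0 ?invr_eq0.
move=> i; rewrite /toric_map QE WE -cubic_atE (meval_eq _ WE) cubic_scale Fx.
by ring.
Qed.

End ToricMap.

(** * Third points on secant lines, for the second family *)

Section CuspidalFormula.
Variable R : comNzRingType.
Variables e2 e3 : R.

Definition quad (v : 'I_5 -> R) := v i0 * v i1 + v i2 ^+ 2.
(** The polar form, [bilin v v = 2 * quad v]. *)
Definition bilin (v w : 'I_5 -> R) := v i0 * w i1 + v i1 * w i0 + 2%:R * v i2 * w i2.

(** Here [A], [b], [B] stand for [quad v], [bilin v w], [quad w], while [t], [x] and [tau] stand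
    for [v_3], [v_4] and [w_3]. Restricted to the last two coordinates,
    the cubic is [cusp_f], and [F = x_4 * quad + cusp_f]. Write [f], [c], [P], ...
    for [cusp_f], [cusp_c], [cusp_P], ...

    Let [sg] be a square root of [- f / (x A)]. Then [p = (sg v, t, x)] lies on the
    cubic, where [sg v] stands for its first three coordinates. The vector
    [w' = x (2 A w - b v)] is orthogonal to [v] and has square [cusp_r]. The direction
    [d = (c sg v + (1 + sg) w', P, 0)] is tangent at [p] by the choice of [P] and [c].
    The residual point of that tangent line is [P ^ 3 p - Q d], where [Q = Q0 + Q1 sg]
    is the coefficient of the square of the parameter. With [E = Q1 sg ^ 2] it takes the
    form [u0 + sg u1], where
    [u0 = (p0 v + m0 w', P (P ^ 2 t - Q0), P ^ 3 x)] and
    [u1 = (p1 v + m1 w', - P Q1, 0)]. The line through [u0 + sg u1] and [u0 - sg u1] meets the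
    cubic in the third point [Q1 ^ 3 u0 + mu u1], which no longer involves [sg]. *)
Section Scalars.
Variables A b B t x tau : R.

Definition cusp_f := t ^+ 3 + e2 * t * x ^+ 2 + e3 * x ^+ 3.
Definition cusp_df := 3%:R * t ^+ 2 + e2 * x ^+ 2.
Definition cusp_P := 2%:R * cusp_f * tau.
Definition cusp_c := tau * cusp_df.
Definition cusp_gram := 4%:R * A * B - b ^+ 2.
Definition cusp_r := x ^+ 2 * A * cusp_gram.
Definition cusp_Q0 := - cusp_c ^+ 2 * cusp_f + 3%:R * t * cusp_P ^+ 2 + x * cusp_r
  - x ^+ 2 * cusp_f * cusp_gram.
Definition cusp_Q1 := 2%:R * x * cusp_r.
Definition cusp_E := - (2%:R * x ^+ 2 * cusp_f * cusp_gram).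
Definition cusp_p0 := - (cusp_E * cusp_c).
Definition cusp_m0 := - (cusp_Q0 + cusp_E).
Definition cusp_p1 := cusp_P ^+ 3 - cusp_Q0 * cusp_c.
Definition cusp_m1 := - (cusp_Q0 + cusp_Q1).
Definition cusp_mu := x * (cusp_p1 ^+ 2 * A + cusp_m1 ^+ 2 * cusp_r)
  + 3%:R * (cusp_P ^+ 2 * t - cusp_Q0) * cusp_Q1 ^+ 2.
Definition cusp_X := cusp_Q1 ^+ 3 * cusp_p0 + cusp_mu * cusp_p1.
Definition cusp_Y := cusp_Q1 ^+ 3 * cusp_m0 + cusp_mu * cusp_m1.
(** The coefficients of [v] and [w] in [X v + Y w']. *)
Definition cusp_av := cusp_X - cusp_Y * (x * b).
Definition cusp_aw := cusp_Y * (2%:R * x * A).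
Definition cusp_3 := cusp_Q1 ^+ 3 * (cusp_P * (cusp_P ^+ 2 * t - cusp_Q0)) - cusp_mu * (cusp_P * cusp_Q1).
Definition cusp_4 := cusp_Q1 ^+ 3 * (cusp_P ^+ 3 * x).
End Scalars.

Definition cusp_map (v w : 'I_5 -> R) : 'I_5 -> R :=
  let A := quad v in let b := bilin v w in let B := quad w in
  let t := v i3 in let x := v i4 in let tau := w i3 in
  let a := cusp_av A b B t x tau in let a' := cusp_aw A b B t x tau in
  vec5 (a * v i0 + a' * w i0) (a * v i1 + a' * w i1) (a * v i2 + a' * w i2)
    (cusp_3 A b B t x tau) (cusp_4 A b B t x tau).

End CuspidalFormula.

Section CuspidalMap.
Variable k : closedFieldType.
Hypothesis char0 : [pchar k] =i pred0.
Variables e2 e3 : k.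
Local Notation F := (cubic 0 1 0 e2 e3).

Lemma cuspE v : F.@[v] = v i4 * quad v + cusp_f e2 e3 (v i3) (v i4).
Proof. by rewrite cubicE /curve_form /quad /cusp_f; ring. Qed.

Section OnCubic.
Variables A b B t x tau : k.
Local Notation f := (cusp_f e2 e3 t x).
Local Notation P := (cusp_P e2 e3 t x tau).
Local Notation cc := (cusp_c e2 t x tau).
Local Notation rr := (cusp_r A b B x).
Local Notation Q0 := (cusp_Q0 e2 e3 A b B t x tau).
Local Notation Q1 := (cusp_Q1 A b B x).
Local Notation E := (cusp_E e2 e3 A b B t x).
Local Notation p0 := (cusp_p0 e2 e3 A b B t x tau).
Local Notation p1 := (cusp_p1 e2 e3 A b B t x tau).
Local Notation m0 := (cusp_m0 e2 e3 A b B t x tau).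
Local Notation m1 := (cusp_m1 e2 e3 A b B t x tau).
Local Notation mu := (cusp_mu e2 e3 A b B t x tau).

(** The value of the cubic at [al u0 + be u1]; orthogonality of [v] and [w'] makes the
    quadratic form a sum of two squares. *)
Definition pencil al be :=
  al * (P ^+ 3 * x) * ((al * p0 + be * p1) ^+ 2 * A + (al * m0 + be * m1) ^+ 2 * rr)
  + cusp_f e2 e3 (al * (P * (P ^+ 2 * t - Q0)) - be * (P * Q1)) (al * (P ^+ 3 * x)).

(** The points [u0 + sg u1] lie on the cubic, as residual points of tangent lines: the
    first order term vanishes because [2 f c = P * cusp_df], and the terms of order
    two and three cancel by the choice of [Q]. *)
Lemma pencil_tangent sg : x * A * sg ^+ 2 = - f -> pencil 1 sg = 0.
Proof.
move=> sgE; pose Q := Q0 + Q1 * sg.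
have EE : E = Q1 * sg ^+ 2.
  rewrite /cusp_E /cusp_Q1 /cusp_r; transitivity (2%:R * x ^+ 2 * cusp_gram A b B * (x * A * sg ^+ 2)).
    by rewrite sgE; ring.
  by ring.
(* The first three coordinates of [P ^ 3 p - Q d]. *)
have pE : 1 * p0 + sg * p1 = sg * (P ^+ 3 - Q * cc) by rewrite /cusp_p0 /cusp_p1 EE /Q; ring.
have mE : 1 * m0 + sg * m1 = - (Q * (1 + sg)) by rewrite /cusp_m0 /cusp_m1 EE /Q; ring.
(* The definition of [Q] as second order coefficient of the cubic along [d]. *)
have KE : x * (1 + sg) ^+ 2 * rr = Q + cc ^+ 2 * f - 3%:R * t * P ^+ 2.
  rewrite /Q /cusp_Q0 /cusp_Q1.
  transitivity (x * rr + 2%:R * x * rr * sg + x ^+ 2 * cusp_gram A b B * (x * A * sg ^+ 2)).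
    by rewrite /cusp_r; ring.
  by rewrite sgE; ring.
rewrite /pencil pE mE.
transitivity (P ^+ 3 * ((x * A * sg ^+ 2) * (P ^+ 3 - Q * cc) ^+ 2
   + Q ^+ 2 * (x * (1 + sg) ^+ 2 * rr)
   + (P ^+ 2 * t - Q) ^+ 3 + e2 * (P ^+ 2 * t - Q) * P ^+ 4 * x ^+ 2 + e3 * P ^+ 6 * x ^+ 3)).
  rewrite /Q; move: P Q0 Q1 cc rr => p q0 q1 c' r'; rewrite /cusp_f; ring.
rewrite sgE KE; clear pE mE KE EE sgE; move: Q => Q.
transitivity (P ^+ 3 * (P ^+ 6 * (t ^+ 3 + e2 * t * x ^+ 2 + e3 * x ^+ 3 - f) + Q * P ^+ 3 * (2%:R * f * cc - P * cusp_df e2 t x))).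
  by rewrite /cusp_df; ring.
rewrite -/(cusp_f e2 e3 t x) subrr /cusp_P /cusp_c.
by move: f (cusp_df _ _ _) => f' df'; ring.
Qed.

(** As a binary cubic, [pencil] vanishes at [1 : sg] and [1 : - sg], so it is the product
    of [be ^ 2 - sg ^ 2 al ^ 2] and a linear form, whose coefficients are those
    of [al * be ^ 2] and of [be ^ 3]. *)
Lemma pencil_third : x != 0 -> A != 0 -> f != 0 -> pencil (Q1 ^+ 3) mu = 0.
Proof.
move=> x0 A0 f0; have [sg sgE] := @nth_root k 2 (- f / (x * A)) isT.
have {}sgE : x * A * sg ^+ 2 = - f by rewrite sgE mulrC divfK ?mulf_neq0.
have sg0 : sg != 0.
  apply: contraNneq f0 => z; move: sgE; rewrite z => /eqP; rewrite expr0n mulr0 eq_sym oppr_eq0.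
  by move/eqP ->.
pose c0 := pencil 1 0.
pose c2 := P ^+ 3 * mu; pose c3 := - (P * Q1) ^+ 3.
pose u3 := P * (P ^+ 2 * t - Q0); pose u4 := P ^+ 3 * x.
pose c1 := u4 * (2%:R * p0 * p1 * A + 2%:R * m0 * m1 * rr) - 3%:R * u3 ^+ 2 * (P * Q1)
  - e2 * (P * Q1) * u4 ^+ 2.
have expand al be : pencil al be = al ^+ 3 * c0 + al ^+ 2 * be * c1 + al * be ^+ 2 * c2 + be ^+ 3 * c3.
  have -> : c2 = u4 * (p1 ^+ 2 * A + m1 ^+ 2 * rr) + 3%:R * u3 * (P * Q1) ^+ 2.
    by rewrite /c2 /u3 /u4 /cusp_mu; move: p1 m1 rr Q1 Q0 P => p1' m1' r' q1' q0' p'; ring.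
  rewrite /c0 /c1 /c3 /pencil -/u3 -/u4.
  move: (u3) (u4) p0 p1 m0 m1 rr (P * Q1) => u3x u4x p0x p1x m0x m1x rx qx.
  by rewrite /cusp_f; ring.
have s1 := pencil_tangent sgE.
have s2 : pencil 1 (- sg) = 0 by apply: pencil_tangent; rewrite sqrrN.
rewrite !expand in s1 s2.
have h0 : c0 + sg ^+ 2 * c2 = 0.
  apply: (mulfI (two_neq0 char0)); rewrite mulr0.
  by rewrite -[RHS](etrans (congr2 +%R s1 s2) (addr0 0)); move: (c0) (c1) (c2) (c3) => c0' c1' c2' c3'; ring.
have h1 : c1 + sg ^+ 2 * c3 = 0.
  apply: (mulfI (mulf_neq0 (two_neq0 char0) sg0)); rewrite mulr0.
  rewrite -[RHS](etrans (congr2 (fun a b => a - b) s1 s2) (subr0 0)) /=.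
  by move: (c0) (c1) (c2) (c3) => c0' c1' c2' c3'; ring.
have c0E : c0 = - (sg ^+ 2 * c2) by apply/eqP; rewrite -addr_eq0 h0.
have c1E : c1 = - (sg ^+ 2 * c3) by apply/eqP; rewrite -addr_eq0 h1.
rewrite expand c0E c1E /c2 /c3; move: mu P Q1 => mu' P' Q'; ring.
Qed.

End OnCubic.
End CuspidalMap.

(** Each of the scalars is isobaric when [A], [b], [B] have weight [ka], [t] and [tau] have
    weight [al], and [x] has weight [ep], with [ka * ep = al ^ 3]. Stated for two rings
    linked by a morphism, this covers scaling, equivariance and the evaluation of
    polynomials at once. *)
Section CuspidalWeights.
Variables (R S : comNzRingType) (g : {rmorphism R -> S}).
Variables (al ka ep : S) (e2 e3 : R) (d2 d3 : S).
Hypotheses (ka_ep : ka * ep = al ^+ 3) (d2E : d2 * ep ^+ 2 = al ^+ 2 * g e2)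
  (d3E : d3 * ep ^+ 3 = al ^+ 3 * g e3).
Variables A b B t x tau : R.
Local Notation s phi := (phi (ka * g A) (ka * g b) (ka * g B) (al * g t) (ep * g x) (al * g tau)).
Local Notation o phi := (g (phi A b B t x tau)).

Lemma cusp_f_weight : cusp_f d2 d3 (al * g t) (ep * g x) = al ^+ 3 * g (cusp_f e2 e3 t x).
Proof.
rewrite /cusp_f; transitivity (al ^+ 3 * g t ^+ 3 + (d2 * ep ^+ 2) * al * g t * g x ^+ 2 +
  d3 * ep ^+ 3 * g x ^+ 3); by [ring | rewrite d2E d3E; ring].
Qed.

Lemma cusp_df_weight : cusp_df d2 (al * g t) (ep * g x) = al ^+ 2 * g (cusp_df e2 t x).
Proof.
rewrite /cusp_df; transitivity (3%:R * al ^+ 2 * g t ^+ 2 + (d2 * ep ^+ 2) * g x ^+ 2).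
  by ring.
by rewrite d2E; ring.
Qed.

Lemma cusp_P_weight :
  cusp_P d2 d3 (al * g t) (ep * g x) (al * g tau) = al ^+ 4 * g (cusp_P e2 e3 t x tau).
Proof. by rewrite /cusp_P cusp_f_weight; move: (cusp_f _ _ _ _) => f; ring. Qed.

Lemma cusp_c_weight :
  cusp_c d2 (al * g t) (ep * g x) (al * g tau) = al ^+ 3 * g (cusp_c e2 t x tau).
Proof. by rewrite /cusp_c cusp_df_weight; move: (cusp_df _ _ _) => f; ring. Qed.

Lemma cusp_gram_weight :
  cusp_gram (ka * g A) (ka * g b) (ka * g B) = ka ^+ 2 * g (cusp_gram A b B).
Proof. by rewrite /cusp_gram; ring. Qed.

Lemma cusp_r_weight :
  ep * g x * cusp_r (ka * g A) (ka * g b) (ka * g B) (ep * g x) = al ^+ 9 * g (x * cusp_r A b B x).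
Proof.
rewrite /cusp_r cusp_gram_weight (_ : al ^+ 9 = (ka * ep) ^+ 3); last by rewrite ka_ep; ring.
by move: (cusp_gram _ _ _) => D; ring.
Qed.

Lemma cusp_E_weight : cusp_E d2 d3 (ka * g A) (ka * g b) (ka * g B) (al * g t) (ep * g x) =
  al ^+ 9 * g (cusp_E e2 e3 A b B t x).
Proof.
rewrite /cusp_E cusp_gram_weight cusp_f_weight.
rewrite (_ : al ^+ 9 = al ^+ 3 * (ka * ep) ^+ 2); last by rewrite ka_ep; ring.
by move: (cusp_gram _ _ _) (cusp_f _ _ _ _) => D f; ring.
Qed.

Lemma cusp_Q0_weight : s (cusp_Q0 d2 d3) = al ^+ 9 * o (cusp_Q0 e2 e3).
Proof.
rewrite /cusp_Q0 cusp_r_weight cusp_c_weight cusp_P_weight cusp_f_weight cusp_gram_weight.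
have -> : (ep * g x) ^+ 2 * (al ^+ 3 * g (cusp_f e2 e3 t x)) * (ka ^+ 2 * g (cusp_gram A b B)) =
    al ^+ 9 * g (x ^+ 2 * cusp_f e2 e3 t x * cusp_gram A b B).
  rewrite (_ : al ^+ 9 = al ^+ 3 * (ka * ep) ^+ 2); last by rewrite ka_ep; ring.
  by move: (cusp_gram _ _ _) (cusp_f _ _ _ _) => D f; ring.
move: (cusp_r _ _ _ _) (cusp_c _ _ _ _) (cusp_P _ _ _ _ _) (cusp_f _ _ _ _) (cusp_gram _ _ _).
by move=> r c P f D; ring.
Qed.

Lemma cusp_Q1_weight : cusp_Q1 (ka * g A) (ka * g b) (ka * g B) (ep * g x) =
  al ^+ 9 * g (cusp_Q1 A b B x).
Proof.
transitivity (2%:R * (ep * g x * cusp_r (ka * g A) (ka * g b) (ka * g B) (ep * g x))).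
  by rewrite /cusp_Q1; move: (cusp_r _ _ _ _) => r; ring.
by rewrite cusp_r_weight /cusp_Q1; move: (cusp_r _ _ _ _) => r; ring.
Qed.

Lemma cusp_p0_weight : s (cusp_p0 d2 d3) = al ^+ 12 * o (cusp_p0 e2 e3).
Proof.
rewrite /cusp_p0 cusp_E_weight cusp_c_weight.
by move: (cusp_E _ _ _ _ _ _ _) (cusp_c _ _ _ _) => E c; ring.
Qed.

Lemma cusp_p1_weight : s (cusp_p1 d2 d3) = al ^+ 12 * o (cusp_p1 e2 e3).
Proof.
rewrite /cusp_p1 cusp_Q0_weight cusp_c_weight cusp_P_weight.
by move: (cusp_Q0 _ _ _ _ _ _ _ _) (cusp_c _ _ _ _) (cusp_P _ _ _ _ _) => E c P; ring.
Qed.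

Lemma cusp_m0_weight : s (cusp_m0 d2 d3) = al ^+ 9 * o (cusp_m0 e2 e3).
Proof.
rewrite /cusp_m0 cusp_Q0_weight cusp_E_weight.
by move: (cusp_Q0 _ _ _ _ _ _ _ _) (cusp_E _ _ _ _ _ _ _) => Q E; ring.
Qed.

Lemma cusp_m1_weight : s (cusp_m1 d2 d3) = al ^+ 9 * o (cusp_m1 e2 e3).
Proof.
rewrite /cusp_m1 cusp_Q0_weight cusp_Q1_weight.
by move: (cusp_Q0 _ _ _ _ _ _ _ _) (cusp_Q1 _ _ _ _) => Q E; ring.
Qed.

Lemma cusp_mu_weight : s (cusp_mu d2 d3) = al ^+ 27 * o (cusp_mu e2 e3).
Proof.
rewrite /cusp_mu cusp_Q0_weight cusp_Q1_weight cusp_P_weight cusp_p1_weight cusp_m1_weight.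
rewrite mulrDr [ep * g x * (_ * cusp_r _ _ _ _)]mulrCA cusp_r_weight.
move: (cusp_Q0 _ _ _ _ _ _ _ _) (cusp_Q1 _ _ _ _) (cusp_P _ _ _ _ _) => Q E P.
move: (cusp_p1 _ _ _ _ _ _ _ _) (cusp_m1 _ _ _ _ _ _ _ _) (cusp_r _ _ _ _) => p m r.
have -> : ep * g x * ((al ^+ 12 * g p) ^+ 2 * (ka * g A)) = al ^+ 27 * g (x * p ^+ 2 * A).
  rewrite (_ : al ^+ 27 = al ^+ 24 * (ka * ep)); last by rewrite ka_ep; ring.
  by ring.
by ring.
Qed.

Lemma cusp_av_weight : s (cusp_av d2 d3) = al ^+ 39 * o (cusp_av e2 e3).
Proof.
rewrite /cusp_av /cusp_X /cusp_Y cusp_mu_weight cusp_Q1_weight cusp_p0_weight cusp_p1_weight.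
rewrite cusp_m0_weight cusp_m1_weight.
move: (cusp_Q1 _ _ _ _) (cusp_mu _ _ _ _ _ _ _ _) => Q m.
move: (cusp_p1 _ _ _ _ _ _ _ _) (cusp_m1 _ _ _ _ _ _ _ _) => p1 m1.
move: (cusp_p0 _ _ _ _ _ _ _ _) (cusp_m0 _ _ _ _ _ _ _ _) => p0 m0.
have -> : ep * g x * (ka * g b) = al ^+ 3 * g (x * b) by rewrite -ka_ep; ring.
by ring.
Qed.

Lemma cusp_aw_weight : s (cusp_aw d2 d3) = al ^+ 39 * o (cusp_aw e2 e3).
Proof.
rewrite /cusp_aw /cusp_Y cusp_mu_weight cusp_Q1_weight cusp_m0_weight cusp_m1_weight.
move: (cusp_Q1 _ _ _ _) (cusp_mu _ _ _ _ _ _ _ _) => Q m.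
move: (cusp_m0 _ _ _ _ _ _ _ _) (cusp_m1 _ _ _ _ _ _ _ _) => m0 m1.
rewrite -[2%:R * (ep * g x) * (ka * g A)]mulrA (_ : ep * g x * (ka * g A) = al ^+ 3 * g (x * A)); last by rewrite -ka_ep; ring.
by ring.
Qed.

Lemma cusp_3_weight : s (cusp_3 d2 d3) = al ^+ 39 * (al * o (cusp_3 e2 e3)).
Proof.
rewrite /cusp_3 cusp_mu_weight cusp_Q1_weight cusp_Q0_weight cusp_P_weight.
move: (cusp_Q1 _ _ _ _) (cusp_mu _ _ _ _ _ _ _ _) => Q m.
by move: (cusp_Q0 _ _ _ _ _ _ _ _) (cusp_P _ _ _ _ _) => Q0 P; ring.
Qed.

Lemma cusp_4_weight : s (cusp_4 d2 d3) = al ^+ 39 * (ep * o (cusp_4 e2 e3)).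
Proof.
rewrite /cusp_4 cusp_Q1_weight cusp_P_weight.
by move: (cusp_Q1 _ _ _ _) (cusp_P _ _ _ _ _) => Q P; ring.
Qed.

End CuspidalWeights.

Section CuspidalMapLaws.

Lemma cusp_map_weight (R S : comNzRingType) (g : {rmorphism R -> S}) (al ka ep : S)
    (e2 e3 : R) (d2 d3 : S) (v w : 'I_5 -> R) (v' w' : 'I_5 -> S) :
  ka * ep = al ^+ 3 -> d2 * ep ^+ 2 = al ^+ 2 * g e2 -> d3 * ep ^+ 3 = al ^+ 3 * g e3 ->
  quad v' = ka * g (quad v) -> bilin v' w' = ka * g (bilin v w) -> quad w' = ka * g (quad w) ->
  v' i3 = al * g (v i3) -> v' i4 = ep * g (v i4) -> w' i3 = al * g (w i3) ->
  forall a a', a = g (cusp_av e2 e3 (quad v) (bilin v w) (quad w) (v i3) (v i4) (w i3)) ->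
  a' = g (cusp_aw e2 e3 (quad v) (bilin v w) (quad w) (v i3) (v i4) (w i3)) ->
  forall i, cusp_map d2 d3 v' w' i =
  al ^+ 39 * vec5 (a * v' i0 + a' * w' i0) (a * v' i1 + a' * w' i1) (a * v' i2 + a' * w' i2)
    (al * g (cusp_map e2 e3 v w i3)) (ep * g (cusp_map e2 e3 v w i4)) i.
Proof.
move=> h1 h2 h3 qv b qw v3 v4 w3 a a' aE aE' i.
rewrite /cusp_map qv b qw v3 v4 w3 (cusp_av_weight h1 h2 h3) (cusp_aw_weight h1 h2 h3).
rewrite (cusp_3_weight h1 h2 h3) (cusp_4_weight h1 h2 h3) -aE -aE'.
by move: i; apply: ord5P; rewrite /vec5 /= ?mulrDr ?mulrA.
Qed.

Variable k : closedFieldType.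
Hypothesis char0 : [pchar k] =i pred0.

Lemma cusp_map_eval n (e2 e3 : k) (v w : 'I_5 -> {mpoly k[n]}) y i :
  (cusp_map e2%:MP e3%:MP v w i).@[y] =
  cusp_map e2 e3 (fun j => (v j).@[y]) (fun j => (w j).@[y]) i.
Proof.
pose v' j := (v j).@[y]; pose w' j := (w j).@[y].
have qE u : quad (fun j => (u j).@[y]) = (quad u).@[y] by rewrite /quad mevalD mevalM mevalXn.
have bE : bilin v' w' = (bilin v w).@[y].
  by rewrite /bilin !mevalD !mevalM mevalMn meval1.
have h := @cusp_map_weight _ _ (meval y) 1 1 1 e2%:MP e3%:MP e2 e3 v w v' w'.
apply: esym; apply: etrans (h _ _ _ _ _ _ _ _ _ _ _ erefl erefl i) _; rewrite ?expr1n ?mul1r ?mulr1 ?mevalC //;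
  try by [apply: qE | apply: esym; apply: mevalC].
clear h; move: i; apply: ord5P; rewrite /cusp_map /vec5 /= ?mul1r //;
  by move: (cusp_av _ _ _ _ _ _ _ _) (cusp_aw _ _ _ _ _ _ _ _) => a a'; rewrite mevalD !mevalM.
Qed.

Lemma cusp_map_scale (e2 e3 : k) v w c i :
  cusp_map e2 e3 (fun j => c * v j) (fun j => c * w j) i = c ^+ 40 * cusp_map e2 e3 v w i.
Proof.
have h := @cusp_map_weight _ _ idfun c (c ^+ 2) c e2 e3 e2 e3 v w
  (fun j => c * v j) (fun j => c * w j).
apply: etrans (h _ _ _ _ _ _ _ _ _ _ _ erefl erefl i) _; try by rewrite /quad /bilin /=; ring.
clear h; move: i; apply: ord5P; rewrite /cusp_map /vec5 /= //;
  last by move: (cusp_4 _ _ _ _ _ _ _ _) => a; ring.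
4: by move: (cusp_3 _ _ _ _ _ _ _ _) => a; ring.
all: by move: (cusp_av _ _ _ _ _ _ _ _) (cusp_aw _ _ _ _ _ _ _ _) => a a'; ring.
Qed.

Variables e2 e3 : k.
Local Notation F := (cubic 0 1 0 e2 e3).

(** If the last coordinate is nonzero then so are [x], [A] and [f], the denominators in the
    construction of the conjugate points. *)
Lemma cusp_map_on v w : cusp_map e2 e3 v w i4 != 0 -> F.@[cusp_map e2 e3 v w] = 0.
Proof.
rewrite /cusp_map /= {1}/vec5 /= => z4; rewrite cuspE.
move: z4; set A := quad v; set b := bilin v w; set B := quad w.
set t := v i3; set x := v i4; set tau := w i3 => z4.
have [x0 A0 f0] : [/\ x != 0, A != 0 & cusp_f e2 e3 t x != 0].
  move: z4; rewrite /cusp_4 /cusp_Q1 /cusp_r /cusp_P !(mulf_eq0, expf_eq0, negb_or) /=.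
  by case: (x == 0) => //=; case: (A == 0); case: (cusp_f e2 e3 t x == 0);
    rewrite ?andbF ?andbT //= ?andbF.
rewrite -(@pencil_third _ char0 e2 e3 A b B t x tau x0 A0 f0) /pencil.
rewrite -/(cusp_3 e2 e3 A b B t x tau) -/(cusp_4 e2 e3 A b B t x tau); congr (_ * _ + _).
rewrite -/(cusp_X e2 e3 A b B t x tau) -/(cusp_Y e2 e3 A b B t x tau).
rewrite /cusp_av /cusp_aw /quad /vec5 /= /cusp_r /cusp_gram.
move: (cusp_X _ _ _ _ _ _ _ _) (cusp_Y _ _ _ _ _ _ _ _) => X Y.
by rewrite /A /b /B /bilin /quad; ring.
Qed.

Section Equivariance.
Variables (M : 'M[k]_5) (al : k).
Hypotheses (M3 : forall v, mulv M v i3 = al * v i3) (M4 : forall v, mulv M v i4 = v i4).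
Hypotheses (Mcol3 : forall i, i != i3 -> M i i3 = 0) (Mcol4 : forall i, i != i4 -> M i i4 = 0).
Hypothesis qM : forall v, quad (mulv M v) = al ^+ 3 * quad v.
Hypotheses (d2E : e2 = al ^+ 2 * e2) (d3E : e3 = al ^+ 3 * e3).

Lemma bilin_polar (u v : 'I_5 -> k) :
  bilin u v = quad (fun i => 1 * u i + 1 * v i) - quad u - quad v.
Proof. by rewrite /bilin /quad; ring. Qed.

(** Symmetries act on all ingredients of the construction through scalars. *)
Lemma cusp_map_equivariant v w i :
  cusp_map e2 e3 (mulv M v) (mulv M w) i = al ^+ 39 * mulv M (cusp_map e2 e3 v w) i.
Proof.
have bM : bilin (mulv M v) (mulv M w) = al ^+ 3 * bilin v w.
  rewrite !bilin_polar !mulrBr -!qM; congr (_ - _ - _).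
  by rewrite /quad !mulv_lin.
have h := @cusp_map_weight _ _ idfun al (al ^+ 3) 1 e2 e3 e2 e3 v w (mulv M v) (mulv M w).
apply: etrans (h _ _ _ _ _ _ _ _ _ _ _ erefl erefl i) _; rewrite ?mul1r ?mulr1 ?expr1n ?mulr1 //.
clear h; congr (_ * _); have row j : j != i3 -> j != i4 -> forall u, mulv M u j =
    M j i0 * u i0 + M j i1 * u i1 + M j i2 * u i2.
  by move=> j3 j4 u; rewrite mulvE Mcol3 // Mcol4 //; ring.
move: i; apply: ord5P; rewrite {1}/vec5 /= ?M3 ?M4 // !row //; rewrite /cusp_map /vec5 /=;
  move: (cusp_av _ _ _ _ _ _ _ _) (cusp_aw _ _ _ _ _ _ _ _) => a a'; ring.
Qed.

End Equivariance.
End CuspidalMapLaws.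

(** * Dominance by reflections, for the second family *)

Section Reflections.
Variable k : closedFieldType.
Hypothesis char0 : [pchar k] =i pred0.

(** The orthogonal reflection along [n], composed with the scalar [eta] on the first three
    coordinates. *)
Lemma quad_reflection (n : 'I_5 -> k) (eta : k) : quad n != 0 -> eta ^+ 2 = 1 ->
  exists M : 'M[k]_5,
  [/\ forall v, quad (mulv M v) = quad v, forall v, mulv M v i3 = v i3,
      forall v, mulv M v i4 = v i4, forall i, i != i3 -> M i i3 = 0 &
      forall i, i != i4 -> M i i4 = 0] /\
  forall v i, i != i3 -> i != i4 -> mulv M v i = eta * (v i - bilin n v / quad n * n i).
Proof.
move=> qn eta2; pose be v := bilin n v / quad n.
pose h v : 'I_5 -> k := vec5 (eta * (v i0 - be v * n i0)) (eta * (v i1 - be v * n i1))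
  (eta * (v i2 - be v * n i2)) (v i3) (v i4).
pose M : 'M[k]_5 := \matrix_(i, j) h (bvec k j) i.
have ME v i : mulv M v i = h v i.
  move: i; apply: ord5P; rewrite mulvE !mxE /h /vec5 /bvec /be /bilin /=; ring.
exists M; split; last first.
  by move=> v i i3n i4n; rewrite ME; move: i i3n i4n; apply: ord5P.
split=> [v|v|v|i|i]; rewrite ?ME //.
- rewrite {1}/quad !ME /h /vec5 /=; move: eta2; rewrite expr2 => eta2.
  transitivity (eta * eta * (quad v - be v * bilin n v + be v ^+ 2 * quad n)).
    by rewrite /quad /bilin; ring.
  by rewrite eta2 /be; field.
- move: i; apply: ord5P => // _; rewrite mxE /h /vec5 /bvec /be /bilin /=; ring.
- move: i; apply: ord5P => // _; rewrite mxE /h /vec5 /bvec /be /bilin /=; ring.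
Qed.

(** The reflection along [u - x] exchanges [u] and [x], that along [u + x] exchanges [u] and
    [- x]. The sum of [quad (u - x)] and [quad (u + x)] is [4 quad u], so one
    of the two reflections exists. *)
Lemma quad_transitive (u x : 'I_5 -> k) : quad u = quad x -> quad u != 0 ->
  u i3 = x i3 -> u i4 = x i4 ->
  exists M : 'M[k]_5,
  [/\ forall v, quad (mulv M v) = quad v, forall v, mulv M v i3 = v i3,
      forall v, mulv M v i4 = v i4, forall i, i != i3 -> M i i3 = 0 &
      forall i, i != i4 -> M i i4 = 0] /\ mulv M u =1 x.
Proof.
move=> qux qu u3 u4; have [n [eta [qn eta2 nE]]] : exists n eta, [/\ quad n != 0, eta ^+ 2 = 1 &
    forall i, eta * (u i - bilin n u / quad n * n i) = x i].
  have [q0|q0] := eqVneq (quad (fun i => u i - x i)) 0; last first.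
    exists (fun i => u i - x i), 1; split=> // [|i]; first by rewrite expr1n.
    have -> : bilin (fun i => u i - x i) u = quad (fun i => u i - x i).
      apply/eqP; rewrite -subr_eq0; apply/eqP.
      transitivity (quad u - quad x); last by rewrite qux subrr.
      by rewrite /bilin /quad; ring.
    by rewrite divff //; ring.
  have q1 : quad (fun i => u i + x i) != 0.
    apply: contraNneq qu => q1; have : 4%:R * quad u = 0.
      transitivity (quad (fun i => u i - x i) + quad (fun i => u i + x i) + 2%:R * (quad u - quad x)).
        by rewrite /quad; ring.
      by rewrite q0 q1 qux subrr; ring.
    by move=> /eqP; rewrite mulf_eq0 (negPf (natr_neq0 char0 3)).
  exists (fun i => u i + x i), (-1); split=> // [|i]; first by rewrite sqrrN expr1n.
  have -> : bilin (fun i => u i + x i) u = quad (fun i => u i + x i).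
    apply/eqP; rewrite -subr_eq0; apply/eqP.
    transitivity (quad u - quad x); last by rewrite qux subrr.
    by rewrite /bilin /quad; ring.
  by rewrite divff //; ring.
have [M [MP ME]] := quad_reflection qn eta2; exists M; split=> // i.
case: MP => _ M3 M4 _ _.
have [->|i3n] := eqVneq i i3; first by rewrite M3.
have [->|i4n] := eqVneq i i4; first by rewrite M4.
by rewrite ME // nE.
Qed.

End Reflections.

Section CuspidalDominance.
Variable k : closedFieldType.
Hypothesis char0 : [pchar k] =i pred0.
Variables e2 e3 : k.
Local Notation F := (cubic 0 1 0 e2 e3).

Lemma cusp_f_nonzero : exists t, cusp_f e2 e3 t 1 != 0.
Proof.
pose p : {poly k} := 'X^3 + (e2 *: 'X + e3%:P).
have p0 : p != 0.
  apply/eqP => /(congr1 (fun p : {poly k} => p`_3)).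
  rewrite !coefD coefZ coefXn coefX coefC coef0 /= mulr0 !addr0 => /eqP.
  by rewrite oner_eq0.
have [t tp] := elimT (closed_nonrootP p) p0; exists t.
move: tp; rewrite /root /p !hornerD hornerZ hornerXn hornerX hornerC.
by rewrite /cusp_f !expr1n !mulr1 addrA.
Qed.

(** It suffices to look for solutions with [b = 0], [x = tau = 1] and [Q0 = 0]. Put
    [r = 4 f ^ 2 rho]. Then [Q0 = 0] becomes [A (kap - rho) = - f rho], and the slope is [T] if
    and only if [A = - 4 rho ^ 2 (T + 2 t + rho)]. Eliminating [A] leaves
    a cubic equation for [rho], with solutions different from 0 and [kap] when [f <> 0]. *)
Lemma cusp_slope T : exists A B t,
  cusp_4 e2 e3 A 0 B t 1 1 != 0 /\ cusp_3 e2 e3 A 0 B t 1 1 = T * cusp_4 e2 e3 A 0 B t 1 1.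
Proof.
have [t ft] := cusp_f_nonzero; pose f := cusp_f e2 e3 t 1; pose d := cusp_df e2 t 1.
have n2 := two_neq0 char0; have n4 : 4%:R != 0 :> k := natr_neq0 char0 3.
pose kap := (d ^+ 2 - 12%:R * t * f) / (4%:R * f); pose S := T + 2%:R * t.
pose cf (i : nat) := [:: - (f / 4%:R); S * kap; kap - S]`_i.
have [rho] := @solve_monicpoly k 3 cf isT.
rewrite !big_ord_recl big_ord0 /cf /= expr0 expr1 => rhoE.
have {}rhoE : f = 4%:R * (S + rho) * (kap - rho) * rho.
  transitivity (4%:R * (S * kap * rho + (kap - S) * rho ^+ 2 - rho ^+ 3)); last by ring.
  by rewrite rhoE; field.
have [kr0 r0] : kap - rho != 0 /\ rho != 0.
  by split; apply: contraNneq ft => z; rewrite -/f rhoE z ?mulr0 ?mul0r.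
pose A := - (f * rho) / (kap - rho); pose B := f ^+ 2 * rho / A ^+ 2.
have A0 : A != 0 by rewrite /A mulf_neq0 ?invr_eq0 // oppr_eq0 mulf_neq0.
have BE : A ^+ 2 * B = f ^+ 2 * rho by rewrite /B mulrC divfK ?expf_neq0.
have rE : cusp_r A 0 B 1 = 4%:R * f ^+ 2 * rho.
  by transitivity (4%:R * (A ^+ 2 * B)); [rewrite /cusp_r /cusp_gram; ring | rewrite BE; ring].
have PE : cusp_P e2 e3 t 1 1 = 2%:R * f by rewrite /cusp_P mulr1.
have Q1E : cusp_Q1 A 0 B 1 = 8%:R * f ^+ 2 * rho by rewrite /cusp_Q1 rE; ring.
have Q0E : cusp_Q0 e2 e3 A 0 B t 1 1 = 0.
  have gE : cusp_gram A 0 B = - (4%:R * f * (kap - rho)).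
    apply: (mulfI A0); transitivity (cusp_r A 0 B 1); first by rewrite /cusp_r; ring.
    by rewrite rE /A; field.
  rewrite /cusp_Q0 rE PE gE /cusp_c -/f -/d /kap; by field; rewrite ft n4.
have c4E : cusp_4 e2 e3 A 0 B t 1 1 = (8%:R * f ^+ 2 * rho) ^+ 3 * (2%:R * f) ^+ 3.
  by rewrite /cusp_4 Q1E PE mulr1.
exists A, B, t; split.
  by rewrite c4E !(mulf_eq0, expf_eq0) /= (negPf (natr_neq0 char0 7)) (negPf n2) (negPf ft) (negPf r0).
rewrite c4E /cusp_3 /cusp_mu /cusp_p1 /cusp_m1 Q0E Q1E PE rE.
suff AE : A = - (4%:R * rho ^+ 2 * (S + rho)) by rewrite AE /S; ring.
by rewrite /A {1}rhoE; field.
Qed.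

(** By [cusp_slope] some value [z] of the map has the same ratio of the last two
    coordinates as [x]. After rescaling to equal last coordinates, the equation of the
    cubic shows that both have the same nonzero [quad], so a symmetry fixing the
    last two coordinates carries one to the other. *)
Lemma cusp_map_dominant x : F.@[x] = 0 -> x i4 * quad x != 0 ->
  exists v w, cusp_map e2 e3 v w i4 != 0 /\ proportional (cusp_map e2 e3 v w) x.
Proof.
move=> Fx; rewrite mulf_eq0 negb_or => /andP[x4 qx].
have [A [B [t [c4 c3]]]] := cusp_slope (x i3 / x i4).
have [sB sBE] := @nth_root k 2 B isT.
pose v : 'I_5 -> k := vec5 1 A 0 t 1; pose w : 'I_5 -> k := vec5 0 0 sB 1 0.
have [qv qw b0] : [/\ quad v = A, quad w = B & bilin v w = 0].
  by rewrite /quad /bilin /v /w /vec5 /=; split; rewrite -?sBE; ring.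
pose z := cusp_map e2 e3 v w.
have zE : z i3 = x i3 / x i4 * z i4 by rewrite /z /cusp_map qv qw b0 /v /w /vec5 /=.
have z4 : z i4 != 0 by rewrite /z /cusp_map qv qw b0 /v /w /vec5 /=.
have Fz : F.@[z] = 0 := cusp_map_on char0 z4.
(* The common last coordinate of [u] and [y] is [x_4 z_4]. *)
pose u i := x i4 * z i; pose y i := z i4 * x i.
have quy : quad u = quad y.
  have quadE p : F.@[p] = 0 -> p i4 * quad p = - cusp_f e2 e3 (p i3) (p i4).
    by move=> /eqP; rewrite cuspE addr_eq0 => /eqP.
  have u3 : u i3 = y i3 by rewrite /u /y zE; field.
  have u4 : u i4 = y i4 by rewrite /u /y mulrC.
  have y4 : y i4 != 0 by rewrite mulf_neq0.
  apply: (mulfI y4); rewrite (quadE y) ?cubic_scale ?Fx ?mulr0 // -u3 -u4.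
  by rewrite quadE // cubic_scale Fz mulr0.
have [|||M [[qM M3 M4 col3 col4] ME]] := @quad_transitive k char0 u y quy.
- have -> : quad u = z i4 ^+ 2 * quad x by rewrite quy /quad /y; ring.
  by rewrite mulf_neq0 ?expf_neq0.
- by rewrite /u /y zE; field.
- by rewrite /u /y mulrC.
have E i : cusp_map e2 e3 (mulv M v) (mulv M w) i = z i4 / x i4 * x i.
  have M3' u' : mulv M u' i3 = 1 * u' i3 by rewrite M3 mul1r.
  have qM' u' : quad (mulv M u') = 1 ^+ 3 * quad u' by rewrite qM expr1n mul1r.
  have d2E : e2 = 1 ^+ 2 * e2 by rewrite expr1n mul1r.
  have d3E : e3 = 1 ^+ 3 * e3 by rewrite expr1n mul1r.
  rewrite (cusp_map_equivariant M3' M4 col3 col4 qM' d2E d3E) expr1n mul1r.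
  apply: (mulfI x4); rewrite -mulv_scale -/z -/u ME /y; by field.
exists (mulv M v), (mulv M w); split; first by rewrite E divfK.
by exists (z i4 / x i4); rewrite // mulf_neq0 ?invr_eq0.
Qed.

End CuspidalDominance.

(** * The two families *)

Section Covariants.
Variable k : closedFieldType.
Hypothesis char0 : [pchar k] =i pred0.
Variables s r e1 e2 e3 : k.
Hypothesis sr : (s == 1) && (r == 0) || [&& s == 0, r == 1 & e1 == 0].
Local Notation F := (cubic s r e1 e2 e3).
Local Notation X := {p : proj k 5 | hypersurface F p}.
Hypothesis reps : forall f, map_on_cone s r e1 e2 e3 f ->
    exists C d, global_rep s r e1 e2 e3 C d f.
Variables (n : nat) (pi0 : 'I_5 -> {mpoly k[n]}).
Hypothesis ch0 : chart s r e1 e2 e3 i0 pi0.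
Variables (gT : finGroupType) (a : gT -> X -> X).
Hypothesis ha : finite_subgroup_of_Aut a.
Variable psi : ('I_5 -> k) -> ('I_5 -> k) -> 'I_5 -> k.
Variables (Psi : 'I_5 -> {mpoly k[5 + 5]}) (D : nat).
Hypothesis Psi_eval : forall y i,
  (Psi i).@[y] = psi (fun j => y (lshift 5 j)) (fun j => y (rshift 5 j)) i.
(* The degree is written [D.+1] because [psi] has to vanish at the origin. *)
Hypothesis psi_scale : forall v w c i,
  psi (fun j => c * v j) (fun j => c * w j) i = c ^+ D.+1 * psi v w i.
Hypothesis psi_on : forall v w, psi v w i4 != 0 -> F.@[psi v w] = 0.
Hypothesis psi_equivariant : forall (M : 'M[k]_5) c, M \in unitmx ->
  (forall v, F.@[mulv M v] = c * F.@[v]) -> M i4 i4 = 1 ->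
  exists2 b, b != 0 & forall v w i, psi (mulv M v) (mulv M w) i = b * mulv M (psi v w) i.
Variables (m : {mpoly k[5]}) (l : nat) (v0 : 'I_5 -> k).
Hypotheses (hm : m \is l.-homog) (Fv0 : F.@[v0] = 0) (mv0 : m.@[v0] != 0).
Hypothesis psi_dominant : forall x, F.@[x] = 0 -> m.@[x] != 0 ->
  exists v w, psi v w i4 != 0 /\ proportional (psi v w) x.

(** The representation is two copies of the one given by [group_matrices]. *)
Lemma covariant_unirational : G_unirational a.
Proof.
have [M [uM M44 FM Ma rM]] := group_matrices char0 sr reps ha.
have homPsi i : Psi i \is D.+1.-homog.
  by apply: homog_of_scaling => c y; rewrite !Psi_eval psi_scale.
have evE y : (fun i => (Psi i).@[y]) = psi (fun j => y (lshift 5 j)) (fun j => y (rshift 5 j)).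
  by apply: functional_extensionality => i; rewrite Psi_eval.
have glue v w : exists y : 'I_(5 + 5) -> k,
    (fun j => y (lshift 5 j)) = v /\ (fun j => y (rshift 5 j)) = w.
  exists (fun j => match split j with inl j1 => v j1 | inr j2 => w j2 end).
  by split; apply: functional_extensionality => j; rewrite (unsplitK (inl _), unsplitK (inr _)).
apply: (@unirational_criterion k s r e1 e2 e3 n pi0 ch0 gT a M Ma (5 + 5)
  (MxRepresentation (double_mx_repr rM)) Psi D.+1 (Psi i4) D.+1 homPsi (homPsi i4) _ _ _ m l v0) => //.
- by move=> y y4; exists i4.
- by move=> y; rewrite evE Psi_eval; apply: psi_on.
- move=> g y; have [c Mc] := FM g; have [b b0 bE] := psi_equivariant (uM g) Mc (M44 g).
  exists b => // i; have [yl yr] := mulv_double M g y.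
  rewrite Psi_eval evE -bE; congr (psi _ _ _); exact: functional_extensionality.
move=> x Fx mx; have [v [w [z4 zx]]] := psi_dominant Fx mx; have [y [yv yw]] := glue v w.
exists y; rewrite evE Psi_eval yv yw; split=> //.
have [[j yj]|y0] := classic (nonzero y); first by exists j.
case/negP: z4; have y0' : y = fun=> 0.
  apply: functional_extensionality => j; apply/eqP; apply: contra_notT y0 => yj; by exists j.
rewrite -yv -yw y0'; have := psi_scale (fun=> 0) (fun=> 0) 0 i4.
by rewrite exprS !mul0r => ->.
Qed.

End Covariants.

Section TwoFamilies.
Variable k : closedFieldType.
Hypothesis char0 : [pchar k] =i pred0.
Variable gT : finGroupType.
Local Notation X F := {p : proj k 5 | hypersurface F p}.

Lemma toric_unirational (e1 e2 e3 : k) (a : gT -> X (cubic 1 0 e1 e2 e3) -> X (cubic 1 0 e1 e2 e3)) :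
  finite_subgroup_of_Aut a -> G_unirational a.
Proof.
have sr : ((1 : k) == 1) && ((0 : k) == 0) || [&& (1 : k) == 0, (0 : k) == 1 & e1 == 0].
  by rewrite !eqxx.
pose vl j : {mpoly k[5 + 5]} := 'X_(lshift 5 j); pose vr j : {mpoly k[5 + 5]} := 'X_(rshift 5 j).
move=> ha; apply: (@covariant_unirational k char0 1 0 e1 e2 e3 sr _ _ _
    (chart_swap (toric_chart char0 e1 e2 e3)) gT a ha (toric_map e1 e2 e3)
    (toric_map e1%:MP e2%:MP e3%:MP vl vr) 9 _ _ _ _ ('X_i1 * 'X_i2 * 'X_i4) 3
    (vec5 (- (1 + e3)) 1 1 0 1)).
- exact: toric_global_rep.
- move=> y i; rewrite toric_map_eval; congr (toric_map _ _ _ _ _ _);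
    by apply: functional_extensionality => j; rewrite mevalXU.
- by move=> v w c i; rewrite toric_map_scale.
- by move=> v w _; apply: toric_map_on.
- move=> M c uM FM M44; exists (c ^+ 4).
    by rewrite expf_neq0 // (scaling_neq0 sr uM FM).
  move=> v w i; apply: (toric_map_equivariant FM).
  + exact: (hyperplane_coord char0 sr uM FM M44).
  + by have [_ ? _ _ _] := symmetry_columns char0 sr uM FM M44.
  have [col3 col4 _ _ _] := symmetry_columns char0 sr uM FM M44.
  have [r20 r21 r02 r12] := symmetry_row2 char0 sr uM FM M44 erefl.
  have [a0 b0] := plane_rows char0 sr uM FM (j := i0) isT.
  have [a1 b1] := plane_rows char0 sr uM FM (j := i1) isT.
  have [a2 b2] := plane_rows char0 sr uM FM (j := i2) isT.
  have b3 := hyperplane_row char0 sr uM FM.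
  have [c03 c13 c23] := And3 (col3 i0 isT) (col3 i1 isT) (col3 i2 isT).
  have [c04 c14 c24 c34] := And4 (col4 i0 isT) (col4 i1 isT) (col4 i2 isT) (col4 i3 isT).
  move=> u; apply: ord5P; rewrite /plane_part /vec5 /= !mulvE /= ?r20 ?r21 ?r02 ?r12 ?a0 ?a1 ?a2
    ?b0 ?b1 ?b2 ?b3 ?c03 ?c13 ?c23 ?c04 ?c14 ?c24 ?c34; ring.
- have X1 i : ('X_i : {mpoly k[5]}) \is 1.-homog by rewrite dhomogX /= mdeg1.
  exact: (dhomogM (dhomogM (X1 _) (X1 _)) (X1 _)).
- by rewrite cubicE /curve_form /vec5 /=; ring.
- by rewrite !mevalM !mevalXU /vec5 /= !mulr1 oner_neq0.
move=> x Fx; rewrite !mevalM !mevalXU => mx.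
have [v [c [c0 cE]]] := toric_map_dominant Fx mx; exists v, x; split; last by exists c.
by rewrite cE mulf_neq0 //; apply: contraNneq mx => ->; rewrite mulr0.
Qed.

Lemma cuspidal_unirational (e2 e3 : k) (a : gT -> X (cubic 0 1 0 e2 e3) -> X (cubic 0 1 0 e2 e3)) :
  finite_subgroup_of_Aut a -> G_unirational a.
Proof.
have sr : ((0 : k) == 1) && ((1 : k) == 0) || [&& (0 : k) == 0, (1 : k) == 1 & (0 : k) == 0].
  by rewrite !eqxx orbT.
pose vl j : {mpoly k[5 + 5]} := 'X_(lshift 5 j); pose vr j : {mpoly k[5 + 5]} := 'X_(rshift 5 j).
have [t ft] := cusp_f_nonzero e2 e3.
move=> ha; apply: (@covariant_unirational k char0 0 1 0 e2 e3 sr _ _ _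
    (chart_swap (cuspidal_chart char0 e2 e3)) gT a ha (cusp_map e2 e3)
    (cusp_map e2%:MP e3%:MP vl vr) 39 _ _ _ _
    ('X_i4 * ('X_i0 * 'X_i1 + 'X_i2 * 'X_i2)) 3
    (vec5 (- cusp_f e2 e3 t 1) 1 0 t 1)).
- exact: cuspidal_global_rep.
- move=> y i; rewrite cusp_map_eval; congr (cusp_map _ _ _ _ _);
    by apply: functional_extensionality => j; rewrite mevalXU.
- by move=> v w c i; rewrite cusp_map_scale.
- by move=> v w; apply: cusp_map_on.
- move=> M c uM FM M44; have al0 := diag3_neq0 char0 sr uM FM M44.
  have [col3 col4 cE d2 d3] := symmetry_columns char0 sr uM FM M44.
  have {}cE : c = M i3 i3 ^+ 3 by case: cE => // /eqP; rewrite oner_eq0.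
  exists (M i3 i3 ^+ 39); first by rewrite expf_neq0.
  move=> v w i; apply: cusp_map_equivariant => //.
  + by move=> u; rewrite (coord3 char0 sr uM FM) col4 // mul0r addr0.
  + exact: (hyperplane_coord char0 sr uM FM M44).
  + move=> u; rewrite -cE -(symmetry_quadric char0 sr uM FM M44) /quad.
    by rewrite !mulvE /plane_pt /vec5 /= !col3 // !col4 //; ring.
  + apply: (mulIf al0); rewrite d2 cE; ring.
  by rewrite -cE.
- have X1 i : ('X_i : {mpoly k[5]}) \is 1.-homog by rewrite dhomogX /= mdeg1.
  by apply: (dhomogM (X1 _) (_ : _ \is 2.-homog)); apply: rpredD; apply: (dhomogM (X1 _) (X1 _)).
- by rewrite cuspE /quad /vec5 /=; ring.
- rewrite !mevalM !mevalD !mevalM !mevalXU /vec5 /= mul1r mulr1 mulr0 addr0 oppr_eq0.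
  exact: ft.
move=> x Fx; rewrite !mevalM mevalD !mevalM !mevalXU -expr2; exact: cusp_map_dominant.
Qed.

End TwoFamilies.

Lemma x_E (k : closedFieldType) :
  [/\ x_ k 1 = 'X_i0, x_ k 2 = 'X_i1, x_ k 3 = 'X_i2, x_ k 4 = 'X_i3 & x_ k 5 = 'X_i4].
Proof. by split; congr ('X_ _); apply: val_inj; rewrite /= inordK. Qed.

Lemma cubic1E (k : closedFieldType) (e1 e2 e3 : k) : cubic1 e1 e2 e3 = cubic 1 0 e1 e2 e3.
Proof.
rewrite /cubic1 /cubic /curve_form -!mul_mpolyC mpolyC1 mpolyC0.
by have [-> -> -> -> ->] := x_E k; ring.
Qed.

Lemma cubic2E (k : closedFieldType) (e1 e2 : k) : cubic2 e1 e2 = cubic 0 1 0 e1 e2.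
Proof.
rewrite /cubic2 /cubic /curve_form -!mul_mpolyC mpolyC1 mpolyC0.
by have [-> -> -> -> ->] := x_E k; ring.
Qed.

Theorem theorem4p5 (k : closedFieldType) (char0 : [pchar k] =i pred0)
    (F : {mpoly k[5]})
    (hF : (exists e1 e2 e3 : k, F = cubic1 e1 e2 e3) \/
          (exists e1 e2 : k, F = cubic2 e1 e2))
    (gT : finGroupType)
    (a : gT -> {p : proj k 5 | hypersurface F p} ->
               {p : proj k 5 | hypersurface F p})
    (ha : finite_subgroup_of_Aut a) :
  G_unirational a.
Proof.
case: hF => [[e1 [e2 [e3 FE]]]|[e1 [e2 FE]]]; subst F.
  move: a ha; rewrite cubic1E; exact: toric_unirational.
move: a ha; rewrite cubic2E; exact: cuspidal_unirational.
Qed.
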